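(* Let $B=\{x\in\mathbb{E}^2:\|x\|\le 1\}$ and $0\le\lambda\le 1$. Then $$\delta_\lambda(B)=\delta_\lambda^*(B)=\begin{cases}\dfrac{\pi}{\sqrt{12}}, & \text{if } 0\le\lambda\le\frac{\sqrt3}{2},\\[2mm] \dfrac{\pi}{4\lambda}, & \text{if } \frac{\sqrt3}{2}\le\lambda\le 1.\end{cases}$$ Furthermore, for $0\le\lambda\le\frac{\sqrt3}{2}$ (respectively, $\frac{\sqrt3}{2}\le\lambda\le1$), the lattice packing of unit disks whose Delaunay triangles are congruent to $T^e_{reg}(1)$ (respectively, to $T^e\big(\sqrt{2-2\sqrt{1-\lambda^2}}\big)$) is a $\lambda$-separable packing with density $\delta_\lambda(B)$.
   Context: $\mathbb{E}^2$ is the Euclidean plane. A packing of disks is a family of disks with pairwise disjoint interiors. For $0\le\lambda\le\rho$, a packing $\mathcal P$ of disks of radius $\rho>0$ is called $\lambda$-separable if the family $\mathcal P'$ of disks of radius $\lambda$ concentric to the disks of $\mathcal P$ is totally separable, i.e. any two disks of $\mathcal P'$ can be separated by a line which is disjoint from the interior of every disk of $\mathcal P'$. (Two disks are separated by a line if they lie in different closed half planes bounded by it.) Unit disks have radius $\rho=1$. $\delta_\lambda(B)$ (resp. $\delta^*_\lambda(B)$) is the largest density of $\lambda$-separable packings of unit disks (resp. of $\lambda$-separable lattice packings of unit disks, i.e. those whose centers form a $2$-dimensional lattice) in $\mathbb{E}^2$, that is, the largest fraction of $\mathbb{E}^2$ covered by such packings. $T^e_{reg}(1)$ is the regular triangle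 of edge length $2$. For $0<\lambda<y$, put $x^e(y)=\frac{y^2}{2\sqrt{y^2-\lambda^2}}$; $T^e(y)$ is the isosceles triangle with edge lengths $2y,\,2x^e(y),\,2x^e(y)$. The Delaunay decomposition of a packing is the Delaunay decomposition defined by the set $X$ of centers: the locally finite edge-to-edge tiling of $\operatorname{conv}(X)$ by convex polygons with vertices in $X$ such that the circumdisk of each tile contains no point of $X$ in its interior and only the vertices of the tile on its boundary. Its triangular cells are the Delaunay triangles; a non-triangular Delaunay cell is understood to be dissected into triangles by diagonals (needed only for $\lambda=1$, where the cells are squares and the triangle $T^e(\sqrt2)$ is half a square). *)

(* Defs.v *)
From mathcomp Require Import all_boot all_order all_algebra.
From mathcomp Require Import all_classical all_reals all_analysis.

Set Implicit Arguments.
Unset Strict Implicit.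
Unset Printing Implicit Defensive.

Import Order.TTheory GRing.Theory Num.Theory.
Import numFieldNormedType.Exports.

Local Open Scope classical_set_scope.
Local Open Scope ring_scope.

(* The Euclidean plane is [R * R]. The norm that MathComp-Analysis puts on a
   product is the maximum norm, so the Euclidean distance is written out; the
   topology ([interior], written [A°]) is the usual one, and area is the product
   of two copies of the one-dimensional Lebesgue measure. *)

Definition edist (R : realType) (p q : R * R) : R :=
  Num.sqrt ((p.1 - q.1) ^+ 2 + (p.2 - q.2) ^+ 2).

Definition disk (R : realType) (c : R * R) (r : R) : set (R * R) :=
  [set p | edist p c <= r].

Definition area (R : realType) (A : set (R * R)) : \bar R :=
  (@lebesgue_measure R \x @lebesgue_measure R)%E A.

(* The line [a.1 x + a.2 y = b] (for [a != 0]) and its two closed half planes. *)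
Definition line (R : realType) (a : R * R) (b : R) : set (R * R) :=
  [set p | a.1 * p.1 + a.2 * p.2 = b].

Definition half_le (R : realType) (a : R * R) (b : R) : set (R * R) :=
  [set p | a.1 * p.1 + a.2 * p.2 <= b].

Definition half_ge (R : realType) (a : R * R) (b : R) : set (R * R) :=
  [set p | b <= a.1 * p.1 + a.2 * p.2].

(* A packing of disks of radius [rho > 0] has pairwise distinct centers, so it is
   given by its set [X] of centers. *)
Definition packing (R : realType) (rho : R) (X : set (R * R)) : Prop :=
  trivIset X (fun c => (disk c rho)°).

Definition totally_separable (R : realType) (lam : R) (X : set (R * R)) : Prop :=
  forall c d : R * R, X c -> X d -> c <> d ->
  exists (a : R * R) (b : R),
    [/\ a != 0,
        disk c lam `<=` half_le a b /\ disk d lam `<=` half_ge a b &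
        forall e : R * R, X e -> line a b `&` (disk e lam)° = set0].

Definition separable_packing (R : realType) (lam rho : R) (X : set (R * R)) :
    Prop :=
  packing rho X /\ totally_separable lam X.

Definition lattice (R : realType) (X : set (R * R)) : Prop :=
  exists u v : R * R,
    u.1 * v.2 - u.2 * v.1 != 0 /\
    X = [set p | exists m n : int, p = u *~ m + v *~ n].

(* The fraction of the disk of radius [r] about the origin covered by the disks
   of radius [rho] centered at the points of [X]. *)
Definition covered_fraction (R : realType) (rho : R) (X : set (R * R)) (r : R) :
    R :=
  fine (area ((\bigcup_(c in X) disk c rho) `&` disk 0 r)) /
  fine (area (disk (0 : R * R) r)).

Definition upper_density (R : realType) (rho : R) (X : set (R * R)) : \bar R :=
  limf_esup (fun r : R => (covered_fraction rho X r)%:E) +oo.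

Definition has_density (R : realType) (rho : R) (X : set (R * R)) (d : \bar R) :
    Prop :=
  (covered_fraction rho X r)%:E @[r --> +oo] --> d.

Definition delta (R : realType) (lam : R) : \bar R :=
  ereal_sup (upper_density 1 @` [set X | separable_packing lam 1 X]).

Definition delta_lattice (R : realType) (lam : R) : \bar R :=
  ereal_sup
    (upper_density 1 @` [set X | separable_packing lam 1 X /\ lattice X]).

Definition hull (R : realType) (A : set (R * R)) : set (R * R) :=
  smallest (fun C => @convex_set R (R * R)%type C) A.

(* A convex polygon (triangles included) is represented by the set [V] of its
   vertices; the polygon itself is [hull V]. *)
Definition polygon (R : realType) (V : set (R * R)) : Prop :=
  [/\ finite_set V,
      (hull V)° !=set0 &
      forall v : R * R, V v -> ~ hull (V `\ v) v].

(* In [delaunay_edge], given that the tiles have disjoint interiors, the last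
   equation says that two tiles meet in nothing, a common vertex or a common
   edge. *)
Record delaunay (R : realType) (X : set (R * R)) (D : set (set (R * R))) : Prop :=
  Delaunay {
    delaunay_tile : forall V, D V -> polygon V /\ V `<=` X;
    delaunay_cover : \bigcup_(V in D) hull V = hull X;
    delaunay_edge : forall V W, D V -> D W -> V <> W ->
      (hull V)° `&` (hull W)° = set0 /\ hull V `&` hull W = hull (V `&` W);
    delaunay_finite : forall r : R,
      finite_set [set V | D V /\ hull V `&` disk 0 r !=set0];
    delaunay_circum : forall V, D V -> exists (c : R * R) (r : R),
      [/\ forall v, V v -> edist v c = r,
          forall x, X x -> ~ (edist x c < r) &
          forall x, X x -> edist x c = r -> V x]
  }.

(* [S] is a dissection by diagonals of the polygon with vertex set [V] into
   triangles; if [V] is a triangle, this forces [S = [set V]]. *)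
Definition dissection (R : realType) (V : set (R * R)) (S : set (set (R * R))) :
    Prop :=
  [/\ forall t, S t -> t `<=` V /\ (t #= `I_3)%card,
      \bigcup_(t in S) hull t = hull V &
      trivIset S (fun t => (hull t)°)].

(* [S] is a possible set of Delaunay triangles of [X]; it is not determined by
   [X] when there are non-triangular cells. *)
Definition delaunay_triangles (R : realType) (X : set (R * R))
    (S : set (set (R * R))) : Prop :=
  exists D : set (set (R * R)),
    [/\ delaunay X D,
        forall t, S t -> exists2 V, D V & t `<=` V &
        forall V, D V -> dissection V [set t | S t /\ t `<=` V]].

Definition congruent (R : realType) (A B : set (R * R)) : Prop :=
  exists f : R * R -> R * R,
    (forall p q, edist (f p) (f q) = edist p q) /\ f @` A = B.

(* A triangle with given edge lengths is determined up to congruence only, so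
   [triangle], [Te_reg] and [Te] are the classes of all copies. *)
Definition triangle (R : realType) (a b c : R) : set (set (R * R)) :=
  [set t | exists p q s : R * R,
    [/\ t = [set p; q; s], edist p q = a, edist q s = b & edist s p = c]].

Definition Te_reg (R : realType) (y : R) : set (set (R * R)) :=
  triangle (2 * y) (2 * y) (2 * y).

Definition xe (R : realType) (lam y : R) : R :=
  y ^+ 2 / (2 * Num.sqrt (y ^+ 2 - lam ^+ 2)).

Definition Te (R : realType) (lam y : R) : set (set (R * R)) :=
  triangle (2 * y) (2 * xe lam y) (2 * xe lam y).

Definition delaunay_congruent (R : realType) (X : set (R * R))
    (T : set (set (R * R))) : Prop :=
  exists2 t0, T t0 &
  exists2 S, delaunay_triangles X S & forall t, S t -> congruent t t0.

(* A lattice packing of unit disks whose Delaunay triangles are congruent to [T]. *)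
Definition delaunay_lattice_packing (R : realType) (T : set (set (R * R)))
    (X : set (R * R)) : Prop :=
  [/\ lattice X, packing 1 X & delaunay_congruent X T].

(* Main.v *)
(* Let [K] be twice the least area of a non-obtuse triangle of centers. Total
   separability gives [K >= 4 lam], because the line that separates a suitable
   vertex from the other two keeps an altitude at least [2 lam]; the packing
   condition alone gives [K >= sqrt 12].

   Upper bound: saturate the centers in a large disk and triangulate them by
   (perturbed) Delaunay triangles, so that the circumradii squared are below 5. An obtuse
   triangle may have area less than [K / 2], but its deficit is bounded by a linear
   function of its longest side and is paid by the neighbour across that side; the
   Delaunay property stops such debts from cascading. Since there are two triangles
   per vertex, each center takes at least area [K].

   Lattices: for [|u| = |v| = 2] and [u . v = 4 h] with [0 <= h <= 1/2] the lattice
   spanned by [u], [v] has determinant [4 lam] with [lam^2 = 1 - h^2] and is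
   [lam]-separable by lines parallel to [u] and [v]. Its Delaunay cells are the
   translates of the triangles [0, u, v] and [u, v, u + v] (merged to a rhombus when
   [h = 0]). Conversely a triangle of lattice points with empty circumdisk
   spans the lattice, so the Delaunay triangles determine the lattice. *)

Require Import Defs.
From mathcomp Require Import all_boot all_order all_algebra.
From mathcomp Require Import all_classical all_reals all_analysis.
From mathcomp Require Import measurable_realfun zify ring lra.

Set Implicit Arguments.
Unset Strict Implicit.
Unset Printing Implicit Defensive.

Import Order.TTheory GRing.Theory Num.Theory.
Import numFieldNormedType.Exports.

Local Open Scope classical_set_scope.
Local Open Scope ring_scope.

(** No theory of triangulations is used. The heights [nsq (y i)] are perturbed by distinct powers of
    a small number, so that no four lifts over a proper triangle are coplanar. Regular triangles are
    then lower facets of the lifted points: an oriented edge carries at most one, and different ones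
    are disjoint. Two triangles per vertex come without Euler's formula: for a generic direction [w]
    each triangle has one vertex between the other two, and an inner vertex plays this role in the
    triangle ahead of it along [w] and in the one behind. The constants fit tightly. Squared sides
    5, 5, 4 give [det3] equal to 4, the largest [K] that occurs, so saturating at squared distance 5
    preserves the lower bound [K]. Squared circumradii are then below 5 and squared sides at most
    20. In this range an obtuse triangle with longest squared side [w] lacks at most [(w - 8) / 6],
    and a triangle has room for all such demands across its sides. *)

Local Notation edist := Defs.edist.

(** * Areas of triangles, parallelograms and disks *)

Section area.
Context {R : realType}.
Local Notation mu := (@lebesgue_measure R).
Local Notation pt := (measurableTypeR R * measurableTypeR R)%type.
Implicit Types A : set pt.

Lemma measurable_affine (k c : R) :
  measurable_fun setT (fun y : measurableTypeR R => k * y + c : measurableTypeR R).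
Proof. by apply: measurable_funD => //; exact: measurable_funM. Qed.

(** Uniqueness of Lebesgue measure: for [0 < k], the measure of preimages multiplied by [k] has the
    right value on half-open intervals. Negative slopes reduce to this by reflection. *)
Lemma lebesgue_measure_affine (k c : R) (A : set (measurableTypeR R)) : k != 0 -> measurable A ->
  mu ((fun y : measurableTypeR R => k * y + c : measurableTypeR R) @^-1` A) = (`|k|^-1%:E * mu A)%E.
Proof.
wlog k0 : k / 0 < k => [hw kn0 mA|_ mA].
  have /orP[k0|k0] := lt_total kn0; last exact: hw.
  have mB : measurable ((fun y : measurableTypeR R => - k * y + c : measurableTypeR R) @^-1` A).
    by rewrite -[X in measurable X]setTI; exact: measurable_affine.
  rewrite -normrN -hw ?oppr_eq0 ?oppr_gt0// -[RHS]lebesgue_measureN// /pushforward.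
  by congr (mu _); apply/seteqP; split => y /=; rewrite mulrNN.
rewrite gtr0_norm//.
pose f := fun y : measurableTypeR R => k * y + c : measurableTypeR R.
have mf : measurable_fun setT f by exact: measurable_affine.
have k'0 : 0 <= k by exact: ltW.
pose m' : {measure set (measurableTypeR R) -> \bar R} :=
  mscale (NngNum k'0) (pushforward mu f).
have H : mu A = m' mf A.
  apply: lebesgue_measure_unique => // _ [[a b]] _ <-.
  rewrite /m' /= /mscale /= /pushforward.
  have -> : f @^-1` `]a, b]%classic = `](a - c) / k, (b - c) / k]%classic.
    apply/seteqP; split=> y /=; rewrite !in_itv /= ltr_pdivrMr// ler_pdivlMr// /f => /andP[h1 h2]; apply/andP; split; lra.
  rewrite !lebesgue_measure_itv /= !lte_fin.
  rewrite ltr_pM2r ?invr_gt0// ltrD2r.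
  case: ifPn => _; last by rewrite mule0.
  rewrite -EFinB -EFinM; congr (_%:E); field; lra.
rewrite H /m' /= /mscale /= /pushforward muleA -EFinM mulVf ?mul1e//; lra.
Qed.

Lemma area_xsection (A : set pt) : area A = (\int[mu]_x mu (xsection A x))%E.
Proof. by []. Qed.

Lemma area_ysection (A : set pt) : measurable A ->
  area A = (\int[mu]_y mu (ysection A y))%E.
Proof.
move=> mA; rewrite /area.
apply: (product_measure_unique _ _ (m' := (mu \x^ mu)%E)) => // B C mB mC.
exact: product_measure2E.
Qed.

Lemma area_vertical (k : R) (f : R -> R) (A : set pt) : k != 0 ->
  measurable_fun setT (f : measurableTypeR R -> measurableTypeR R) -> measurable A ->
  area ((fun p : pt => (p.1, k * p.2 + f p.1) : pt) @^-1` A) = (`|k|^-1%:E * area A)%E.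
Proof.
move=> k0 mf mA; rewrite !area_xsection.
rewrite -ge0_integralZl ?lee_fin ?invr_ge0//; last exact: measurable_fun_xsection.
apply: eq_integral => x _; rewrite -(lebesgue_measure_affine (f x) k0).
  by congr (mu _); apply/seteqP; split=> y; rewrite /xsection/= !inE.
exact: measurable_xsection.
Qed.

Lemma area_horizontal (k : R) (f : R -> R) (A : set pt) : k != 0 ->
  measurable_fun setT (f : measurableTypeR R -> measurableTypeR R) -> measurable A ->
  area ((fun p : pt => (k * p.1 + f p.2, p.2) : pt) @^-1` A) = (`|k|^-1%:E * area A)%E.
Proof.
move=> k0 mf mA; rewrite !area_ysection//; last first.
  rewrite -[X in measurable X]setTI; apply: measurable_fun_pair => //=.
  apply: measurable_funD; first exact: measurable_funM.
  exact: measurableT_comp.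
rewrite -ge0_integralZl ?lee_fin ?invr_ge0//; last exact: measurable_fun_ysection.
apply: eq_integral => x _; rewrite -(lebesgue_measure_affine (f x) k0).
  by congr (mu _); apply/seteqP; split=> y; rewrite /ysection/= !inE.
exact: measurable_ysection.
Qed.

Lemma measurable_affine2 (a b e : R) :
  measurable_fun setT (fun p : pt => a * p.1 + b * p.2 + e : measurableTypeR R).
Proof.
apply: measurable_funD => //; apply: measurable_funD; apply: measurable_funM => //.
Qed.

(** For [a != 0] the map is a horizontal shear with scaling followed by a vertical one, both handled
    by sections. If [a = 0], splitting off the shear [(x, x + y)] leaves a map with leading
    coefficient [- b]. *)
Lemma area_affine (a b c d e f : R) (A : set pt) : a * d - b * c != 0 -> measurable A ->
  area ((fun p : pt => (a * p.1 + b * p.2 + e, c * p.1 + d * p.2 + f) : pt) @^-1` A) =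
  (`|a * d - b * c|^-1%:E * area A)%E.
Proof.
wlog a0 : a b c d e f A / a != 0 => [hw D0 mA|D0 mA].
  have [a0|] := eqVneq a 0; last by move=> ?; exact: hw.
  have b0 : b != 0 by apply: contraNneq D0 => ->; rewrite a0; apply/eqP; lra.
  have mB : measurable ((fun p : pt => (- b * p.1 + b * p.2 + e, (c - d) * p.1 + d * p.2 + f) : pt) @^-1` A).
    rewrite -[X in measurable X]setTI; apply: measurable_fun_pair => //; exact: measurable_affine2.
  have -> : a * d - b * c = - b * d - b * (c - d) by rewrite a0; ring.
  have b0' : - b != 0 by rewrite oppr_eq0.
  have D1 : - b * d - b * (c - d) != 0 by apply: contraNneq D0 => h; rewrite a0; apply/eqP; lra.
  have <- := hw (- b) b (c - d) d e f A b0' D1 mA.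
  have := @area_vertical 1 (fun x => 1 * x + 0) _ (oner_neq0 _) (measurable_affine 1 0) mB.
  rewrite normr1 invr1 mul1e => <-; congr (area _).
  by apply/seteqP; split=> p; congr (A (_, _)); rewrite /= ?a0; ring.
pose k := (a * d - b * c) / a; pose g := fun x => (c / a) * x + (f - c * e / a).
have k0 : k != 0 by rewrite mulf_neq0// invr_neq0.
have mB : measurable ((fun p : pt => (p.1, k * p.2 + g p.1) : pt) @^-1` A).
  rewrite -[X in measurable X]setTI; apply: measurable_fun_pair => //.
  rewrite (_ : (fun p : pt => _ : measurableTypeR R) = fun p : pt => (c / a) * p.1 + k * p.2 + (f - c * e / a)).
    exact: measurable_affine2.
  by apply/funext => p; rewrite /g; ring.
have := @area_horizontal a (fun x => b * x + e) _ a0 (measurable_affine b e) mB.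
rewrite (area_vertical k0)//; last exact: measurable_affine.
have -> : (`|a|^-1%:E * (`|k|^-1%:E * area A) = `|a * d - b * c|^-1%:E * area A)%E.
  rewrite muleA -EFinM -invfM -normrM; congr ((_ ^-1)%:E * _)%E.
  by rewrite /k mulrC divfK.
move=> <-; congr (area _).
by apply/seteqP; split=> p; congr (A (_, _)); rewrite /= /k /g; field.
Qed.

Lemma measurable_gt0 (f : pt -> R) : measurable_fun setT (f : pt -> measurableTypeR R) ->
  measurable [set p | 0 < f p].
Proof.
move=> mf; rewrite (_ : [set p | _] = setT `&` f @^-1` `]0, +oo[%classic); first exact: mf.
by rewrite setTI; apply/seteqP; split => p /=; rewrite in_itv /= andbT.
Qed.

Lemma measurable_ge0 (f : pt -> R) : measurable_fun setT (f : pt -> measurableTypeR R) ->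
  measurable [set p | 0 <= f p].
Proof.
move=> mf; rewrite (_ : [set p | _] = setT `&` f @^-1` `[0, +oo[%classic); first exact: mf.
by rewrite setTI; apply/seteqP; split => p /=; rewrite in_itv /= andbT.
Qed.

Lemma area0 : area (set0 : set pt) = 0%E. Proof. exact: measure0. Qed.

Lemma le_area (A B : set pt) : measurable A -> measurable B -> A `<=` B -> (area A <= area B)%E.
Proof. by move=> mA mB; apply: le_measure; rewrite inE. Qed.

Lemma area_rectangle : area (`[(0:R), (1:R)[ `*` `[(0:R), 1[ : set pt)%classic = 1%E.
Proof.
rewrite /area product_measure1E//=; have -> : mu `[0, 1[ = 1%E by rewrite lebesgue_measure_itv /= lte_fin ltr01 -EFinB subr0.
by rewrite mule1.
Qed.

End area.

Definition det3 (R : realType) (p q s : R * R) : R :=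
  (q.1 - p.1) * (s.2 - p.2) - (q.2 - p.2) * (s.1 - p.1).

Definition open_triangle (R : realType) (p q s : R * R) : set (R * R) :=
  [set z | [/\ 0 < det3 z q s, 0 < det3 p z s & 0 < det3 p q z]].

Section area2.
Context {R : realType}.
Local Notation mu := (@lebesgue_measure R).
Local Notation pt := (measurableTypeR R * measurableTypeR R)%type.
Implicit Types A : set pt.

Lemma area_setU_le (A B : set pt) : measurable A -> measurable B ->
  (area (A `|` B) <= area A + area B)%E.
Proof. exact: measureU2. Qed.

Lemma measurable_affine2_gt0 (a b c : R) (f : R * R -> R) :
  (forall z, f z = a * z.1 + b * z.2 + c) -> measurable ([set z | 0 < f z] : set pt).
Proof.
move=> fE; rewrite (_ : mkset _ = [set z : pt | 0 < a * z.1 + b * z.2 + c]).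
  by apply: (measurable_gt0 (f := fun z : pt => a * z.1 + b * z.2 + c)); exact: measurable_affine2.
by apply/funext => z /=; rewrite fE.
Qed.

Lemma measurable_open_triangle (p q s : R * R) : measurable (open_triangle p q s : set pt).
Proof.
have -> : open_triangle p q s = [set z | 0 < det3 z q s] `&`
    [set z | 0 < det3 p z s] `&` [set z | 0 < det3 p q z].
  by apply/seteqP; split=> z /=; [case=> *; split=> //; split | case=> -[] *; split].
apply: measurableI; first apply: measurableI.
- by apply: (@measurable_affine2_gt0 (q.2 - s.2) (s.1 - q.1) (q.1 * s.2 - q.2 * s.1)) => z; rewrite /det3; ring.
- by apply: (@measurable_affine2_gt0 (s.2 - p.2) (p.1 - s.1) (s.1 * p.2 - s.2 * p.1)) => z; rewrite /det3; ring.
- by apply: (@measurable_affine2_gt0 (p.2 - q.2) (q.1 - p.1) (p.1 * q.2 - p.2 * q.1)) => z; rewrite /det3; ring.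
Qed.

Definition unit_triangle : set (R * R) := open_triangle (0, 0) (1, 0) (0, 1).

(** The triangle, its reflection in the center of the unit square and the null set [N] cover the
    square. *)
Lemma area_unit_triangle_ge : ((2^-1)%:E <= area unit_triangle)%E.
Proof.
set T := unit_triangle.
have mT : measurable (T : set pt) by exact: measurable_open_triangle.
pose F := fun p : pt => (-1 * p.1 + 0 * p.2 + 1, 0 * p.1 + (-1) * p.2 + 1) : pt.
have mT' : measurable (F @^-1` T).
  by rewrite -[X in measurable X]setTI; apply: measurable_fun_pair => //; exact: measurable_affine2.
have aT' : area (F @^-1` T) = area T.
  have h : ((-1) * (-1) - 0 * 0 : R) != 0 by rewrite mulrNN mulr1 mulr0 subr0 oner_neq0.
  rewrite (@area_affine R (-1) 0 0 (-1) 1 1 T h mT).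
  have -> : ((-1) * (-1) - 0 * 0 : R) = 1 by ring.
  by rewrite normr1 invr1 mul1e.
pose N := [set p : pt | p.1 + p.2 = 1] `|` ([set 0] `*` setT) `|` (setT `*` [set 0]).
have mN1 : measurable [set p : pt | p.1 + p.2 = 1].
  rewrite (_ : [set p | _] = setT `&` (fun p : pt => p.1 + p.2 : measurableTypeR R) @^-1` [set 1]).
    have : measurable_fun setT (fun p : pt => p.1 + p.2 : measurableTypeR R).
      exact: measurable_funD.
    by apply => //; exact: measurable_set1.
  by rewrite setTI.
have a1 : area [set p : pt | p.1 + p.2 = 1] = 0%E.
  rewrite area_xsection; apply: integral0_eq => x _.
  rewrite (_ : xsection _ _ = [set 1 - x]); first exact: lebesgue_measure_set1.
  by apply/seteqP; split => y; rewrite /xsection /= inE /=; lra.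
have mN : measurable N.
  by apply: measurableU; [apply: measurableU => //|]; apply: measurableX => //; exact: measurable_set1.
have aN : area N = 0%E.
  have a2 : area ([set 0] `*` setT : set pt) = 0%E.
    by rewrite /area product_measure1E//= lebesgue_measure_set1 mul0e.
  have a3 : area (setT `*` [set 0] : set pt) = 0%E.
    by rewrite /area product_measure1E//= lebesgue_measure_set1 mule0.
  have m2 : measurable ([set 0] `*` setT : set pt) by exact: measurableX.
  have m3 : measurable (setT `*` [set 0] : set pt) by exact: measurableX.
  apply/eqP; rewrite eq_le measure_ge0 andbT.
  apply: (le_trans (area_setU_le (measurableU _ _ mN1 m2) m3)).
  by rewrite a3 adde0; apply: (le_trans (area_setU_le mN1 m2)); rewrite a1 a2 adde0.
have : (1 <= area T + area T)%E.
  rewrite -(area_rectangle (R := R)) -{2}aT' -[leRHS]adde0 -aN.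
  apply: (@le_trans _ _ (area (T `|` F @^-1` T `|` N))); last first.
    apply: (le_trans (area_setU_le (measurableU _ _ mT mT') mN)).
    apply: leeD2r. exact: (area_setU_le mT mT').
  apply: le_area; [exact: measurableX | exact: (measurableU _ _ (measurableU _ _ mT mT') mN)|].
  move=> [x y] /= []; rewrite !in_itv /= => /andP[x0 x1] /andP[y0 y1].
  have [xe|xn] := eqVneq x 0; first by right; left; right; split.
  have [ye|yn] := eqVneq y 0; first by right; right; split.
  have {xn}x0 : 0 < x by rewrite lt_neqAle eq_sym xn.
  have {yn}y0 : 0 < y by rewrite lt_neqAle eq_sym yn.
  have [h|h|h] := ltgtP (x + y) 1.
  - left; left; rewrite /T /unit_triangle /open_triangle /det3 /=; split; nra.
  - left; right; rewrite /T /F /unit_triangle /open_triangle /det3 /=; split; nra.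
  - by right; left; left.
case: (area T) => [t| |]; [|by move=> _; exact: leey|by []].
rewrite -EFinD !lee_fin; lra.
Qed.

(** The barycentric coordinates belonging to [q] and [s] carry the triangle onto [unit_triangle] by
    an affine map of determinant [D^-1]. *)
Lemma area_open_triangle_ge (p q s : R * R) : 0 < det3 p q s ->
  ((det3 p q s / 2)%:E <= area (open_triangle p q s))%E.
Proof.
move=> D0; set D := det3 p q s in D0 *.
pose T := unit_triangle.
have mT : measurable (T : set pt) by exact: measurable_open_triangle.
have Dn : D != 0 by rewrite gt_eqF.
pose a := (s.2 - p.2) / D; pose b := (p.1 - s.1) / D; pose e := (s.1 * p.2 - s.2 * p.1) / D.
pose c := (p.2 - q.2) / D; pose d := (q.1 - p.1) / D; pose f := (p.1 * q.2 - p.2 * q.1) / D.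
have Delta : a * d - b * c = D^-1.
  rewrite /a /b /c /d /D /det3; field.
  by move: Dn; rewrite /D /det3.
have := @area_affine R a b c d e f T; rewrite Delta => /(_ (invr_neq0 Dn) mT).
rewrite normfV invrK gtr0_norm// => h.
have -> : open_triangle p q s = ((fun p : pt => (a * p.1 + b * p.2 + e, c * p.1 + d * p.2 + f) : pt) @^-1` T).
  have E1 z : a * z.1 + b * z.2 + e = det3 p z s / D by rewrite /a /b /e /det3; field.
  have E2 z : c * z.1 + d * z.2 + f = det3 p q z / D by rewrite /c /d /f /det3; field.
  have E3 z : 1 - det3 p z s / D - det3 p q z / D = det3 z q s / D.
    by rewrite -[1](divff Dn) /D /det3; field; move: Dn; rewrite /D /det3.
  have E z : T z = [/\ 0 < 1 - z.1 - z.2, 0 < z.1 & 0 < z.2].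
    rewrite /T /unit_triangle /open_triangle /det3 /=; congr and3; congr is_true; congr Order.lt; ring.
  by apply/seteqP; split=> z; rewrite /preimage /= E /= E1 E2 E3 !pmulr_lgt0 ?invr_gt0//.
rewrite h EFinM; by apply: lee_wpmul2l; [rewrite lee_fin ltW|exact: area_unit_triangle_ge].
Qed.

Definition parallelogram (c u v : R * R) : set (R * R) :=
  [set c + (s *: u + t *: v) | s in `[0, 1[ & t in `[0, 1[].

Lemma area_parallelogram (c u v : R * R) :
  let D := u.1 * v.2 - u.2 * v.1 in D != 0 ->
  measurable (parallelogram c u v : set pt) /\
  area (parallelogram c u v) = `|D|%:E.
Proof.
move=> D Dn.
pose A : set pt := (`[0, 1[ `*` `[0, 1[)%classic.
have mA : measurable A by exact: measurableX.
pose F := fun p : pt => ((v.2 / D) * p.1 + (- v.1 / D) * p.2 + (c.2 * v.1 - c.1 * v.2) / D,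
   (- u.2 / D) * p.1 + (u.1 / D) * p.2 + (u.2 * c.1 - u.1 * c.2) / D) : pt.
have -> : parallelogram c u v = F @^-1` A.
  apply/seteqP; split=> z.
    case=> s /= s01 [t /= t01 <-]; rewrite /A /F /=.
    have -> : v.2 / D * (c.1 + (s * u.1 + t * v.1)) + - v.1 / D * (c.2 + (s * u.2 + t * v.2)) + (c.2 * v.1 - c.1 * v.2) / D = s.
      by rewrite /D; field.
    have -> : - u.2 / D * (c.1 + (s * u.1 + t * v.1)) + u.1 / D * (c.2 + (s * u.2 + t * v.2)) + (u.2 * c.1 - u.1 * c.2) / D = t.
      by rewrite /D; field.
    by [].
  rewrite /A /F /= => -[h1 h2]; exists (F z).1 => //; exists (F z).2 => //.
  by rewrite /F; case: z {h1 h2} => x y /=; congr pair; rewrite /= /GRing.scale /=; rewrite /D; field.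
split.
  rewrite -[X in measurable X]setTI; apply: measurable_fun_pair => //; exact: measurable_affine2.
have De : (v.2 / D) * (u.1 / D) - (- v.1 / D) * (- u.2 / D) = D^-1.
  by rewrite /D; field.
rewrite area_affine// De ?invr_neq0// normfV invrK.
by rewrite [area A](area_rectangle (R := R)) mule1.
Qed.

End area2.

Section disk_area.
Context {R : realType}.
Local Notation mu := (@lebesgue_measure R).
Local Notation pt := (measurableTypeR R * measurableTypeR R)%type.

Lemma derive1_sin : derive1 (@sin R) = cos.
Proof. by apply/funext => x; rewrite derive1E; apply: derive_val. Qed.

(** Substituting [x = sin t] gives the integrand [2 * cos t ^+ 2], with primitive
    [t + sin t * cos t]. *)
Lemma integral_semicircle :
  (\int[mu]_(x in `[(-1)%R, 1%R]) (2 * Num.sqrt (1 - x ^+ 2))%:E = (@pi R)%:E)%E.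
Proof.
have pi0 := @pi_gt0 R.
have s1 : sin (- (pi / 2)) = -1 :> R by rewrite sinN sin_pihalf.
rewrite -s1 -[in X in `[_, X]](@sin_pihalf R).
have ab : - (pi / 2) < pi / 2 :> R by lra.
rewrite (@integration_by_substitution_increasing R sin (fun x => 2 * Num.sqrt (1 - x ^+ 2)))//; first last.
- apply: continuous_subspaceT => x.
  apply: cvgM; first exact: cvg_cst.
  apply: continuous_comp; last exact: sqrt_continuous.
  by apply: cvgB; [exact: cvg_cst|exact: exprn_continuous].
- split; first by move=> x _; apply: ex_derive.
  + by apply: cvg_at_right_filter; exact: continuous_sin.
  + by apply: cvg_at_left_filter; exact: continuous_sin.
- by apply: cvgP; apply: cvg_at_left_filter; rewrite derive1_sin; exact: continuous_cos.
- by apply: cvgP; apply: cvg_at_right_filter; rewrite derive1_sin; exact: continuous_cos.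
- by move=> x _; rewrite derive1_sin; exact: continuous_cos.
- by move=> x y xi yi; rewrite ltr_sin.
- exact: ltW.
rewrite derive1_sin.
have -> : (\int[mu]_(x in `[(- (pi / 2))%R, (pi / 2)%R]) ((((fun x => 2 * Num.sqrt (1 - x ^+ 2)) \o sin) * cos) x)%:E = \int[mu]_(x in `[(- (pi / 2))%R, (pi / 2)%R]) (2 * cos x ^+ 2)%:E)%E.
  apply: eq_integral => x; rewrite inE /= in_itv /= => xi; congr (_%:E).
  rewrite /GRing.mul /= -cos2sin2 sqrtr_sqr ger0_norm ?cos_ge0_pihalf//.
  by rewrite expr2 -mulrA.
have dH (x : R) : is_derive x (1 : R) (fun x : R => x + sin x * cos x) (2 * cos x ^+ 2).
  apply: is_derive_eq; rewrite /GRing.scale /=.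
  by have := cos2Dsin2 x; lra.
rewrite (@continuous_FTC2 R _ (fun x => x + sin x * cos x))//.
- by rewrite s1 cosN cos_pihalf !mulr0 !addr0 -EFinB opprK; congr (_%:E); field.
- apply: continuous_subspaceT => x.
  apply: cvgM; first exact: cvg_cst.
  by apply: cvgM; exact: continuous_cos.
- have cH x : {for x, continuous (fun x : R => x + sin x * cos x)}.
    by apply: differentiable_continuous; apply/derivable1_diffP; apply: ex_derive.
  split; first by move=> x _; apply: ex_derive.
  + by apply: cvg_at_right_filter; exact: cH.
  + by apply: cvg_at_left_filter; exact: cH.
- by move=> x _; rewrite derive1E; apply: derive_val.
Qed.

Lemma edist_le (p c : R * R) (r : R) : 0 <= r ->
  (edist p c <= r) = ((p.1 - c.1) ^+ 2 + (p.2 - c.2) ^+ 2 <= r ^+ 2).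
Proof.
by move=> r0; rewrite /edist -[X in _ <= X](ger0_norm r0) -sqrtr_sqr ler_sqrt ?sqr_ge0.
Qed.

Lemma diskE (c : R * R) (r : R) : 0 <= r ->
  disk c r = [set p | (p.1 - c.1) ^+ 2 + (p.2 - c.2) ^+ 2 <= r ^+ 2].
Proof. by move=> r0; apply/funext => p; rewrite /disk /= edist_le. Qed.

Lemma measurable_disk (c : R * R) (r : R) : measurable (disk c r : set pt).
Proof.
have [r0|r0] := leP 0 r; last first.
  suff -> : disk c r = set0 by [].
  apply/seteqP; split => p //; rewrite /disk /edist /= => h.
  by have := lt_le_trans r0 (sqrtr_ge0 ((p.1 - c.1) ^+ 2 + (p.2 - c.2) ^+ 2)); rewrite ltNge h.
rewrite diskE//.
rewrite (_ : mkset _ = [set p : pt | 0 <= r ^+ 2 - ((p.1 - c.1) ^+ 2 + (p.2 - c.2) ^+ 2)]).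
  apply: (measurable_ge0 (f := fun p : pt => r ^+ 2 - ((p.1 - c.1) ^+ 2 + (p.2 - c.2) ^+ 2))).
  apply: measurable_funB => //; apply: measurable_funD; apply: measurable_funX; exact: measurable_funB.
by apply/funext => p /=; rewrite subr_ge0.
Qed.

Lemma area_unit_disk : area (disk (0 : R * R) 1) = (@pi R)%:E.
Proof.
rewrite area_xsection -integral_semicircle [RHS]integral_mkcond.
apply: eq_integral => x _; rewrite patchE diskE//.
case: ifPn; rewrite mem_setE in_itv /= => xI; last first.
  rewrite (_ : xsection _ _ = set0) ?measure0//; apply/seteqP; split => y //.
  rewrite /xsection /= inE /= !subr0 => h; apply: (negP xI).
  by have := sqr_ge0 y; move=> ?; apply/andP; split; nra.
have x1 : x ^+ 2 <= 1 by move/andP: xI => [*]; nra.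
pose q := Num.sqrt (1 - x ^+ 2).
have q2 : q ^+ 2 = 1 - x ^+ 2 by rewrite sqr_sqrtr// subr_ge0.
have q0 : 0 <= q by exact: sqrtr_ge0.
rewrite (_ : xsection _ _ = `[- q, q]%classic).
  rewrite lebesgue_measure_itv /= lte_fin.
  case: ifPn => h; first by rewrite -EFinB opprK; congr (_%:E); rewrite -/q; ring.
  by rewrite -/q (_ : q = 0) ?mulr0//; lra.
apply/seteqP; split => y; rewrite /xsection /= inE /= !subr0 in_itv /= => h.
  by apply/andP; split; nra.
by move/andP: h => [h1 h2]; nra.
Qed.

Lemma area_disk (c : R * R) (r : R) : 0 < r -> area (disk c r) = (pi * r ^+ 2)%:E.
Proof.
move=> r0; have rn : r != 0 by rewrite gt_eqF.
have D0 : r^-1 * r^-1 - 0 * 0 != 0 by rewrite mulr0 subr0 mulf_neq0 ?invr_neq0.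
have := @area_affine R _ _ _ _ (- c.1 / r) (- c.2 / r) _ D0 (measurable_disk 0 1).
rewrite area_unit_disk mulr0 subr0 -EFinM -invfM normfV invrK ger0_norm -?expr2 ?sqr_ge0//.
rewrite [pi * _]mulrC => <-; congr area; rewrite !diskE// ?ltW//.
apply/seteqP; split => p; rewrite /preimage /= !subr0 !mul0r add0r addr0;
rewrite ![r^-1 * _]mulrC -!mulrDl !exprMn -mulrDl exprVn;
by rewrite ler_pdivrMr ?exprn_gt0// expr1n mul1r.
Qed.

End disk_area.

(** * Inequalities for triangles in terms of squared side lengths *)

Section heron.
Variable R : rcfType.
Implicit Types u v w D : R.

(* Sixteen times the squared area, from the squared sides; hence [4 * D ^+ 2] for [D = det3]. *)
Definition heron u v w := 2 * (u * v + v * w + w * u) - u ^+ 2 - v ^+ 2 - w ^+ 2.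
Definition nonobtuse u v w := [/\ u <= v + w, v <= w + u & w <= u + v].

Lemma heron_rot u v w : heron u v w = heron v w u.
Proof. rewrite /heron; ring. Qed.
Lemma heron_swap u v w : heron u v w = heron v u w.
Proof. rewrite /heron; ring. Qed.
Lemma nonobtuse_rot u v w : nonobtuse u v w -> nonobtuse v w u.
Proof. by case=> *; split. Qed.
Lemma nonobtuse_swap u v w : nonobtuse u v w -> nonobtuse v u w.
Proof. by case=> *; split=> //; rewrite addrC. Qed.

(** In a non-obtuse triangle [heron] increases with each side. So the longest [w] may be lowered to
    the middle [v], where the value [u * (4 * v - u)] is at least [3 * u ^+ 2]. *)
Lemma heron_ge48 u v w : 4 <= u -> 4 <= v -> 4 <= w -> nonobtuse u v w ->
  48 <= heron u v w.
Proof.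
wlog uv : u v w / u <= v.
  move=> H u4 v4 w4 n; have [uv|vu] := leP u v; first exact: H.
  by rewrite heron_swap; apply: H => //; [exact: ltW|exact: nonobtuse_swap].
wlog vw : u v w uv / v <= w.
  move=> H u4 v4 w4 n; have [vw|wv] := leP v w; first exact: H.
  have [uw|wu] := leP u w.
    have -> : heron u v w = heron u w v by rewrite /heron; ring.
    apply: H => //; first exact: ltW.
    by apply: nonobtuse_swap; do 2 apply: nonobtuse_rot.
  have -> : heron u v w = heron w u v by rewrite /heron; ring.
  by apply: H => //; [exact: ltW|do 2 apply: nonobtuse_rot].
move=> u4 v4 w4 [n1 n2 n3]; rewrite /heron.
have h1 : 0 <= (w - v) * (2 * u - (w - v)) by apply: mulr_ge0; lra.
have h2 : 0 <= u * (v - u) by apply: mulr_ge0; lra.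
nra.
Qed.

(** Equality holds at 5, 5, 4, which fixes 5 as the threshold of saturation. The side [w] is lowered
    to 4 or, if [v - u] exceeds 4, to [v - u], where the triangle is right-angled. *)
Lemma heron_ge64 u v w : 5 <= u -> 5 <= v -> 4 <= w -> nonobtuse u v w ->
  64 <= heron u v w.
Proof.
wlog uv : u v / u <= v.
  move=> H u4 v4 w4 n; have [uv|vu] := leP u v; first exact: H.
  by rewrite heron_swap; apply: H => //; [exact: ltW|exact: nonobtuse_swap].
move=> u5 v5 w4 [n1 n2 n3].
have [h|h] := leP v (u + 4).
  have h1 : 0 <= (w - 4) * (2 * (u + v) - w - 4) by apply: mulr_ge0; lra.
  have h2 : 0 <= (v - u) * (8 - (v - u)) by apply: mulr_ge0; lra.
  rewrite /heron; nra.
have h1 : 0 <= (w - (v - u)) * (u + v - w + 2 * u) by apply: mulr_ge0; lra.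
rewrite /heron; nra.
Qed.

(** The bound is the value at the right triangle with squared legs 4 and [w - 4]. The longer of [u],
    [v] is lowered until the triangle is right-angled or isosceles. *)
Lemma heron_ge_long u v w : 4 <= u -> 4 <= v -> 8 <= w -> nonobtuse u v w ->
  16 * (w - 4) <= heron u v w.
Proof.
wlog uv : u v / u <= v.
  move=> H u4 v4 w4 n; have [uv|vu] := leP u v; first exact: H.
  by rewrite heron_swap; apply: H => //; [exact: ltW|exact: nonobtuse_swap].
move=> u4 v4 w8 [n1 n2 n3].
have [h|h] := leP u (w - 4).
  have h1 : 0 <= (v - (w - u)) * (w + u - v + 2 * u) by apply: mulr_ge0; lra.
  have h2 : 0 <= (u - 4) * (w - 4 - u) by apply: mulr_ge0; lra.
  rewrite /heron; nra.
have h1 : 0 <= (v - u) * (2 * w - (v - u)) by apply: mulr_ge0; lra.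
have h2 : 0 <= (w - 8) * (3 * w - 8) by apply: mulr_ge0; lra.
have h3 : 0 <= (u - (w - 4)) * w by apply: mulr_ge0; lra.
rewrite /heron; nra.
Qed.

(** This amounts to [(u + v + w) / 6 <= D], which is exactly 4 plus the three loads [(u - 8) / 6],
    [(v - 8) / 6], [(w - 8) / 6]. For ordered sides the range from 8 to 20 enters as
    [2 * v <= 5 * u]. *)
Lemma heron_ge_three u v w : 8 <= u <= 20 -> 8 <= v <= 20 -> 8 <= w <= 20 -> nonobtuse u v w ->
  (u + v + w) ^+ 2 <= 9 * heron u v w.
Proof.
wlog uv : u v w / u <= v.
  move=> H u4 v4 w4 n; have [uv|vu] := leP u v; first exact: H.
  by rewrite heron_swap [u + v]addrC; apply: H => //; [exact: ltW|exact: nonobtuse_swap].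
wlog vw : u v w uv / v <= w.
  move=> H u4 v4 w4 n; have [vw|wv] := leP v w; first exact: H.
  have [uw|wu] := leP u w.
    have -> : heron u v w = heron u w v by rewrite /heron; ring.
    rewrite addrAC; apply: H => //; first exact: ltW.
    by apply: nonobtuse_swap; do 2 apply: nonobtuse_rot.
  have -> : heron u v w = heron w u v by rewrite /heron; ring.
  have -> : u + v + w = w + u + v by ring.
  by apply: H => //; [exact: ltW|do 2 apply: nonobtuse_rot].
move=> /andP[u1 u2] /andP[v1 v2] /andP[w1 w2] [n1 n2 n3]; rewrite /heron.
have h1 : 0 <= (w - v) * (u + v - w) by apply: mulr_ge0; lra.
have h2 : 0 <= (5 * u - 2 * v) * (v - u) by apply: mulr_ge0; lra.
nra.
Qed.

(* [u * v * w < 20 * D ^+ 2] says that the circumradius squared is less than 5. *)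
Lemma obtuse_deficit u v w D : 4 <= u -> 4 <= v -> u + v <= w ->
  u * v * w < 20 * D ^+ 2 -> 4 * D ^+ 2 = heron u v w -> 0 <= D ->
  8 <= w <= 20 /\ 4 - (w - 8) / 6 <= D.
Proof.
move=> u4 v4 uvw circ hD D0.
pose p := Num.sqrt (u * v); have uv0 : 0 <= u * v by apply: mulr_ge0; lra.
have p2 : p ^+ 2 = u * v by rewrite sqr_sqrtr.
have p4 : 4 <= p by have := sqrtr_ge0 (u * v); rewrite -/p => ?; nra.
(* [p] is the product of the lengths of the two short sides and [t] is minus the cosine of the
   obtuse angle between them. [wt] below is the circumradius bound in the form of the law of
   sines. *)
pose t := (w - u - v) / (2 * p).
have tp : 2 * t * p = w - u - v by rewrite /t; field; lra.
have t0 : 0 <= t by rewrite /t divr_ge0; lra.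
have uv2p : 2 * p <= u + v.
  rewrite -ler_sqr ?nnegrE; [|lra..]; have := sqr_ge0 (u - v); nra.
have wp : 2 * p * (1 + t) <= w by lra.
have DE : D ^+ 2 = p ^+ 2 * (1 - t ^+ 2).
  have : 4 * D ^+ 2 = 4 * (p ^+ 2 - (t * p) ^+ 2).
    have -> : t * p = (w - u - v) / 2 by lra.
    by rewrite hD p2 /heron; field.
  by nra.
have wt : w < 20 * (1 - t ^+ 2).
  have : p ^+ 2 * w < p ^+ 2 * (20 * (1 - t ^+ 2)) by rewrite [in X in X < _]p2; move: circ; rewrite DE; lra.
  by rewrite ltr_pM2l ?exprn_gt0//; lra.
have pt : p < 10 * (1 - t).
  rewrite -(ltr_pM2l (_ : 0 < 1 + t)); [nra|lra].
have t6 : t <= 3 / 5 by lra.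
split; first by apply/andP; split; nra.
(* The slope 1/6 is tuned here: [16 * (1 - t ^+ 2)] is at least the square of [4 / 3 * (3 - t)]
   precisely for [0 <= t <= 3 / 5]. *)
have h : (4 - (w - 8) / 6) <= 4 / 3 * (3 - t) by nra.
apply: (le_trans h); rewrite -ler_sqr ?nnegrE; [|nra|exact: D0].
rewrite DE; have t1 : 0 <= 1 - t ^+ 2 by nra.
have : 16 * (1 - t ^+ 2) <= p ^+ 2 * (1 - t ^+ 2) by apply: ler_wpM2r => //; nra.
by nra.
Qed.

Lemma ler_of_sqr (x y : R) : 0 <= y -> x ^+ 2 <= y ^+ 2 -> x <= y.
Proof. by move=> y0 h; have [x0|x0] := leP 0 x; [rewrite -ler_sqr ?nnegrE|exact: le_trans (ltW x0) y0]. Qed.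

(** The surplus over 4 is twice the load [(w - 8) / 6], so the longer of two loaded sides pays for
    both. At [w = 20] this line meets the square-root bound of [heron_ge_long]. *)
Lemma load_one u v w D : 4 <= u -> 4 <= v -> 8 <= w <= 20 -> nonobtuse u v w ->
  4 * D ^+ 2 = heron u v w -> 0 <= D -> 4 + (w - 8) / 3 <= D.
Proof.
move=> u4 v4 /andP[w8 w20] n hD D0.
have := heron_ge_long u4 v4 w8 n; rewrite -hD => h.
apply: ler_of_sqr => //; nra.
Qed.

Lemma load_three u v w D : 8 <= u <= 20 -> 8 <= v <= 20 -> 8 <= w <= 20 -> nonobtuse u v w ->
  4 * D ^+ 2 = heron u v w -> 0 <= D -> (u + v + w) / 6 <= D.
Proof.
move=> u4 v4 w4 n hD D0.
have := heron_ge_three u4 v4 w4 n; rewrite -hD => h.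
apply: ler_of_sqr => //; nra.
Qed.

(** The area is bounded through the circumradius here: long sides in a circle of bounded radius
    force a large [D]. *)
Lemma load_obtuse_one u v w D : 8 <= u <= 20 -> 4 <= v -> u + v <= w ->
  u * v * w < 20 * D ^+ 2 -> 0 <= D -> 4 + (u - 8) / 6 <= D.
Proof.
move=> /andP[u8 u20] v4 uvw circ D0; apply: ler_of_sqr => //.
have h1 : u * 4 * (u + 4) <= u * v * w.
  apply: ler_pM; [nra|lra| |lra]; apply: ler_pM; lra.
nra.
Qed.

Lemma load_obtuse_two u v w D : 8 <= u <= 20 -> 8 <= v <= 20 -> u + v <= w ->
  u * v * w < 20 * D ^+ 2 -> 0 <= D -> 4 + (u - 8) / 6 + (v - 8) / 6 <= D.
Proof.
move=> /andP[u8 u20] /andP[v8 v20] uvw circ D0; apply: ler_of_sqr => //.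
have h1 : 8 * (u + v - 8) * (u + v) <= u * v * w.
  apply: ler_pM; [nra|lra| |lra]; nra.
nra.
Qed.

(* The possible loads that a triangle with squared sides [u v w] receives across [u]. *)
Definition load_of (l u v w : R) := l = 0 \/ [/\ l = (u - 8) / 6, 8 <= u <= 20 & u <= v + w].

Lemma loaded_nonobtuse u v w D (l m n : R) : 4 <= u -> 4 <= v -> 4 <= w ->
  nonobtuse u v w -> 4 * D ^+ 2 = heron u v w -> 0 <= D ->
  load_of l u v w -> load_of m v w u -> load_of n w u v ->
  l != 0 \/ m != 0 \/ n != 0 -> 4 + l + m + n <= D.
Proof.
move=> u4 v4 w4 no hD D0 hl hm hn.
have no2 := nonobtuse_rot no; have no3 := nonobtuse_rot no2.
have hD2 := hD; rewrite heron_rot in hD2; have hD3 := hD2; rewrite heron_rot in hD3.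
have U : 8 <= u <= 20 -> 4 + (u - 8) / 3 <= D by move=> h; exact: load_one hD2 D0.
have V : 8 <= v <= 20 -> 4 + (v - 8) / 3 <= D by move=> h; exact: load_one hD3 D0.
have W : 8 <= w <= 20 -> 4 + (w - 8) / 3 <= D by move=> h; exact: load_one hD D0.
case: hl => [->|[-> hu _]]; case: hm => [->|[-> hv _]]; case: hn => [->|[-> hw _]] //=.
- by rewrite eqxx => -[//|[//|//]].
- by move=> _; move: (W hw) (andP hw) => ? [? ?]; lra.
- by move=> _; move: (V hv) (andP hv) => ? [? ?]; lra.
- move=> _; move: (V hv) (andP hv) (W hw) (andP hw) => ? [? ?] ? [? ?].
  by have [?|?] := leP v w; lra.
- by move=> _; move: (U hu) (andP hu) => ? [? ?]; lra.
- move=> _; move: (U hu) (andP hu) (W hw) (andP hw) => ? [? ?] ? [? ?].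
  by have [?|?] := leP u w; lra.
- move=> _; move: (V hv) (andP hv) (U hu) (andP hu) => ? [? ?] ? [? ?].
  by have [?|?] := leP v u; lra.
- by move=> _; have := load_three hu hv hw no hD D0; lra.
Qed.

Lemma loaded_obtuse u v w D (l m n : R) : 4 <= u -> 4 <= v -> 4 <= w -> u + v < w ->
  u * v * w < 20 * D ^+ 2 -> 0 <= D ->
  load_of l u v w -> load_of m v w u -> load_of n w u v ->
  l != 0 \/ m != 0 \/ n != 0 -> 4 + l + m + n <= D.
Proof.
move=> u4 v4 w4 ob circ D0 hl hm hn.
have -> : n = 0 by case: hn => // -[_ _]; rewrite leNgt ob.
have circ' : v * u * w < 20 * D ^+ 2 by rewrite [v * u]mulrC.
have uvw : u + v <= w by exact: ltW.
have vuw : v + u <= w by rewrite addrC.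
case: hl => [->|[-> hu _]]; case: hm => [->|[-> hv _]] //=.
- by rewrite eqxx => -[//|[//|//]].
- by move=> _; have := load_obtuse_one hv u4 vuw circ' D0; lra.
- by move=> _; have := load_obtuse_one hu v4 uvw circ D0; lra.
- by move=> _; have := load_obtuse_two hu hv uvw circ D0; lra.
Qed.

(** This stops the cascade: a triangle with any load on it, obtuse or not, pays all its loads from
    its own area and keeps 4. *)
Lemma loaded_triangle u v w D (l m n : R) : 4 <= u -> 4 <= v -> 4 <= w ->
  u * v * w < 20 * D ^+ 2 -> 4 * D ^+ 2 = heron u v w -> 0 <= D ->
  load_of l u v w -> load_of m v w u -> load_of n w u v ->
  l != 0 \/ m != 0 \/ n != 0 -> 4 + l + m + n <= D.
Proof.
move=> u4 v4 w4 circ hD D0 hl hm hn ne.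
have [c1|c1] := ltP (u + v) w; first exact: loaded_obtuse hl hm hn ne.
have [c2|c2] := ltP (v + w) u.
  have -> : 4 + l + m + n = 4 + m + n + l by ring.
  apply: (loaded_obtuse v4 w4 u4 c2 _ D0 hm hn hl); last by tauto.
  by rewrite mulrC mulrA.
have [c3|c3] := ltP (w + u) v.
  have -> : 4 + l + m + n = 4 + n + l + m by ring.
  apply: (loaded_obtuse w4 u4 v4 c3 _ D0 hn hl hm); last by tauto.
  by rewrite -mulrA mulrC.
by apply: loaded_nonobtuse hD D0 hl hm hn ne => //; split.
Qed.

End heron.

(** * Weighted Delaunay triangles of a finite family *)

Section regular_triangles.
Variables (R : realType) (I : finType) (y : I -> R * R) (h : I -> R).

Definition cross (a b : R * R) : R := a.1 * b.2 - a.2 * b.1.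

Definition det (i j k : I) := det3 (y i) (y j) (y k).

(* For [0 < det i j k], nonnegative iff the point [(y l, h l)] lies on or above the plane through the
   lifts of [y i], [y j], [y k]; for [h = nsq \o y] this is the empty circumdisk property. *)
Definition gap (i j k l : I) := det i j k * h l -
  (det l j k * h i + det i l k * h j + det i j l * h k).

Definition reg (i j k : I) := (0 < det i j k) && [forall l, 0 <= gap i j k l].

Hypothesis generic : forall i j k l, det i j k != 0 -> gap i j k l = 0 ->
  l \in [:: i; j; k].

Lemma regP i j k : reflect (0 < det i j k /\ forall l, 0 <= gap i j k l) (reg i j k).
Proof. by apply: (iffP andP) => -[? /forallP ?]. Qed.

Lemma det_rot i j k : det i j k = det j k i.
Proof. rewrite /det /det3; ring. Qed.

Lemma gap_rot i j k l : gap i j k l = gap j k i l.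
Proof. rewrite /gap /det /det3; ring. Qed.

Lemma reg_rot i j k : reg i j k = reg j k i.
Proof. by rewrite /reg det_rot; congr andb; apply: eq_forallb => l; rewrite gap_rot. Qed.

Lemma reg_det i j k : reg i j k -> 0 < det i j k.
Proof. by case/andP. Qed.

Lemma det_eq i j : (det i j i = 0) * (det i j j = 0) * (det i i j = 0).
Proof. by do 2?split; rewrite /det /det3; ring. Qed.

(** Exchanging [k] and [k'] changes the sign of [gap i j k k'], so both gaps vanish and genericity
    applies. *)
Lemma reg_edge_unique i j k k' : reg i j k -> reg i j k' -> k = k'.
Proof.
move=> /regP[D g] /regP[D' g'].
have e : gap i j k k' = - gap i j k' k by rewrite /gap /det /det3; ring.
have /(generic (lt0r_neq0 D)) : gap i j k k' = 0.
  by have := g k'; have := g' k; lra.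
rewrite !inE => /or3P[] /eqP k'E; move: D'; rewrite k'E ?det_eq ?ltxx//.
Qed.

(* The difference of the two interpolating affine functions has constant sign at the
   vertices of each triangle, hence vanishes at all of them if the triangles overlap. *)
Lemma reg_vertices i j k i' j' k' z : reg i j k -> reg i' j' k' ->
  open_triangle (y i) (y j) (y k) z -> open_triangle (y i') (y j') (y k') z ->
  [/\ i' \in [:: i; j; k], j' \in [:: i; j; k] & k' \in [:: i; j; k]].
Proof.
move=> /regP[D g] /regP[D' g'] [z1 z2 z3] [z1' z2' z3'].
have E : det3 z (y j') (y k') * gap i j k i' + det3 (y i') z (y k') * gap i j k j' +
         det3 (y i') (y j') z * gap i j k k' +
        (det3 z (y j) (y k) * gap i' j' k' i + det3 (y i) z (y k) * gap i' j' k' j +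
         det3 (y i) (y j) z * gap i' j' k' k) = 0.
  rewrite /gap /det /det3; ring.
have p1 := mulr_ge0 (ltW z1') (g i'); have p2 := mulr_ge0 (ltW z2') (g j').
have p3 := mulr_ge0 (ltW z3') (g k').
have q1 := mulr_ge0 (ltW z1) (g' i); have q2 := mulr_ge0 (ltW z2) (g' j).
have q3 := mulr_ge0 (ltW z3) (g' k).
have e1 : det3 z (y j') (y k') * gap i j k i' = 0 by lra.
have e2 : det3 (y i') z (y k') * gap i j k j' = 0 by lra.
have e3 : det3 (y i') (y j') z * gap i j k k' = 0 by lra.
split; apply: generic (lt0r_neq0 D) _; apply/eqP.
- by move/eqP: e1; rewrite mulf_eq0 gt_eqF.
- by move/eqP: e2; rewrite mulf_eq0 gt_eqF.
- by move/eqP: e3; rewrite mulf_eq0 gt_eqF.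
Qed.

Lemma finite_argmin (T : finType) (P : pred T) (F : T -> R) : (exists x, P x) ->
  exists2 x, P x & forall x', P x' -> F x <= F x'.
Proof.
by move=> [x0 Px0]; case: (arg_minP F Px0) => x Px min; exists x.
Qed.

(** Gift wrapping: the plane of the lifted triangle is turned about the edge until it first meets
    the lift of a point on the other side. The ratio [gap i j k l / det j i l] measures the turn. *)
Lemma reg_neighbour i j k : reg i j k -> (exists l, 0 < det j i l) ->
  exists k', reg j i k'.
Proof.
move=> /regP[D g] ex.
have [k' D' min] := finite_argmin (fun l => gap i j k l / det j i l) ex.
exists k'; apply/regP; split=> // l.
suff : 0 <= det i j k * gap j i k' l by rewrite pmulr_rge0.
have -> : det i j k * gap j i k' l = det j i k' * gap i j k l - det j i l * gap i j k k'.
  rewrite /gap /det /det3; ring.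
have gl := g l; have gk' := g k'.
have [dl|dl] := ltP 0 (det j i l).
  have := min l dl; rewrite ler_pdivrMr// mulrAC ler_pdivlMr// => m.
  by rewrite subr_ge0 mulrC [leRHS]mulrC.
have : 0 <= det j i k' * gap i j k l by rewrite mulr_ge0// ltW.
have : 0 <= - det j i l * gap i j k k' by rewrite mulr_ge0// oppr_ge0.
lra.
Qed.

(* Among the segments from [y j] to [y k] that cross the ray from [y i] in the
   direction [w], the one with the least lifted slope along the ray belongs to a regular triangle. *)
Lemma exists_reg i (w g : R * R) :
  (forall l, l != i -> cross (y l - y i) w != 0) ->
  (forall l, g.1 * (y l - y i).1 + g.2 * (y l - y i).2 <= h l - h i) ->
  (exists j k, [/\ 0 < cross (y j - y i) w, 0 < cross w (y k - y i) & 0 < det i j k]) ->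
  exists j k, [/\ reg i j k, 0 < cross (y j - y i) w & 0 < cross w (y k - y i)].
Proof.
move=> gen supp ex.
pose P (p : I * I) := [&& 0 < cross (y p.1 - y i) w, 0 < cross w (y p.2 - y i) & 0 < det i p.1 p.2].
pose F (p : I * I) := (cross w (y p.2 - y i) * (h p.1 - h i) + cross (y p.1 - y i) w * (h p.2 - h i)) / det i p.1 p.2.
have /(finite_argmin F) [[j k] /and3P[/= jw wk D] min] : exists p, P p.
  by case: ex => j [k [? ? ?]]; exists (j, k); apply/and3P.
exists j, k; split=> //; apply/regP; split=> // l.
have [->|li] := eqVneq l i.
  by rewrite (_ : gap i j k i = 0) // /gap /det /det3; ring.
rewrite leNgt; apply/negP => gl.
have dC : det i j k = cross (y j - y i) (y k - y i) by rewrite /det /det3 /cross /=; ring.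
pose a := det i l k; pose b := det i j l.
have pl : det i j k * cross (y l - y i) w = a * cross (y j - y i) w - b * cross w (y k - y i).
  rewrite /a /b /det /det3 /cross /=; ring.
have gE : gap i j k l = det i j k * (h l - h i) - a * (h j - h i) - b * (h k - h i).
  rewrite /gap /a /b /det /det3; ring.
have a0 : 0 < cross (y l - y i) w -> a <= 0.
  move=> lw; rewrite leNgt; apply/negP => a0.
  have /min : P (l, k) by apply/and3P.
  rewrite /F /= ler_pdivrMr// mulrAC ler_pdivlMr//.
  rewrite leNgt => /negP; apply; rewrite -subr_gt0.
  have : 0 < cross w (y k - y i) * (- gap i j k l) by rewrite mulr_gt0// oppr_gt0.
  congr (0 < _); rewrite gE -/a.
  have : det i j k * cross (y l - y i) w * (h k - h i) =
     (a * cross (y j - y i) w - b * cross w (y k - y i)) * (h k - h i) by rewrite pl.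
  lra.
have b0 : cross (y l - y i) w < 0 -> b <= 0.
  move=> lw; rewrite leNgt; apply/negP => b0.
  have wl : 0 < cross w (y l - y i) by move: lw; rewrite /cross; lra.
  have /min : P (j, l) by apply/and3P.
  rewrite /F /= ler_pdivrMr// mulrAC ler_pdivlMr//.
  rewrite leNgt => /negP; apply; rewrite -subr_gt0.
  have : 0 < cross (y j - y i) w * (- gap i j k l) by rewrite mulr_gt0// oppr_gt0.
  congr (0 < _); rewrite gE -/b.
  have : det i j k * - cross w (y l - y i) * (h j - h i) =
     (a * cross (y j - y i) w - b * cross w (y k - y i)) * (h j - h i).
    by rewrite -pl; congr (_ * _ * _); rewrite /cross; ring.
  lra.
(* Minimality makes both weights nonpositive, so [y l] lies in the cone at [y i] opposite to [j] and
   [k]. There a lift below the plane would contradict the supporting plane [g] at [i]. *)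
have [A B] : a <= 0 /\ b <= 0.
  have := gen l li; rewrite neq_lt => /orP[lw|lw].
    split; last exact: b0.
    have : a * cross (y j - y i) w < 0.
      have : det i j k * cross (y l - y i) w < 0 by rewrite pmulr_rlt0.
      have : b * cross w (y k - y i) <= 0 by rewrite pmulr_lle0// b0.
      lra.
    by rewrite pmulr_llt0// => /ltW.
  split; first exact: a0.
  have : b * cross w (y k - y i) < 0.
    have : 0 < det i j k * cross (y l - y i) w by rewrite mulr_gt0.
    have : a * cross (y j - y i) w <= 0 by rewrite pmulr_lle0// a0.
    lra.
  by rewrite pmulr_llt0// => /ltW.
pose G l := g.1 * (y l - y i).1 + g.2 * (y l - y i).2.
have GE : det i j k * G l = a * G j + b * G k.
  rewrite /G /a /b /det /det3 /=; ring.
have : 0 <= det i j k * (h l - h i - G l) by apply: mulr_ge0; [exact: ltW|rewrite subr_ge0; exact: supp].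
have : 0 <= - a * (h j - h i - G j) by apply: mulr_ge0; [rewrite oppr_ge0|rewrite subr_ge0; exact: supp].
have : 0 <= - b * (h k - h i - G k) by apply: mulr_ge0; [rewrite oppr_ge0|rewrite subr_ge0; exact: supp].
move: gl; rewrite gE => gl *; lra.
Qed.

End regular_triangles.

(** * Compensation of small obtuse triangles *)

Section counting.
Variables (R : realType) (I : finType) (y : I -> R * R) (h : I -> R).
Variables (w : R * R) (V0 V1 : pred I) (K : R).

Local Notation tri := (I * I * I)%type.
Local Notation D t := (det y t.1.1 t.1.2 t.2).
Definition dist2 i j := (y i - y j).1 ^+ 2 + (y i - y j).2 ^+ 2.
Definition rot (t : tri) : tri := (t.1.2, t.2, t.1.1).
Definition regt (t : tri) := reg y h t.1.1 t.1.2 t.2.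
(* The first vertex is strictly between the others with respect to [cross _ w]. Each
   triangle has exactly one such rotation, and each vertex in [V0] is the middle vertex of at least two triangles. *)
Definition mid (t : tri) :=
  cross (y t.1.2 - y t.1.1) w * cross (y t.2 - y t.1.1) w < 0.
Definition T0 (t : tri) := regt t && [|| V0 t.1.1, V0 t.1.2 | V0 t.2].
Definition T1 (t : tri) := regt t && [&& V1 t.1.1, V1 t.1.2 & V1 t.2].
Definition obtuse i j k := dist2 k i + dist2 k j < dist2 i j.
Definition bad (t : tri) := obtuse t.1.1 t.1.2 t.2 && (D t < K).

(* What a deficient triangle asks from its neighbour across the longest side. *)
Definition charge (t : tri) : R :=
  if T0 t && bad t then (dist2 t.1.1 t.1.2 - 8) / 6 else 0.
Definition load i j : R := \sum_k charge (j, i, k).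

Hypothesis generic : forall i j k l, det y i j k != 0 -> gap y h i j k l = 0 ->
  l \in [:: i; j; k].
Hypothesis w_generic : forall i j, i != j -> cross (y j - y i) w != 0.
Hypothesis T0_T1 : forall t, T0 t -> T1 t.
Hypothesis T0_neighbour : forall i j k, T0 (j, i, k) -> exists k', T1 (i, j, k').
Hypothesis T1_side : forall i j k, T1 (i, j, k) -> 4 <= dist2 i j.
Hypothesis T1_circ : forall i j k, T1 (i, j, k) ->
  dist2 i j * dist2 j k * dist2 k i < 20 * det y i j k ^+ 2.
Hypothesis T1_acute : forall i j k, T1 (i, j, k) ->
  nonobtuse (dist2 i j) (dist2 j k) (dist2 k i) -> K <= det y i j k.
Hypothesis K4 : K <= 4.
Hypothesis T1_delaunay : forall i j k k', T1 (i, j, k) -> T1 (j, i, k') ->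
  obtuse j i k' -> ~~ obtuse i j k.
Hypothesis V0_up : forall i, V0 i -> exists j k,
  [/\ reg y h i j k, 0 < cross (y j - y i) w & cross (y k - y i) w < 0].
Hypothesis V0_down : forall i, V0 i -> exists j k,
  [/\ reg y h i j k, cross (y j - y i) w < 0 & 0 < cross (y k - y i) w].

Lemma dist2C i j : dist2 i j = dist2 j i.
Proof. rewrite /dist2 /=; ring. Qed.

Lemma det_heron i j k :
  4 * det y i j k ^+ 2 = heron (dist2 i j) (dist2 j k) (dist2 k i).
Proof. rewrite /heron /dist2 /det /det3 /=; ring. Qed.

Lemma rotK3 t : rot (rot (rot t)) = t. Proof. by case: t => -[]. Qed.

Lemma rot_bij : bijective rot.
Proof. by exists (rot \o rot) => t; rewrite /= rotK3. Qed.

Lemma regt_rot t : regt (rot t) = regt t.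
Proof. by rewrite /regt /= -reg_rot. Qed.

Lemma T0_rot t : T0 (rot t) = T0 t.
Proof. by rewrite /T0 regt_rot /=; congr andb; rewrite orbA orbC. Qed.

Lemma T1_rot t : T1 (rot t) = T1 t.
Proof. by rewrite /T1 regt_rot /=; congr andb; rewrite andbA andbC. Qed.

Lemma T1_cycle i j k : T1 (i, j, k) -> T1 (j, k, i).
Proof. by rewrite -[T1 (i, j, k)]T1_rot. Qed.

Lemma T1_reg t : T1 t -> regt t. Proof. by case/andP. Qed.

Lemma reg_distinct i j k : reg y h i j k -> [/\ i != j, j != k & i != k].
Proof.
move=> /reg_det D0; split; apply: contraTneq D0 => ->; by rewrite det_eq ltxx.
Qed.

(** Among three nonzero numbers with sum zero exactly one pair has equal signs; [mid] tests this for
    the two edges, cyclically oriented, that meet at the first vertex. *)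
Lemma mid_partition t : regt t ->
  (mid t + mid (rot t) + mid (rot (rot t)) = 1)%N.
Proof.
case: t => [[i j] k] /reg_distinct[/= ij jk ik]; rewrite /mid /=.
set a := cross (y j - y i) w; set b := cross (y k - y j) w; set c := cross (y i - y k) w.
have -> : cross (y k - y i) w = - c by rewrite /c /cross /=; ring.
have -> : cross (y i - y j) w = - a by rewrite /a /cross /=; ring.
have -> : cross (y j - y k) w = - b by rewrite /b /cross /=; ring.
have abc : a + b + c = 0 by rewrite /a /b /c /cross /=; ring.
have a0 : a != 0 by exact: w_generic.
have b0 : b != 0 by exact: w_generic.
have c0 : c != 0 by apply: w_generic; rewrite eq_sym.
rewrite !mulrN !oppr_lt0.
move: a0 b0 c0; rewrite !neq_lt => /orP[a0|a0] /orP[b0|b0] /orP[c0|c0]; try (by exfalso; lra);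
by rewrite ?(nmulr_rgt0 _ a0) ?(pmulr_rgt0 _ a0) ?(nmulr_rgt0 _ b0) ?(pmulr_rgt0 _ b0)
  ?(nmulr_rgt0 _ c0) ?(pmulr_rgt0 _ c0) ?a0 ?b0 ?c0 ?(lt_gtF a0) ?(lt_gtF b0) ?(lt_gtF c0).
Qed.

(** Charges and loads belong to labeled triangles, areas to unlabeled ones. Taking [mid] as the
    choice of one labeling passes between the two kinds of sums. *)
Lemma sum_mid (g : tri -> R) : \sum_(t | T1 t) g t =
  \sum_(t | T1 t && mid t) (g t + g (rot t) + g (rot (rot t))).
Proof.
rewrite 2!big_split /=.
rewrite [in X in _ = _ + X + _](reindex_inj (bij_inj rot_bij)) /=.
rewrite [in X in _ = _ + X + _](reindex_inj (bij_inj rot_bij)) /=.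
rewrite [in X in _ = _ + _ + X](reindex_inj (bij_inj rot_bij)) /=.
under [in X in _ = _ + X + _]eq_bigl do rewrite !T1_rot.
under [in X in _ = _ + X + _]eq_bigr do rewrite rotK3.
under [in X in _ = _ + _ + X]eq_bigl do rewrite !T1_rot.
under [in X in _ = _ + _ + X]eq_bigr do rewrite rotK3.
have E (P : pred tri) (f : tri -> R) : \sum_(t | T1 t && P t) f t =
    \sum_(t | T1 t) (if P t then f t else 0) by rewrite big_mkcondr.
rewrite !E -!big_split; apply: eq_bigr => t t1; have := mid_partition (T1_reg t1).
by case: (mid t); case: (mid (rot t)); case: (mid (rot (rot t))) => //= _; rewrite ?addr0 ?add0r.
Qed.

Lemma bad_deficit t : T1 t -> bad t ->
  8 <= dist2 t.1.1 t.1.2 <= 20 /\ K - D t <= (dist2 t.1.1 t.1.2 - 8) / 6.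
Proof.
case: t => [[i j] k] t1 /andP[/= ob DK].
have t2 := T1_cycle t1; have t3 := T1_cycle t2.
have [h1 h2] : 8 <= dist2 i j <= 20 /\ 4 - (dist2 i j - 8) / 6 <= det y i j k.
  apply: (@obtuse_deficit _ (dist2 j k) (dist2 k i)).
  - exact: T1_side t2.
  - exact: T1_side t3.
  - by move: ob; rewrite /obtuse [dist2 k j]dist2C; lra.
  - by rewrite mulrC mulrA; exact: T1_circ t1.
  - by rewrite det_heron [LHS]heron_rot.
  - by apply: ltW; apply: reg_det (T1_reg t1).
by split=> //=; have := K4; lra.
Qed.

Lemma charge_ge0 t : 0 <= charge t.
Proof.
rewrite /charge; case: ifP => // /andP[/T0_T1 t1 /(bad_deficit t1)[]].
by move=> /andP[? ?] _; lra.
Qed.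

Lemma load_ge0 i j : 0 <= load i j.
Proof. by apply: sumr_ge0 => k _; exact: charge_ge0. Qed.

(** At most one regular triangle lies across the edge, so at most one term of the sum is nonzero.
    [T1_delaunay] ensures that a loaded edge does not face an obtuse angle of the receiving
    triangle. *)
Lemma loadP i j k : T1 (i, j, k) -> load_of (load i j) (dist2 i j) (dist2 j k) (dist2 k i).
Proof.
move=> t1.
have [/existsP[k' b]|] := boolP [exists k', T0 (j, i, k') && bad (j, i, k')]; last first.
  move=> /existsPn nb; left; apply: big1 => k' _.
  by rewrite /charge ifN.
right; have /andP[/T0_T1 t1' bd] := b.
have -> : load i j = (dist2 i j - 8) / 6.
  rewrite /load (bigD1 k')//= big1 ?addr0; last first.
    move=> k'' nk; rewrite /charge ifN//; apply: contra nk => /andP[/T0_T1 t1'' _].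
    by apply/eqP; exact: (reg_edge_unique generic (T1_reg t1'') (T1_reg t1')).
  by rewrite /charge b /= dist2C.
split=> //; first by have [] := bad_deficit t1' bd; rewrite /= dist2C.
have /andP[/= ob _] := bd.
by have := T1_delaunay t1 t1' ob; rewrite /obtuse -leNgt [dist2 k j]dist2C addrC.
Qed.

(** The discharging inequality: what a triangle keeps and gives away against what it has and
    receives. With a load, [loaded_triangle] applies. Without load, a triangle of [T0] that has less
    than [K] is obtuse, and its own charge fills the deficit. *)
Lemma triangle_balance t : T1 t ->
  (if T0 t then K else 0) +
    (load t.1.1 t.1.2 + load t.1.2 t.2 + load t.2 t.1.1) <=
  D t + (charge t + charge (rot t) + charge (rot (rot t))).
Proof.
case: t => [[i j] k] t1.
change ((if T0 (i, j, k) then K else 0) + (load i j + load j k + load k i) <=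
  det y i j k + (charge (i, j, k) + charge (j, k, i) + charge (k, i, j))).
have t2 := T1_cycle t1; have t3 := T1_cycle t2.
have D0 : 0 < det y i j k by exact: reg_det (T1_reg t1).
have c1 := charge_ge0 (i, j, k); have c2 := charge_ge0 (j, k, i).
have c3 := charge_ge0 (k, i, j).
have [s1 s2 s3] : [/\ 4 <= dist2 i j, 4 <= dist2 j k & 4 <= dist2 k i].
  by split; [exact: T1_side t1|exact: T1_side t2|exact: T1_side t3].
have [l0|l0] := boolP [|| load i j != 0, load j k != 0 | load k i != 0].
  have := loaded_triangle s1 s2 s3 (T1_circ t1) (det_heron i j k) (ltW D0)
    (loadP t1) (loadP t2) (loadP t3).
  have hl : load i j != 0 \/ load j k != 0 \/ load k i != 0.
    by case/or3P: l0; tauto.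
  by move=> /(_ hl) hh; case: ifP => _; have := K4; lra.
move: l0; rewrite !negb_or !negbK => /and3P[/eqP-> /eqP-> /eqP->].
rewrite !addr0; case: ifP => t0; last by lra.
have [KD|DK] := leP K (det y i j k); first by lra.
have bd a b c : T0 (a, b, c) -> obtuse a b c -> det y a b c = det y i j k ->
    K - det y i j k <= charge (a, b, c).
  move=> te oe De; have be : bad (a, b, c) by rewrite /bad /= oe De.
  by have [_] := bad_deficit (T0_T1 te) be; rewrite /charge te be /= De.
have t0' : T0 (j, k, i) by rewrite -[T0 _]/(T0 (rot (i, j, k))) T0_rot.
have t0'' : T0 (k, i, j) by rewrite -[T0 _]/(T0 (rot (j, k, i))) T0_rot.
have [ob1|ob1] := boolP (obtuse i j k); first by have := bd _ _ _ t0 ob1 erefl; lra.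
have [ob2|ob2] := boolP (obtuse j k i).
  by have := bd _ _ _ t0' ob2 (esym (det_rot y i j k)); lra.
have [ob3|ob3] := boolP (obtuse k i j).
  by have := bd _ _ _ t0'' ob3 (det_rot y k i j); lra.
have : K <= det y i j k.
  apply: T1_acute t1 _; move: ob1 ob2 ob3; rewrite /obtuse -!leNgt.
  rewrite [dist2 k j]dist2C [dist2 i k]dist2C [dist2 j i]dist2C => *; split; lra.
lra.
Qed.

(** Only triangles of [T0] charge, and their neighbors lie in [T1], so every charge is counted on
    the right. This is the reason for two collections of triangles. *)
Lemma sum_charge_le_load : \sum_(t | T1 t) charge t <= \sum_(t | T1 t) load t.1.1 t.1.2.
Proof.
apply: (@le_trans _ _ (\sum_t charge t)).
  rewrite [leRHS](bigID T1) /= lerDl sumr_ge0// => t _; exact: charge_ge0.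
rewrite [leRHS](eq_bigl (fun t => true && T1 (t.1, t.2))); last by case.
rewrite (eq_bigr (fun t => charge (t.1, t.2))); last by case.
rewrite -(pair_bigA _ (fun p k => charge (p, k))) /=.
rewrite -(pair_big_dep xpredT (fun p k => T1 (p, k)) (fun p k => load p.1 p.2)) /=.
rewrite (reindex_inj (h := fun p : I * I => (p.2, p.1))) /=; last first.
  by move=> [a b] [c d] /= [-> ->].
apply: ler_sum => -[i j] _ /=.
have [/existsP[k /andP[/T0_neighbour[k' t1] _]]|] :=
    boolP [exists k', T0 (j, i, k') && bad (j, i, k')]; last first.
  move=> /existsPn nb; rewrite big1 => [|k' _]; last by rewrite /charge ifN.
  by apply: sumr_ge0 => k _; exact: load_ge0.
rewrite [leRHS](bigD1 k')//= -[leLHS]/(load i j) lerDl; apply: sumr_ge0 => *; exact: load_ge0.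
Qed.

(** The two triangles in which a vertex of [V0] is the middle one differ in the sign of [cross _ w]
    at their second vertex, so the families [up] and [dn] are disjoint. *)
Lemma count_T0_mid : (2 * #|V0| <= #|[pred t | T0 t && mid t]|)%N.
Proof.
pose up (t : tri) := [&& T0 t, V0 t.1.1 & 0 < cross (y t.1.2 - y t.1.1) w] && (cross (y t.2 - y t.1.1) w < 0).
pose dn (t : tri) := [&& T0 t, V0 t.1.1 & cross (y t.1.2 - y t.1.1) w < 0] && (0 < cross (y t.2 - y t.1.1) w).
have first (P : pred tri) : (forall i, V0 i -> exists2 t, P t & t.1.1 = i) -> (#|V0| <= #|P|)%N.
  move=> hP; have /subset_leq_card s : V0 \subset [seq t.1.1 | t in P].
    by apply/fintype.subsetP => i /hP[t Pt <-]; exact: (fintype.image_f (fun t : tri => t.1.1) Pt).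
  by apply: (leq_trans s); exact: leq_image_card.
have hu : (#|V0| <= #|up|)%N.
  apply: first => i Vi; have [j [k [rg a b]]] := V0_up Vi.
  by exists (i, j, k) => //; rewrite /up /T0 /regt /= rg Vi a b.
have hd : (#|V0| <= #|dn|)%N.
  apply: first => i Vi; have [j [k [rg a b]]] := V0_down Vi.
  by exists (i, j, k) => //; rewrite /dn /T0 /regt /= rg Vi a b.
have disj : #|[predI up & dn]| = 0%N.
  apply: eq_card0 => t; apply/negbTE/negP => /andP[] /andP[/and3P[_ _ a] _] /andP[/and3P[_ _ b] _].
  by have := lt_trans a b; rewrite ltxx.
apply: (@leq_trans #|[predU up & dn]|).
  by have := cardUI up dn; rewrite disj addn0 => ->; rewrite mul2n -addnn leq_add.
apply: subset_leq_card; apply/fintype.subsetP => t; rewrite !inE.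
case/orP => /andP[/and3P[t0 _ a] b]; rewrite t0 /mid /=.
  by rewrite pmulr_rlt0.
by rewrite nmulr_rlt0.
Qed.

Lemma sum_det_ge : 0 <= K -> K *+ (2 * #|V0|) <= \sum_(t | T1 t && mid t) D t.
Proof.
move=> K0; apply: (le_trans (ler_wpMn2l K0 count_T0_mid)).
have -> : K *+ #|[pred t | T0 t && mid t]| = \sum_(t | T1 t && mid t) (if T0 t then K else 0).
  rewrite -big_mkcondr /= -sumr_const; apply: eq_bigl => t; rewrite !inE.
  by rewrite /=; have := @T0_T1 t; case: (T0 t) => [->|_] //=; rewrite ?andbT ?andbF.
have := @ler_sum R _ (index_enum _) (fun t => T1 t && mid t) _ _
  (fun t tm => triangle_balance (proj1 (andP tm))).
rewrite [leLHS]big_split [leRHS]big_split /=.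
have := sum_mid charge; rewrite /= => <-.
have := sum_mid (fun t => load t.1.1 t.1.2); rewrite /= => <-.
have := sum_charge_le_load; lra.
Qed.

End counting.

(** * Generic heights and directions by perturbation *)

Section weights.
Variable R : realType.

Lemma horner_cvg_right (p : {poly R}) : p.[s] @[s --> 0^'+] --> p.[0].
Proof. by apply: cvg_at_right_filter; exact: continuous_horner. Qed.

Lemma horner_near_lt0 (p : {poly R}) : p.[0] < 0 -> \forall s \near 0^'+, p.[s] < 0.
Proof. exact: cvgr_lt (@horner_cvg_right p) 0. Qed.

Lemma horner_near_neq0 (p : {poly R}) : p != 0 -> \forall s \near 0^'+, p.[s] != 0.
Proof.
move=> p0; have [m [q]] := multiplicity_XsubC p 0; rewrite p0 /= => q0 ->.
near=> s.
rewrite hornerM horner_exp !hornerE mulf_neq0//.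
  near: s; apply: cvgr_neq0 (@horner_cvg_right q) _; exact: q0.
by rewrite ?subr0; apply: expf_neq0; apply: lt0r_neq0; near: s; exact: nbhs_right_gt.
Unshelve. all: by end_near. Qed.

Variables (I : finType) (y : I -> R * R) (h0 : I -> R).

(* Take [h i = h0 i + s ^+ (rank of i + 1)] for small [s > 0]. *)
Lemma generic_weights : exists h : I -> R,
  [/\ forall i, 0 <= h i - h0 i <= 1,
      forall i j k l, gap y h0 i j k l < 0 -> gap y h i j k l < 0 &
      forall i j k l, det y i j k != 0 -> gap y h i j k l = 0 -> l \in [:: i; j; k]].
Proof.
(* The exponents start at 1, so that [s = 0] gives back [h0]. They are distinct, so the coefficient
   of ['X^(e l)] in [p i j k l] is [det y i j k] for a fourth point [l]. *)
pose e (i : I) := (enum_rank i).+1.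
pose p i j k l : {poly R} := (gap y h0 i j k l)%:P + (det y i j k *: 'X^(e l) -
  (det y l j k *: 'X^(e i) + det y i l k *: 'X^(e j) + det y i j l *: 'X^(e k))).
have pE s i j k l : (p i j k l).[s] = gap y (fun i => h0 i + s ^+ e i) i j k l.
  by rewrite /p hornerD hornerC hornerD hornerN !hornerD !hornerZ !hornerXn /gap; ring.
have p0 i j k l : (p i j k l).[0] = gap y h0 i j k l.
  rewrite pE /gap /= !exprS !mul0r !addr0; ring.
have eI a b : a != b -> (e a == e b) = false.
  by move=> ab; rewrite /e eqSS; apply: contraNF ab => /eqP/val_inj/enum_rank_inj->.
have pn i j k l : det y i j k != 0 -> l \notin [:: i; j; k] -> p i j k l != 0.
  move=> D; rewrite !inE !negb_or => /and3P[li lj lk].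
  apply: contraNneq D => P0; have : (p i j k l)`_(e l) = 0 by rewrite P0 coef0.
  rewrite /p coefD coefC /= add0r coefB !coefD !coefZ !coefXn eqxx.
  by rewrite !eI// !mulr0 !addr0 subr0 mulr1 => ->.
have H1 : \forall s \near (0 : R)^'+, forall q : I * I * I * I,
    (p q.1.1.1 q.1.1.2 q.1.2 q.2).[0] < 0 -> (p q.1.1.1 q.1.1.2 q.1.2 q.2).[s] < 0.
  apply: filter_forall => -[[[i j] k] l] /=.
  have [lt0|ge0] := ltP ((p i j k l).[0]) 0.
    by near=> s => _; near: s; exact: horner_near_lt0.
  by near=> s.
have H2 : \forall s \near (0 : R)^'+, forall q : I * I * I * I,
    p q.1.1.1 q.1.1.2 q.1.2 q.2 != 0 -> (p q.1.1.1 q.1.1.2 q.1.2 q.2).[s] != 0.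
  apply: filter_forall => -[[[i j] k] l] /=.
  have [->|n0] := eqVneq (p i j k l) 0; first by near=> s.
  by near=> s => _; near: s; exact: horner_near_neq0.
have [s [s0 s1 [h1 h2]]] : exists s : R, [/\ 0 < s, s < 1 &
   (forall q : I * I * I * I,
    (p q.1.1.1 q.1.1.2 q.1.2 q.2).[0] < 0 -> (p q.1.1.1 q.1.1.2 q.1.2 q.2).[s] < 0) /\
   (forall q : I * I * I * I,
    p q.1.1.1 q.1.1.2 q.1.2 q.2 != 0 -> (p q.1.1.1 q.1.1.2 q.1.2 q.2).[s] != 0)].
  near (0 : R)^'+ => s; exists s; split.
  - by near: s; exact: nbhs_right_gt.
  - by near: s; exact: nbhs_right_lt.
  - by split; near: s.
exists (fun i => h0 i + s ^+ e i); split.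
- by move=> i; rewrite addrC addKr exprn_ge0 ?exprn_ile1 ?ltW.
- by move=> i j k l; rewrite -p0 -pE => /(h1 (i, j, k, l)).
- move=> i j k l D; rewrite -pE => g0; apply: contraT => lN.
  by have := h2 (i, j, k, l) (pn _ _ _ _ D lN); rewrite /= g0 eqxx.
Unshelve. all: by end_near. Qed.

Lemma generic_direction : injective y -> exists s : R,
  0 < s < 1 /\ forall i j, i != j -> cross (y j - y i) (s, 1) != 0.
Proof.
move=> yI.
have H : \forall s \near (0 : R)^'+, forall q : I * I, q.1 != q.2 ->
    cross (y q.2 - y q.1) (s, 1) != 0.
  apply: filter_forall => -[i j] /=.
  have [->|ij] := eqVneq i j; first by near=> s.
  pose q : {poly R} := (y j - y i).1%:P - (y j - y i).2 *: 'X.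
  have qE s : q.[s] = cross (y j - y i) (s, 1) by rewrite /q /cross hornerD hornerN hornerC hornerZ hornerX /=; ring.
  have q0 : q != 0.
    apply: contraNneq ij => q0; apply/eqP/yI.
    have := congr1 (fun q : {poly R} => q`_0) q0; have := congr1 (fun q : {poly R} => q`_1) q0.
    rewrite /q !coefB !coefC !coefZ !coefX /= mulr1 mulr0 sub0r subr0 => /eqP; rewrite oppr_eq0 => /eqP e2 e1.
    by case: (y i) (y j) e1 e2 => a b [c d] /= /eqP; rewrite subr_eq0 => /eqP-> /eqP; rewrite subr_eq0 => /eqP->.
  by near=> s => _; rewrite -qE; near: s; exact: horner_near_neq0.
near (0 : R)^'+ => s; exists s; split.
  by apply/andP; split; near: s; [exact: nbhs_right_gt|exact: nbhs_right_lt].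
suff h : forall q : I * I, q.1 != q.2 -> cross (y q.2 - y q.1) (s, 1) != 0.
  by move=> i j; exact: h (i, j).
by near: s.
Unshelve. all: by end_near. Qed.

End weights.

(** * Norm inequalities and the circumcenter *)

Section norm.
Variable R : realType.
Implicit Types (a b p q s z : R * R) (A B : R).

Definition nsq a : R := a.1 ^+ 2 + a.2 ^+ 2.

Lemma nsq_ge0 a : 0 <= nsq a.
Proof. by rewrite addr_ge0 ?sqr_ge0. Qed.

Lemma dot_sqr_le a b : (a.1 * b.1 + a.2 * b.2) ^+ 2 <= nsq a * nsq b.
Proof.
rewrite -subr_ge0; have := sqr_ge0 (cross a b).
by congr (_ <= _); rewrite /nsq /cross; ring.
Qed.

Lemma cross_sqr_le a b : cross a b ^+ 2 <= nsq a * nsq b.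
Proof.
rewrite -subr_ge0; have := sqr_ge0 (a.1 * b.1 + a.2 * b.2).
by congr (_ <= _); rewrite /nsq /cross; ring.
Qed.

Lemma nsqD_le a b A B : 0 <= A -> 0 <= B -> nsq a <= A ^+ 2 -> nsq b <= B ^+ 2 ->
  nsq (a + b) <= (A + B) ^+ 2.
Proof.
move=> A0 B0 hA hB.
have h : a.1 * b.1 + a.2 * b.2 <= A * B.
  apply: ler_of_sqr; first exact: mulr_ge0.
  by apply: (le_trans (dot_sqr_le a b)); rewrite exprMn ler_pM ?nsq_ge0.
by move: hA hB; rewrite /nsq /=; lra.
Qed.

Lemma circumcenter p q s : 0 < det3 p q s -> exists o rho,
  (forall z, det3 p q s * (nsq (z - o) - rho) = det3 p q s * nsq z -
     (det3 z q s * nsq p + det3 p z s * nsq q + det3 p q z * nsq s)) /\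
  4 * det3 p q s ^+ 2 * rho = nsq (p - q) * nsq (q - s) * nsq (s - p).
Proof.
move=> D0; have Dn : det3 p q s != 0 by rewrite gt_eqF.
pose e := q - p; pose f := s - p.
pose o : R * R := (p.1 + (nsq e * f.2 - nsq f * e.2) / (2 * det3 p q s),
          p.2 + (nsq f * e.1 - nsq e * f.1) / (2 * det3 p q s)).
exists o, (nsq (p - o)); split.
  move=> z; rewrite /o /e /f /nsq /= -/(det3 p q s).
  move: Dn; rewrite /det3 => Dn; field; exact: Dn.
rewrite /o /e /f /nsq /=.
by move: Dn; rewrite /det3 => Dn; field; exact: Dn.
Qed.

End norm.

(** * The hypotheses of the compensation argument for saturated centers *)

Section saturated.
Variables (R : realType) (I : finType) (y : I -> R * R) (K r : R).
Hypothesis r0 : 0 <= r.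
Hypothesis K4 : K <= 4.
Hypothesis sep : forall i j, i != j -> 4 <= nsq (y i - y j).
Hypothesis acute : forall i j k, 0 < det y i j k ->
  nonobtuse (dist2 y i j) (dist2 y j k) (dist2 y k i) -> K <= det y i j k.
Hypothesis saturated : forall z, nsq z <= (r + 30) ^+ 2 -> exists i, nsq (y i - z) < 5.

Let h0 i := nsq (y i).
Variable h : I -> R.
Hypothesis h_near : forall i, 0 <= h i - h0 i <= 1.
Hypothesis h_gap : forall i j k l, gap y h0 i j k l < 0 -> gap y h i j k l < 0.
Hypothesis generic : forall i j k l, det y i j k != 0 -> gap y h i j k l = 0 ->
  l \in [:: i; j; k].
Variable s : R.
Hypothesis s01 : 0 < s < 1.
Let w : R * R := (s, 1).
Hypothesis w_generic : forall i j, i != j -> cross (y j - y i) w != 0.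

(** Sides have length at most 5, so triangles meeting [V0] reach [r + 5] and their neighbors
    [r + 10]. Saturation up to [r + 30] leaves room for the auxiliary points needed there. *)
Let V0 := [pred i | nsq (y i) <= r ^+ 2].
Let V1 := [pred i | nsq (y i) <= (r + 10) ^+ 2].

Lemma reg_empty i j k l : reg y h i j k -> 0 <= gap y h0 i j k l.
Proof.
move=> /regP[_ /(_ l)]; rewrite leNgt => /negP g; rewrite leNgt; apply/negP => g0.
by apply: g; exact: h_gap.
Qed.

(** If [rho] were at least 5, the open disk of squared radius 5 that touches the circumcircle at
    [y i] from inside would contain a center by saturation. The circumcenter itself cannot be used,
    as it might lie outside the saturated region; the center [c] of the small disk stays close to
    [y i]. *)
Lemma reg_circ i j k : reg y h i j k -> nsq (y i) <= (r + 20) ^+ 2 ->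
  exists o rho, [/\ rho < 5,
    nsq (y i - o) = rho, nsq (y j - o) = rho, nsq (y k - o) = rho &
    4 * det y i j k ^+ 2 * rho = dist2 y i j * dist2 y j k * dist2 y k i].
Proof.
move=> rg yi; have D0 := reg_det rg; have [ o [rho [oE vol]]] := circumcenter D0.
have onC p : det y i j k * (nsq (p - o) - rho) = 0 -> nsq (p - o) = rho.
  by move=> /eqP; rewrite mulf_eq0 gt_eqF//= subr_eq0 => /eqP.
have oi : nsq (y i - o) = rho by apply: onC; rewrite oE /det /det3; ring.
have oj : nsq (y j - o) = rho by apply: onC; rewrite oE /det /det3; ring.
have ok : nsq (y k - o) = rho by apply: onC; rewrite oE /det /det3; ring.
have empty l : rho <= nsq (y l - o).
  have := reg_empty l rg; rewrite /gap -oE -/(det y i j k) pmulr_rge0//.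
  by rewrite subr_ge0.
exists o, rho; split=> //; rewrite ltNge; apply/negP => rho5.
pose t := Num.sqrt (5 / rho).
have t2 : t ^+ 2 * rho = 5 by rewrite sqr_sqrtr ?divr_ge0 ?divfK ?gt_eqF//; lra.
have t0 : 0 <= t by exact: sqrtr_ge0.
have t1 : t <= 1 by nra.
pose c := y i + (t * (o.1 - (y i).1), t * (o.2 - (y i).2)).
have ci : nsq (t * (o.1 - (y i).1), t * (o.2 - (y i).2)) = 5.
  by rewrite -t2 -oi /nsq /=; ring.
have [l] : exists l, nsq (y l - c) < 5.
  apply: saturated; apply: (@le_trans _ _ ((r + 20 + 3) ^+ 2)); last by rewrite ler_sqr ?nnegrE; have := r0; lra.
  by apply: nsqD_le => //; have := r0; [lra|rewrite ci; lra].
have := empty l; rewrite -oi => el; apply/negP; rewrite -leNgt.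
have : 0 <= (1 - t) * nsq (y l - y i) by rewrite mulr_ge0 ?nsq_ge0; lra.
have : 0 <= t * (nsq (y l - o) - nsq (y i - o)) by rewrite mulr_ge0; lra.
move=> h1 h2; rewrite -ci -subr_ge0; have := addr_ge0 h1 h2.
by congr (_ <= _); rewrite /nsq /c /=; ring.
Qed.

Lemma reg_near i j k : reg y h i j k -> nsq (y i) <= (r + 20) ^+ 2 ->
  nsq (y j - y i) <= 5 ^+ 2 /\ nsq (y k - y i) <= 5 ^+ 2.
Proof.
move=> rg yi; have [ o [rho [rho5 oi oj ok _]]] := reg_circ rg yi.
have rho0 : 0 <= rho by rewrite -oi nsq_ge0.
(* A rational upper bound for the square root of 5, the bound on the circumradius. *)
pose q := 5 / 2 : R.
have q0 : 0 <= q by rewrite /q; lra.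
have qq : 5 = q + q :> R by rewrite /q; field.
have q2 : 5 <= q ^+ 2 by rewrite /q expr2; lra.
have oi' : nsq (o - y i) <= q ^+ 2.
  by apply: (@le_trans _ _ rho); [rewrite -oi /nsq /=; lra|lra].
rewrite qq; split; rewrite -(subrKA o); apply: nsqD_le => //; lra.
Qed.

Lemma reg_spread A i j k : reg y h i j k -> 0 <= A <= r + 15 -> nsq (y i) <= A ^+ 2 ->
  nsq (y j) <= (A + 5) ^+ 2 /\ nsq (y k) <= (A + 5) ^+ 2.
Proof.
move=> rg /andP[A0 Ar] yi.
have [//|d1 d2] := reg_near rg; first by apply: (le_trans yi); nra.
by split; rewrite -[y _](subrKC (y i)); apply: nsqD_le.
Qed.

Local Notation T0 := (T0 y h V0).
Local Notation T1 := (T1 y h V1).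

Lemma V1_of_near i j k : reg y h i j k ->
  [|| nsq (y i) <= (r + 5) ^+ 2, nsq (y j) <= (r + 5) ^+ 2 | nsq (y k) <= (r + 5) ^+ 2] ->
  T1 (i, j, k).
Proof.
have le5 a : nsq a <= (r + 5) ^+ 2 -> nsq a <= (r + 10) ^+ 2.
  by move=> /le_trans; apply; rewrite ler_sqr ?nnegrE; have := r0; lra.
have A5 : 0 <= r + 5 <= r + 15 by have := r0; move=> ?; apply/andP; split; lra.
have E : r + 5 + 5 = r + 10 by ring.
move=> rg; rewrite /T1 /regt /= rg /=.
have rg2 := rg; rewrite reg_rot in rg2; have rg3 := rg2; rewrite reg_rot in rg3.
case/or3P => near.
- by have := reg_spread rg A5 near; rewrite E => -[-> ->]; rewrite le5.
- by have := reg_spread rg2 A5 near; rewrite E => -[-> ->]; rewrite le5.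
- by have := reg_spread rg3 A5 near; rewrite E => -[-> ->]; rewrite le5.
Qed.

Lemma T0_T1 t : T0 t -> T1 t.
Proof.
have le0 a : nsq a <= r ^+ 2 -> nsq a <= (r + 5) ^+ 2.
  by move=> /le_trans; apply; rewrite ler_sqr ?nnegrE; have := r0; lra.
case: t => -[i j] k /andP[rg]; rewrite /= => near; apply: V1_of_near => //.
by case/or3P: near => /le0 ->; rewrite ?orbT.
Qed.

Lemma T0_neighbour i j k : T0 (j, i, k) -> exists k', T1 (i, j, k').
Proof.
have r00 := r0; have A0 : 0 <= r <= r + 15 by apply/andP; split; lra.
move=> /andP[]; rewrite /regt /= => rg near.
have le0 a : nsq a <= r ^+ 2 -> nsq a <= (r + 5) ^+ 2.
  by move=> /le_trans; apply; rewrite ler_sqr ?nnegrE; lra.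
have near' : nsq (y i) <= (r + 5) ^+ 2 /\ nsq (y j) <= (r + 5) ^+ 2.
  have rg2 := rg; rewrite reg_rot in rg2; have rg3 := rg2; rewrite reg_rot in rg3.
  case/or3P: near => near; split.
  - by have [] := reg_spread rg A0 near.
  - exact: le0.
  - exact: le0.
  - by have [] := reg_spread rg2 A0 near.
  - by have [] := reg_spread rg3 A0 near.
  - by have [] := reg_spread rg3 A0 near.
have [yi yj] := near'.
have yj20 : nsq (y j) <= (r + 20) ^+ 2.
  by apply: (le_trans yj); rewrite ler_sqr ?nnegrE; lra.
have [d1 _] := reg_near rg yj20.
have ij : i != j by apply: contraTneq (reg_det rg) => ->; rewrite det_eq ltxx.
pose e := y j - y i.
have e4 : 4 <= nsq e by rewrite /e -[nsq _]/(dist2 y j i) dist2C; exact: sep.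
have e25 : nsq e <= 5 ^+ 2 by rewrite -[nsq e]/(dist2 y j i) dist2C.
have [|k' hk] := reg_neighbour rg; last first.
  by exists k'; apply: V1_of_near => //; rewrite yi.
(* The edge doubled and turned by a right angle. As the edge has length at least 2, a center within
   squared distance 5 of [y i + n] lies strictly on the left of it. *)
pose n : R * R := (- 2 * e.2, 2 * e.1).
have [l yl] : exists l, nsq (y l - (y i + n)) < 5.
  apply: saturated; apply: (@le_trans _ _ ((r + 5 + 10) ^+ 2)).
    apply: nsqD_le; [lra|lra|by []|].
    have -> : nsq n = 4 * nsq e by rewrite /nsq /=; ring.
    lra.
  by rewrite ler_sqr ?nnegrE; lra.
exists l; pose d := y l - (y i + n).
have -> : det y i j l = 2 * nsq e + cross e d.
  by rewrite /det /det3 /cross /d /n /e /nsq /=; ring.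
have := cross_sqr_le e d; have : nsq d < 5 by [].
have := nsq_ge0 d; move: (nsq e) e4 (nsq d) (cross e d) => E E4 dd c *; nra.
Qed.

Lemma T1_side i j k : T1 (i, j, k) -> 4 <= dist2 y i j.
Proof.
move=> /andP[/= rg _]; apply: sep.
by apply: contraTneq (reg_det rg) => /= ->; rewrite det_eq ltxx.
Qed.

Lemma T1_circ i j k : T1 (i, j, k) ->
  dist2 y i j * dist2 y j k * dist2 y k i < 20 * det y i j k ^+ 2.
Proof.
have r00 := r0; move=> /andP[/= rg /andP[]]; rewrite /= => yi _.
have [|o [rho [rho5 _ _ _ <-]]] := reg_circ rg.
  by apply: (le_trans yi); rewrite ler_sqr ?nnegrE; lra.
have D0 : 0 < det y i j k ^+ 2 by rewrite exprn_gt0// (reg_det rg).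
have : 0 < det y i j k ^+ 2 * (5 - rho) by rewrite mulr_gt0// subr_gt0.
lra.
Qed.

Lemma T1_acute i j k : T1 (i, j, k) ->
  nonobtuse (dist2 y i j) (dist2 y j k) (dist2 y k i) -> K <= det y i j k.
Proof. by move=> /andP[/= rg _]; apply: acute; exact: reg_det rg. Qed.

(** The angles facing a common Delaunay edge add up to at most a straight angle; [E] is the
    polynomial form of this, for the unperturbed heights [h0]. *)
Lemma T1_delaunay i j k k' : T1 (i, j, k) -> T1 (j, i, k') ->
  obtuse y j i k' -> ~~ obtuse y i j k.
Proof.
move=> /andP[/= rg _] /andP[/= rg' _] ob'; apply/negP => ob.
have := reg_empty k' rg; rewrite leNgt => /negP; apply.
have D := reg_det rg; have D' := reg_det rg'.
have E : 2 * gap y h0 i j k k' =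
  det y i j k * (dist2 y k' j + dist2 y k' i - dist2 y j i) +
  det y j i k' * (dist2 y k i + dist2 y k j - dist2 y i j).
  rewrite /gap /h0 /nsq /det /det3 /dist2 /=; ring.
have : det y i j k * (dist2 y k' j + dist2 y k' i - dist2 y j i) < 0.
  by rewrite pmulr_rlt0// subr_lt0.
have : det y j i k' * (dist2 y k i + dist2 y k j - dist2 y i j) < 0.
  by rewrite pmulr_rlt0// subr_lt0.
lra.
Qed.

(** The tangent plane of the paraboloid at [y i] passes at least 4 below the other lifts, which
    perturbations of at most 1 cannot undo. *)
Lemma supports i l : (2 * (y i).1) * (y l - y i).1 + (2 * (y i).2) * (y l - y i).2 <= h l - h i.
Proof.
have [->|li] := eqVneq l i; first by rewrite /= !subrr !mulr0 addr0.
have /andP[a1 _] := h_near l; have /andP[_ b1] := h_near i; have := sep li.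
move: a1 b1; rewrite /h0 /nsq /=; lra.
Qed.

(** Saturation gives centers near [y i + 5 * v + 5 * n] and [y i + 5 * v - 5 * n], hence ahead of
    [y i] on both sides of the ray along [v]. They show that the minimization in [exists_reg] has a
    candidate. *)
Lemma exists_star (v : R * R) i : nsq (y i) <= r ^+ 2 -> 1 <= nsq v <= 2 ->
  (forall l, l != i -> cross (y l - y i) v != 0) ->
  exists j k, [/\ reg y h i j k, 0 < cross (y j - y i) v & 0 < cross v (y k - y i)].
Proof.
have r00 := r0; move=> yi /andP[v1 v2] vgen.
apply: (@exists_reg _ _ _ _ i v (2 * (y i).1, 2 * (y i).2)) => //.
  by move=> l /=; exact: supports.
pose n : R * R := (v.2, - v.1).
have nsqn : nsq n = nsq v by rewrite /nsq /n /=; ring.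
have find (c : R) : c ^+ 2 = 25 -> exists l, nsq (y l - (y i + (5 * v.1 + c * n.1, 5 * v.2 + c * n.2))) < 5.
  move=> c2; apply: saturated; apply: (@le_trans _ _ ((r + 10) ^+ 2)).
    apply: nsqD_le => //.
    have -> : nsq (5 * v.1 + c * n.1, 5 * v.2 + c * n.2) = (25 + c ^+ 2) * nsq v.
      by rewrite /nsq /n /=; ring.
    rewrite c2; lra.
  by rewrite ler_sqr ?nnegrE; lra.
have [j hj] : exists l, nsq (y l - (y i + (5 * v.1 + 5 * n.1, 5 * v.2 + 5 * n.2))) < 5.
  by apply: find; ring.
have [k hk] : exists l, nsq (y l - (y i + (5 * v.1 + (- 5) * n.1, 5 * v.2 + (- 5) * n.2))) < 5.
  by apply: find; ring.
set dj := y j - _ in hj; set dk := y k - _ in hk.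
have dot_lt d : nsq d < 5 -> - (5 * nsq v) < d.1 * v.1 + d.2 * v.2.
  move=> d5; have := dot_sqr_le d v; have := nsq_ge0 d.
  move: (nsq v) v1 (nsq d) d5 (d.1 * _ + _) => V V1' dd d5 c *; nra.
have cross_lt d : nsq d < 5 -> `|cross d v| < 5 * nsq v.
  move=> d5; rewrite ltr_norml; have := cross_sqr_le d v; have := nsq_ge0 d.
  by move: (nsq v) v1 (nsq d) d5 (cross d v) => V V1' dd d5 c *; apply/andP; split; nra.
have ej : cross (y j - y i) v = 5 * nsq v + cross dj v.
  by rewrite /cross /dj /n /nsq /=; ring.
have ek : cross v (y k - y i) = 5 * nsq v - cross dk v.
  by rewrite /cross /dk /n /nsq /=; ring.
have pj : 0 < cross (y j - y i) v by have := cross_lt _ hj; rewrite ej ltr_norml => /andP[]; lra.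
have pk : 0 < cross v (y k - y i) by have := cross_lt _ hk; rewrite ek ltr_norml => /andP[]; lra.
have qj : 0 < (y j - y i).1 * v.1 + (y j - y i).2 * v.2.
  have -> : (y j - y i).1 * v.1 + (y j - y i).2 * v.2 = 5 * nsq v + (dj.1 * v.1 + dj.2 * v.2).
    by rewrite /dj /n /nsq /=; ring.
  by have := dot_lt _ hj; lra.
have qk : 0 < (y k - y i).1 * v.1 + (y k - y i).2 * v.2.
  have -> : (y k - y i).1 * v.1 + (y k - y i).2 * v.2 = 5 * nsq v + (dk.1 * v.1 + dk.2 * v.2).
    by rewrite /dk /n /nsq /=; ring.
  by have := dot_lt _ hk; lra.
exists j, k; split=> //.
have : 0 < nsq v * det y i j k.
  have -> : nsq v * det y i j k = ((y j - y i).1 * v.1 + (y j - y i).2 * v.2) * cross v (y k - y i)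
     + cross (y j - y i) v * ((y k - y i).1 * v.1 + (y k - y i).2 * v.2).
    by rewrite /det /det3 /cross /nsq /=; ring.
  by rewrite addr_gt0// mulr_gt0.
by rewrite pmulr_rgt0//; lra.
Qed.

Lemma sum_det_saturated : 0 <= K ->
  K *+ (2 * #|V0|) <= \sum_(t | T1 t && mid y w t) det y t.1.1 t.1.2 t.2.
Proof.
have /andP[s0 s1] := s01.
have w12 : 1 <= nsq w <= 2 by rewrite /nsq /w /=; apply/andP; split; nra.
apply: sum_det_ge => //.
- exact: T0_T1.
- exact: T0_neighbour.
- exact: T1_side.
- exact: T1_circ.
- exact: T1_acute.
- exact: T1_delaunay.
- move=> i Vi; have [|j [k [rg a b]]] := exists_star Vi w12.
    by move=> l li; apply: w_generic; rewrite eq_sym.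
  exists j, k; split=> //; move: b; rewrite /cross; lra.
- move=> i Vi; have [||j [k [rg a b]]] := @exists_star (- s, -1) i Vi.
  + have -> : nsq (- s, -1) = nsq w by rewrite /nsq /w /=; ring.
    exact: w12.
  + move=> l li; have -> : cross (y l - y i) (- s, -1) = - cross (y l - y i) w.
      by rewrite /cross /w /=; ring.
    by rewrite oppr_eq0; apply: w_generic; rewrite eq_sym.
  exists j, k; split=> //; move: a b; rewrite /cross /w /=; lra.
Qed.

End saturated.

(** * Areas of finite families of sets *)

Section finite_area.
Variable R : realType.
Local Notation pt := (measurableTypeR R * measurableTypeR R)%type.

Lemma measurable_bigU (I : choiceType) (s : seq I) (F : I -> set pt) :
  (forall i, i \in s -> measurable (F i)) -> measurable (\big[setU/set0]_(i <- s) F i).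
Proof.
elim: s => [|i s IH] mF; first by rewrite big_nil.
rewrite big_cons; apply: measurableU; first by apply: mF; rewrite mem_head.
by apply: IH => j js; apply: mF; rewrite in_cons js orbT.
Qed.

Lemma sum_area_disjoint (I : choiceType) (s : seq I) (F : I -> set pt) (a : I -> R) (A : set pt) :
  uniq s -> (forall i, i \in s -> measurable (F i)) ->
  (forall i j, i \in s -> j \in s -> i != j -> F i `&` F j = set0) ->
  (forall i, i \in s -> ((a i)%:E <= area (F i))%E) ->
  measurable A -> (forall i, i \in s -> F i `<=` A) ->
  ((\sum_(i <- s) a i)%:E <= area A)%E.
Proof.
move=> us mF dF aF mA FA.
apply: (@le_trans _ _ (area (\big[setU/set0]_(i <- s) F i))); last first.
  apply: le_area => //; first exact: measurable_bigU.
  by rewrite -bigcup_seq => z [i /= ? ?]; apply: (FA i).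
elim: s us mF dF aF {FA} => [|i s IH] /= us mF dF aF.
  by rewrite !big_nil area0.
rewrite !big_cons /area measureU.
- rewrite EFinD leeD//; first by apply: aF; rewrite mem_head.
  apply: IH; first by case/andP: us.
  + by move=> j js; apply: mF; rewrite in_cons js orbT.
  + by move=> j k js ks; apply: dF; rewrite in_cons ?js ?ks orbT.
  + by move=> j js; apply: aF; rewrite in_cons js orbT.
- by apply: mF; rewrite mem_head.
- by apply: measurable_bigU => j js; apply: mF; rewrite in_cons js orbT.
- rewrite -bigcup_seq setI_bigcupr; apply: bigcup0 => j /= js; apply: dF.
  + by rewrite mem_head.
  + by rewrite in_cons js orbT.
  + by apply: contraTneq js => <-; case/andP: us.
Qed.

Lemma area_cover_le (I : choiceType) (s : seq I) (F : I -> set pt) (a : I -> R) (A : set pt) :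
  (forall i, i \in s -> measurable (F i)) ->
  (forall i, i \in s -> (area (F i) <= (a i)%:E)%E) ->
  measurable A -> A `<=` \big[setU/set0]_(i <- s) F i ->
  (area A <= (\sum_(i <- s) a i)%:E)%E.
Proof.
move=> mF aF mA AF.
apply: (@le_trans _ _ (area (\big[setU/set0]_(i <- s) F i))).
  by apply: le_area => //; exact: measurable_bigU.
elim: s mF aF {AF} => [|i s IH] /= mF aF.
  by rewrite !big_nil area0.
have mU : measurable (\big[setU/set0]_(j <- s) F j).
  by apply: measurable_bigU => j js; apply: mF; rewrite in_cons js orbT.
rewrite !big_cons; apply: (le_trans (area_setU_le (mF i (mem_head _ _)) mU)).
rewrite EFinD leeD//; first by apply: aF; rewrite mem_head.
apply: IH.
+ by move=> j js; apply: mF; rewrite in_cons js orbT.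
+ by move=> j js; apply: aF; rewrite in_cons js orbT.
Qed.

Lemma disk0E (r : R) : 0 <= r -> disk 0 r = [set z : R * R | nsq z <= r ^+ 2].
Proof. by move=> r0; rewrite diskE//; apply/funext => z /=; rewrite !subr0. Qed.

End finite_area.

Section disjoint_triangles.
Variables (R : realType) (I : finType) (y : I -> R * R) (h : I -> R) (w : R * R).
Hypothesis generic : forall i j k l, det y i j k != 0 -> gap y h i j k l = 0 ->
  l \in [:: i; j; k].
Hypothesis w_generic : forall i j, i != j -> cross (y j - y i) w != 0.

Definition tri_set (t : I * I * I) := open_triangle (y t.1.1) (y t.1.2) (y t.2).

(** Overlapping regular triangles have the same vertices; the orientation leaves only rotations, and
    [mid] selects one of these. *)
Lemma tri_set_inj t t' z : regt y h t -> regt y h t' -> mid y w t -> mid y w t' ->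
  tri_set t z -> tri_set t' z -> t = t'.
Proof.
case: t t' => [[i j] k] [[i' j'] k'] rg rg' m m' tz tz'.
have [] := reg_vertices generic rg rg' tz tz'.
have [ij' jk' ik'] := reg_distinct rg'.
have D := reg_det rg; have D' := reg_det rg'; rewrite /= in D D' ij' jk' ik'.
have odd a b c : det y a c b = - det y a b c by rewrite /det /det3; ring.
have P := mid_partition w_generic rg.
have P1 : ~~ mid y w (j, k, i).
  by apply/negP => m1; move: P; rewrite /rot /= m m1.
have P2 : ~~ mid y w (k, i, j).
  by apply/negP => m1; move: P; rewrite /rot /= m m1; case: (mid _ _ _).
rewrite /= !inE => hi hj hk; move: D' m' ij' jk' ik'.
by case/or3P: hi => /eqP ->; case/or3P: hj => /eqP ->; case/or3P: hk => /eqP -> //=;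
  rewrite ?eqxx // => D' m' _ _ _;
  solve [by rewrite m' in P1 | by rewrite m' in P2 |
    by exfalso; move: D'; rewrite odd; lra |
    by exfalso; move: D'; rewrite -det_rot odd; lra |
    by exfalso; move: D'; rewrite det_rot odd; lra ].
Qed.

Lemma sum_det_le (P : pred (I * I * I)) (rho : R) : 0 < rho ->
  (forall t, P t -> [/\ regt y h t, mid y w t, nsq (y t.1.1) <= rho ^+ 2,
     nsq (y t.1.2) <= rho ^+ 2 & nsq (y t.2) <= rho ^+ 2]) ->
  \sum_(t | P t) det y t.1.1 t.1.2 t.2 <= 2 * (pi * rho ^+ 2).
Proof.
move=> rho0 HP.
pose A := disk (0 : R * R) rho.
have : ((\sum_(t <- enum P) (det y t.1.1 t.1.2 t.2 / 2)%R)%:E <= area A)%E.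
  apply: (@sum_area_disjoint _ _ _ tri_set).
  - exact: enum_uniq.
  - by move=> t _; exact: measurable_open_triangle.
  - move=> t t'; rewrite !mem_enum => /HP[r1 m1 _ _ _] /HP[r2 m2 _ _ _] /eqP tt'.
    by apply/seteqP; split=> z // -[z1 z2]; apply: tt'; exact: tri_set_inj z1 z2.
  - move=> t; rewrite mem_enum => /HP[r1 _ _ _ _].
    by apply: area_open_triangle_ge; exact: reg_det r1.
  - exact: measurable_disk.
  - move=> t; rewrite mem_enum => /HP[r1 _ h1 h2 h3] z [z1 z2 z3].
    rewrite /A disk0E ?ltW//=.
    have D0 := reg_det r1.
    move: z1 z2 z3 D0 h1 h2 h3; rewrite /det.
    move: (y t.1.1) (y t.1.2) (y t.2) => p q s z1 z2 z3 D0 h1 h2 h3.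
    (* Convexity of the disk, written in barycentric coordinates and cleared of denominators. *)
    have E : det3 p q s ^+ 2 * (rho ^+ 2 - nsq z) =
      det3 p q s * (det3 z q s * (rho ^+ 2 - nsq p) + det3 p z s * (rho ^+ 2 - nsq q) +
       det3 p q z * (rho ^+ 2 - nsq s)) +
      (det3 z q s * det3 p z s * nsq (p - q) + det3 p z s * det3 p q z * nsq (q - s)
       + det3 p q z * det3 z q s * nsq (s - p)).
      rewrite /nsq /det3 /=; ring.
    rewrite -subr_ge0 -(pmulr_rge0 _ (exprn_gt0 2 D0)) E.
    rewrite -subr_ge0 in h1; rewrite -subr_ge0 in h2; rewrite -subr_ge0 in h3.
    have {}z1 := ltW z1; have {}z2 := ltW z2; have {}z3 := ltW z3; have {}D0 := ltW D0.
    apply: addr_ge0; first apply: mulr_ge0 => //; do 2?apply: addr_ge0;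
      by repeat apply: mulr_ge0; rewrite ?nsq_ge0.
rewrite /A area_disk// lee_fin -mulr_suml big_enum /=; lra.
Qed.

End disjoint_triangles.

(** * Counting the centers of a sparse set *)

Section sparse.
Variables (R : realType) (K : R).
Implicit Types (s : seq (R * R)) (r : R).
Local Notation pt := (measurableTypeR R * measurableTypeR R)%type.

(* What the upper bound uses of a separable packing. *)
Definition sparse (X : set (R * R)) :=
  (forall p q, X p -> X q -> p != q -> 4 <= nsq (p - q)) /\
  (forall p q t, X p -> X q -> X t -> 0 < det3 p q t ->
    nonobtuse (nsq (p - q)) (nsq (q - t)) (nsq (t - p)) -> K <= det3 p q t).

Lemma nsqC (p q : R * R) : nsq (p - q) = nsq (q - p).
Proof. rewrite /nsq /=; ring. Qed.

Lemma det3_neq (p q t : R * R) : 0 < det3 p q t -> [/\ p != q, q != t & t != p].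
Proof.
move=> D; split; apply: contraTneq D => ->; rewrite -leNgt le_eqVlt; apply/orP; left;
  apply/eqP; rewrite /det3; ring.
Qed.

Lemma det3_nsq_heron (p q t : R * R) :
  4 * det3 p q t ^+ 2 = heron (nsq (p - q)) (nsq (q - t)) (nsq (t - p)).
Proof. rewrite /heron /nsq /det3 /=; ring. Qed.

Lemma det3_rot (p q t : R * R) : det3 p q t = det3 q t p.
Proof. rewrite /det3; ring. Qed.

(* Triangles with a new vertex at squared distance at least 5 from the others satisfy [heron_ge64]. *)
Lemma sparse_cons s (z : R * R) : K <= 4 -> sparse [set` s] ->
  (forall p, p \in s -> 5 <= nsq (p - z)) -> sparse [set` z :: s].
Proof.
move=> K4 [sep ac] far; split.
  move=> p q /=; rewrite !in_cons => /orP[/eqP->|ps] /orP[/eqP->|qs]; first by rewrite eqxx.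
  - by move=> _; rewrite nsqC; have := far _ qs; lra.
  - by move=> _; have := far _ ps; lra.
  - exact: sep.
have first q t : q \in s -> t \in s -> 0 < det3 z q t ->
    nonobtuse (nsq (z - q)) (nsq (q - t)) (nsq (t - z)) -> K <= det3 z q t.
  move=> qs ts D no; have [_ qt _] := det3_neq D.
  have f1 : 5 <= nsq (z - q) by rewrite nsqC far.
  have := heron_ge64 f1 (far _ ts) (sep _ _ qs ts qt) (nonobtuse_swap (nonobtuse_rot (nonobtuse_rot no))).
  have -> : heron (nsq (z - q)) (nsq (t - z)) (nsq (q - t)) = 4 * det3 z q t ^+ 2.
    by rewrite det3_nsq_heron /heron; ring.
  by move: (det3 z q t) D => D D0; nra.
move=> p q t /=; rewrite !in_cons => hp hq ht D no; have [pq qt tp] := det3_neq D.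
case/orP: hp => [/eqP pz|ps].
  rewrite pz in D no pq tp *; apply: first => //.
    by move: hq; rewrite eq_sym (negbTE pq).
  by move: ht; rewrite (negbTE tp).
case/orP: hq => [/eqP qz|qs].
  rewrite qz det3_rot in D no pq qt *; apply: first => //; last exact: nonobtuse_rot.
  by move: ht; rewrite eq_sym (negbTE qt).
case/orP: ht => [/eqP tz|ts]; last exact: ac.
rewrite tz -det3_rot in D no *; apply: first => //.
by do 2 apply: nonobtuse_rot.
Qed.

Lemma nsq_lt_of_sub (a b : R * R) (A B : R) : 0 <= A -> 0 <= B ->
  nsq (a - b) <= A ^+ 2 -> nsq b <= B ^+ 2 -> nsq a <= (A + B) ^+ 2.
Proof. by move=> A0 B0 h1 h2; rewrite -(subrK b a); exact: nsqD_le. Qed.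

(** A crude bound whose purpose is to make saturation terminate. The radius is 9/10 because closed
    unit disks may touch. *)
Lemma sparse_size_bound s r : 0 <= r -> uniq s -> sparse [set` s] ->
  (forall p, p \in s -> nsq p <= r ^+ 2) -> (size s)%:R * 3 <= 4 * (r + 1) ^+ 2.
Proof.
move=> r0 us [sep _] sr.
pose rho := 9 / 10 : R; have rho0 : 0 < rho by rewrite /rho; lra.
pose A := disk (0 : R * R) (r + 1); have r1 : 0 < r + 1 by lra.
have : ((\sum_(p <- s) (pi * rho ^+ 2))%:E <= area A)%E.
  apply: (@sum_area_disjoint _ _ s (fun p => disk p rho)) => //.
  - by move=> p _; exact: measurable_disk.
  - move=> p q ps qs pq; apply/seteqP; split=> z // -[].
    rewrite !diskE ?ltW//= => h1 h2; have := sep _ _ ps qs pq; apply/negP; rewrite -ltNge.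
    have : nsq (p - q) <= (rho + rho) ^+ 2.
      rewrite -(subrKA z); apply: nsqD_le; rewrite ?(ltW rho0)//.
      by rewrite nsqC.
    by move/le_lt_trans; apply; rewrite /rho expr2; lra.
  - by move=> p _; rewrite area_disk.
  - exact: measurable_disk.
  - move=> p ps z; rewrite /A disk0E ?ltW// diskE ?ltW//= => hz.
    rewrite addrC; apply: (@nsq_lt_of_sub _ p _ _ ler01 r0 _ (sr p ps)).
    by apply: (le_trans hz); rewrite /rho !expr2; lra.
rewrite /A area_disk// lee_fin big_const_seq count_predT iter_addr addr0 -mulrnAr ler_pM2l ?pi_gt0//.
rewrite -mulr_natl /rho expr2 => hh; nra.
Qed.

(** Points are inserted greedily: [sparse_cons] keeps the set sparse and [sparse_size_bound] limits
    the number of insertions. *)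
Lemma sparse_saturate s r : 0 <= r -> K <= 4 -> uniq s -> sparse [set` s] ->
  (forall p, p \in s -> nsq p <= r ^+ 2) ->
  exists s', [/\ uniq s', sparse [set` s'], {subset s <= s'} &
    forall z, nsq z <= r ^+ 2 -> exists2 p, p \in s' & nsq (p - z) < 5].
Proof.
move=> r0 K4.
have [N HN] : exists N : nat, 4 * (r + 1) ^+ 2 < N%:R * 3.
  exists (Num.truncn (4 * (r + 1) ^+ 2)).+1.
  have : 0 <= 4 * (r + 1) ^+ 2 by rewrite mulr_ge0 ?sqr_ge0.
  have := truncnS_gt (4 * (r + 1) ^+ 2); move: (_%:R) => n; lra.
have : exists n, (N - size s <= n)%N by exists (N - size s)%N.
move=> [n]; elim: n s => [|n IH] s hn us sp sr.
  have := sparse_size_bound r0 us sp sr; move: hn; rewrite leqn0 subn_eq0 -(ler_nat R) => ? ?.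
  by exfalso; lra.
have [sat|] := pselect (forall z, nsq z <= r ^+ 2 -> exists2 p, p \in s & nsq (p - z) < 5).
  by exists s; split.
move=> /existsNP[z /not_implyP[zr nsat]].
have far p : p \in s -> 5 <= nsq (p - z).
  by move=> ps; rewrite leNgt; apply/negP => lt5; apply: nsat; exists p.
have zs : z \notin s.
  by apply/negP => /far; rewrite /nsq subrr /= expr0n /= addr0; lra.
have [||||s' [us' sp' ss' sat']] := IH (z :: s).
- by move: hn => /=; lia.
- by rewrite /= zs.
- exact: sparse_cons.
- by move=> p; rewrite in_cons => /orP[/eqP->//|]; exact: sr.
by exists s'; split=> // p ps; apply: ss'; rewrite in_cons ps orbT.
Qed.

(** The bound is asked only for centers within [r], while saturation reaches [r + 30] and the
    triangles used fit into the disk of radius [r + 10]. The two triangles per center cancel against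
    [det3] being twice the area. *)
Lemma sparse_card s r : 0 <= r -> 0 <= K <= 4 -> uniq s -> sparse [set` s] ->
  (forall p, p \in s -> nsq p <= r ^+ 2) ->
  K * (size s)%:R <= pi * (r + 10) ^+ 2.
Proof.
move=> r0 /andP[K0 K4] us sp sr.
have r30 : 0 <= r + 30 by lra.
have sr30 p : p \in s -> nsq p <= (r + 30) ^+ 2.
  by move=> /sr /le_trans; apply; rewrite ler_sqr ?nnegrE; lra.
have [s' [us' [sep ac] ss' sat]] := sparse_saturate r30 K4 us sp sr30.
pose y (i : 'I_(size s')) := nth (0 : R * R) s' i.
have yI : injective y.
  by move=> i j /eqP; rewrite nth_uniq// => /eqP/val_inj.
have ys i : y i \in s' by exact: mem_nth.
have ysurj p : p \in s' -> exists i, y i = p.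
  move=> ps; have lt : (index p s' < size s')%N by rewrite index_mem.
  by exists (Ordinal lt); rewrite /y /= nth_index.
have sepy i j : i != j -> 4 <= nsq (y i - y j).
  move=> ij; apply: sep; [exact: ys|exact: ys|].
  by apply: contraNneq ij => /yI ->.
have acy i j k : 0 < det y i j k ->
    nonobtuse (dist2 y i j) (dist2 y j k) (dist2 y k i) -> K <= det y i j k.
  by apply: ac; exact: ys.
have saty z : nsq z <= (r + 30) ^+ 2 -> exists i, nsq (y i - z) < 5.
  by move=> /sat[p /ysurj[i <-]]; exists i.
have [h [h1 h2 h3]] := @generic_weights R _ y (fun i => nsq (y i)).
have [e [e01 he]] := generic_direction yI.
have H1 := sum_det_saturated r0 K4 sepy acy saty h1 h2 h3 e01 he K0.
have r10 : 0 < r + 10 by lra.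
have H2 : \sum_(t | T1 y h [pred i | nsq (y i) <= (r + 10) ^+ 2] t && mid y (e, 1) t)
    det y t.1.1 t.1.2 t.2 <= 2 * (pi * (r + 10) ^+ 2).
  apply: (sum_det_le h3 he r10) => t /andP[/andP[rg /and3P[v1 v2 v3]] m].
  by split.
have {H1} := le_trans H1 H2.
have le_s : (size s <= #|[pred i | (nsq (y i) <= r ^+ 2)%R]|)%N.
  rewrite cardE -(size_map y); apply: uniq_leq_size => // p ps.
  have [i yi] := ysurj _ (ss' _ ps); apply/seq.mapP; exists i => //.
  by rewrite mem_enum inE yi sr.
rewrite -[X in X <= _ -> _]mulr_natr natrM => H.
have : K * (size s)%:R <= K * #|[pred i | nsq (y i) <= r ^+ 2]|%:R by rewrite ler_wpM2l// ler_nat.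
lra.
Qed.

End sparse.

(** * Separable packings are sparse *)

Section separable.
Variable R : realType.
Implicit Types (X : set (R * R)) (c p q z a : R * R).

Definition dot a z : R := a.1 * z.1 + a.2 * z.2.

Lemma continuous_nsq_sub c : continuous (fun z : R * R => nsq (z - c)).
Proof.
have -> : (fun z => nsq (z - c)) =
    (fun z => (z.1 - c.1) * (z.1 - c.1) + (z.2 - c.2) * (z.2 - c.2)).
  by apply/funext => z; rewrite /nsq !expr2.
move=> z.
have c1 : (fun w : R * R => w.1 - c.1) @ z --> z.1 - c.1.
  by apply: cvgB; [exact: cvg_fst|exact: cvg_cst].
have c2 : (fun w : R * R => w.2 - c.2) @ z --> z.2 - c.2.
  by apply: cvgB; [exact: cvg_snd|exact: cvg_cst].
by apply: cvgD; apply: cvgM.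
Qed.

Lemma edist_nsq p q : edist p q = Num.sqrt (nsq (p - q)).
Proof. by []. Qed.

Lemma disk_nsq c (r : R) z : 0 <= r -> disk c r z <-> nsq (z - c) <= r ^+ 2.
Proof. by move=> r0; rewrite diskE. Qed.

Lemma interior_disk c (r : R) z : 0 <= r -> nsq (z - c) < r ^+ 2 -> (disk c r)° z.
Proof.
move=> r0 zr; rewrite /interior /=.
have := @cvgr_lt _ _ _ _ _ _ (@continuous_nsq_sub c z) _ zr.
move=> /(_ (nbhs_filter z)) h; apply: filterS h => w hw; apply/disk_nsq => //; exact: ltW.
Qed.

Lemma packing_dist (X : set (R * R)) p q : packing 1 X -> X p -> X q -> p != q -> 4 <= nsq (p - q).
Proof.
move=> pk Xp Xq pq; rewrite leNgt; apply/negP => lt4.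
pose m : R * R := ((p.1 + q.1) / 2, (p.2 + q.2) / 2).
suff e : p = q by rewrite e eqxx in pq.
apply: pk => //.
exists m; split; apply: interior_disk; rewrite // expr1n; move: lt4; rewrite /nsq /m /=.
  by have -> : ((p.1 + q.1) / 2 - p.1) ^+ 2 + ((p.2 + q.2) / 2 - p.2) ^+ 2 =
    ((p.1 - q.1) ^+ 2 + (p.2 - q.2) ^+ 2) / 4; [field|lra].
by have -> : ((p.1 + q.1) / 2 - q.1) ^+ 2 + ((p.2 + q.2) / 2 - q.2) ^+ 2 =
    ((p.1 - q.1) ^+ 2 + (p.2 - q.2) ^+ 2) / 4; [field|lra].
Qed.

Lemma nsq_eq0 a : (nsq a == 0) = (a == 0).
Proof.
case: a => x y; rewrite /nsq /= paddr_eq0 ?sqr_ge0// !sqrf_eq0.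
by apply/andP/eqP => [[/eqP-> /eqP->]|[-> ->]].
Qed.

Lemma nsq_gt0 a : a != 0 -> 0 < nsq a.
Proof. by move=> a0; rewrite lt_neqAle eq_sym nsq_eq0 a0 nsq_ge0. Qed.

(** If the line came closer than [lam] to a center, the foot [f] of the perpendicular from that
    center would lie on the line and inside the disk. *)
Lemma separating_line (lam : R) X c d : 0 <= lam -> totally_separable lam X ->
  X c -> X d -> c != d -> exists a b, [/\ a != 0, dot a c <= b, b <= dot a d &
   forall e, X e -> lam ^+ 2 * nsq a <= (dot a e - b) ^+ 2].
Proof.
move=> l0 ts Xc Xd cd; have [a [b [a0 [hc hd] he]]] := ts c d Xc Xd (elimN eqP cd).
have self e : disk e lam e by rewrite disk_nsq// subrr /nsq /= expr0n addr0 sqr_ge0.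
exists a, b; split=> //; first exact: hc (self c); first exact: hd (self d).
move=> e Xe; rewrite leNgt; apply/negP => lt.
have na := nsq_gt0 a0.
pose t := (dot a e - b) / nsq a.
pose f : R * R := (e.1 - t * a.1, e.2 - t * a.2).
have tE : t * nsq a = dot a e - b by rewrite /t divfK// gt_eqF.
have : (line a b `&` (disk e lam)°) f.
  split.
    rewrite /line /f /=; move: tE; rewrite /nsq /dot; lra.
  apply: interior_disk => //.
  have : nsq (f - e) * nsq a < lam ^+ 2 * nsq a.
    apply: le_lt_trans lt; rewrite -tE /f /nsq /=; lra.
  by rewrite ltr_pM2r.
by rewrite he.
Qed.

(* The normal [a] of a line with [x] on one side and [y], [z] on the other. If the
   foot of the altitude from [x] lies on the side [y z], then the altitude is at least [2 * lam]. *)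
Lemma isolated_height (lam : R) (x y z a : R * R) : 0 <= lam -> a != 0 -> y != z ->
  nsq (x - z) <= nsq (x - y) + nsq (y - z) ->
  nsq (x - y) <= nsq (x - z) + nsq (y - z) ->
  0 <= dot a (y - x) -> 0 <= dot a (z - x) ->
  4 * lam ^+ 2 * nsq a <= dot a (y - x) ^+ 2 ->
  4 * lam ^+ 2 * nsq a <= dot a (z - x) ^+ 2 ->
  4 * lam ^+ 2 * nsq (y - z) <= det3 x y z ^+ 2.
Proof.
move=> l0 a0 yz ny nz A0 B0 hA hB.
have na := nsq_gt0 a0; have N0 : 0 < nsq (y - z) by rewrite nsq_gt0// subr_eq0.
pose m := 2 * lam * Num.sqrt (nsq a).
have m2 : m ^+ 2 = 4 * lam ^+ 2 * nsq a.
  by rewrite /m !exprMn sqr_sqrtr ?nsq_ge0//; ring.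
have m0 : 0 <= m by rewrite /m mulr_ge0 ?sqrtr_ge0 ?mulr_ge0.
rewrite -m2 in hA hB; have {}hA := ler_of_sqr A0 hA; have {}hB := ler_of_sqr B0 hB.
pose u := dot (x - y) (z - y); pose v := dot (x - z) (y - z).
have u0 : 0 <= u by move: ny; rewrite /u /dot /nsq /=; lra.
have v0 : 0 <= v by move: nz; rewrite /v /dot /nsq /=; lra.
have uv : u + v = nsq (y - z) by rewrite /u /v /dot /nsq /=; ring.
(* [g] is [nsq (y - z)] times the vector from [x] to the foot of the altitude. Its weights [u] and
   [v] are nonnegative because the angles at [y] and [z] are not obtuse. *)
pose g : R * R := (v * (y - x).1 + u * (z - x).1, v * (y - x).2 + u * (z - x).2).
have ng : nsq g = nsq (y - z) * det3 x y z ^+ 2.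
  by rewrite /nsq /g /u /v /dot /det3 /=; ring.
have ag : nsq (y - z) * m <= dot a g.
  have -> : dot a g = v * dot a (y - x) + u * dot a (z - x).
    by rewrite /dot /g /=; ring.
  have := ler_wpM2l v0 hA; have := ler_wpM2l u0 hB; rewrite -uv; lra.
have : (nsq (y - z) * m) ^+ 2 <= nsq a * nsq g.
  apply: le_trans (dot_sqr_le a g).
  have mm : 0 <= nsq (y - z) * m by apply: mulr_ge0 => //; exact: ltW.
  by rewrite ler_sqr ?nnegrE// (le_trans mm).
rewrite exprMn m2 ng => hh.
have {}hh : (nsq (y - z) * nsq a) * (4 * lam ^+ 2 * nsq (y - z)) <=
     (nsq (y - z) * nsq a) * det3 x y z ^+ 2 by lra.
by move: hh; rewrite ler_pM2l// mulr_gt0.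
Qed.

(** The line separates [p] from [q], and [t] joins one of them, so the other is isolated. [det3] is
    the altitude from the isolated vertex, at least [2 * lam], times the opposite side, at least
    2. *)
Lemma separable_sparse (lam : R) X : 0 <= lam -> separable_packing lam 1 X -> sparse (4 * lam) X.
Proof.
move=> l0 [pk ts]; split; first by move=> p q Xp Xq; exact: packing_dist pk Xp Xq.
move=> p q t Xp Xq Xt D [n1 n2 n3]; have [pq qt tp] := det3_neq D.
have [a [b [a0 hp hq he]]] := separating_line l0 ts Xp Xq pq.
have ep := he _ Xp; have eq := he _ Xq; have et := he _ Xt.
have side (x y : R) : 0 <= x -> 0 <= y -> lam ^+ 2 * nsq a <= x ^+ 2 -> lam ^+ 2 * nsq a <= y ^+ 2 ->
    4 * lam ^+ 2 * nsq a <= (x + y) ^+ 2.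
  move=> x0 y0; have [xy|xy] := leP x y => hx hy; nra.
have fin N : 4 <= N -> 4 * lam ^+ 2 * N <= det3 p q t ^+ 2 -> 4 * lam <= det3 p q t.
  move=> N4 hh; apply: ler_of_sqr; first exact: ltW.
  apply: le_trans hh; have := sqr_ge0 lam; nra.
have dB e f : dot a (e - f) = (dot a e - b) + (b - dot a f) by rewrite /dot /=; ring.
have dB' e f : dot (- a) (e - f) = (b - dot a e) + (dot a f - b) by rewrite /dot /=; ring.
have nN : nsq (- a) = nsq a by rewrite /nsq /= !sqrrN.
have sqB e : (b - dot a e) ^+ 2 = (dot a e - b) ^+ 2 by ring.
have [tb|tb] := leP b (dot a t).
  apply: (fin (nsq (q - t))); first by apply: (packing_dist pk).
  apply: (@isolated_height lam p q t a) => //; rewrite ?dB.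
  - by rewrite [nsq (p - t)]nsqC; lra.
  - by rewrite [nsq (p - t)]nsqC; lra.
  - by rewrite addr_ge0// subr_ge0.
  - by rewrite addr_ge0// subr_ge0.
  - by apply: side; rewrite ?subr_ge0 ?sqB.
  - by apply: side; rewrite ?subr_ge0 ?sqB.
have {}tb := ltW tb.
apply: (fin (nsq (t - p))); first by apply: (packing_dist pk).
rewrite det3_rot.
apply: (@isolated_height lam q t p (- a)) => //; rewrite ?oppr_eq0 ?dB' ?nN //.
- by rewrite ?[nsq (q - p)]nsqC; lra.
- by rewrite ?[nsq (q - p)]nsqC; lra.
- by rewrite addr_ge0// subr_ge0.
- by rewrite addr_ge0// subr_ge0.
- by apply: side; rewrite ?subr_ge0 ?sqB.
- by apply: side; rewrite ?subr_ge0 ?sqB.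
Qed.

Lemma packing_sparse X : packing 1 X -> sparse (Num.sqrt 12) X.
Proof.
move=> pk; split; first by move=> p q Xp Xq; exact: packing_dist pk Xp Xq.
move=> p q t Xp Xq Xt D n; have [pq qt tp] := det3_neq D.
have := heron_ge48 (packing_dist pk Xp Xq pq) (packing_dist pk Xq Xt qt) (packing_dist pk Xt Xp tp) n.
rewrite -det3_nsq_heron => hh; apply: ler_of_sqr; first exact: ltW.
by rewrite sqr_sqrtr//; lra.
Qed.

End separable.

(** * Densities *)

Section limsup.
Variable R : realType.

Lemma limf_esup_le (f : R -> R) (l : R) :
  (forall e, 0 < e -> \forall r \near +oo, f r <= l + e) ->
  (limf_esup (fun r => (f r)%:E) +oo%R <= l%:E)%E.
Proof.
move=> H; apply/lee_addgt0Pr => e e0; rewrite limf_esupE.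
apply: (@le_trans _ _ (ereal_sup ((fun r => (f r)%:E) @` [set r | f r <= l + e]))).
  by apply: ereal_inf_lbound; exists [set r | f r <= l + e] => //; exact: H.
by apply: ge_ereal_sup => _ [r /= hr <-]; rewrite -EFinD lee_fin.
Qed.

Lemma limf_esup_ge (f : R -> R) (l : R) :
  (forall e, 0 < e -> \forall r \near +oo, l - e <= f r) ->
  (l%:E <= limf_esup (fun r => (f r)%:E) +oo%R)%E.
Proof.
move=> H; rewrite limf_esupE; apply: le_ereal_inf_tmp => _ [V FV <-].
apply/lee_subgt0Pr => e e0.
have [r [Vr hr]] : exists r, V r /\ l - e <= f r.
  have [r ?] := @filter_ex _ _ _ _ (filterI FV (H e e0)); by exists r.
by apply: le_ereal_sup_tmp; exists (f r)%:E; [exists r|rewrite -EFinB lee_fin].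
Qed.

End limsup.

Section finite_points.
Variables (R : realType).
Local Notation pt := (measurableTypeR R * measurableTypeR R)%type.
Implicit Types (X : set (R * R)) (K r : R).

Lemma finite_of_bound (T : eqType) (A : set T) (n : nat) :
  (forall s : seq T, uniq s -> [set` s] `<=` A -> (size s <= n)%N) ->
  exists s : seq T, uniq s /\ A = [set` s].
Proof.
move=> H.
have grow k : exists s : seq T, uniq s /\ (A = [set` s] \/ [set` s] `<=` A /\ size s = k).
  elim: k => [|k [s [us [As|[sA sk]]]]]; first by exists [::]; split=> //; right.
    by exists s; split=> //; left.
  have [e|ne] := pselect (A `<=` [set` s]).
    by exists s; split=> //; left; apply/seteqP.
  have /existsNP[x /not_implyP[Ax xs]] := ne.
  exists (x :: s); split; first by rewrite /= us andbT; apply/negP.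
  right; rewrite /= sk; split=> // z /=; rewrite in_cons => /orP[/eqP->//|]; exact: sA.
have [s [us [As|[sA sk]]]] := grow n.+1; first by exists s.
by have := H _ us sA; rewrite sk ltnn.
Qed.

Lemma sparse_disk X K r : 0 < K <= 4 -> 0 <= r -> sparse K X ->
  exists s : seq (R * R), [/\ uniq s, X `&` [set p | nsq p <= r ^+ 2] = [set` s] &
    K * (size s)%:R <= pi * (r + 10) ^+ 2].
Proof.
move=> /andP[K0 K4] r0 [sep ac].
have B s : uniq s -> [set` s] `<=` X `&` [set p | nsq p <= r ^+ 2] ->
    K * (size s)%:R <= pi * (r + 10) ^+ 2.
  move=> us sX; apply: sparse_card => //; first by rewrite ltW.
    split; first by move=> p q /sX[? _] /sX[? _]; exact: sep.
    by move=> p q t /sX[? _] /sX[? _] /sX[? _]; exact: ac.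
  by move=> p ps; have [] := sX _ ps.
have [|s [us Xs]] := @finite_of_bound _ (X `&` [set p | nsq p <= r ^+ 2])
  (Num.truncn (pi * (r + 10) ^+ 2 / K)).
  move=> s us sX; rewrite truncn_ge_nat; last first.
    by rewrite divr_ge0 ?ltW// mulr_gt0 ?pi_gt0// exprn_gt0//; lra.
  by rewrite ler_pdivlMr// mulrC; exact: B.
by exists s; split=> //; apply: B => //; rewrite Xs.
Qed.

Definition covered X r := (\bigcup_(c in X) disk c 1) `&` disk 0 r.

(** Only centers within [r + 1] matter for the disk of radius [r]; the bound of [sparse_disk] at
    [r + 1] gives the 11. *)
Lemma covered_list X K r : 0 < K <= 4 -> 0 <= r -> sparse K X ->
  exists s : seq (R * R), [/\ uniq s,
    forall p, p \in s -> X p,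
    forall p, X p -> nsq p <= (r + 1) ^+ 2 -> p \in s,
    covered X r = \big[setU/set0]_(p <- s) (disk p 1 `&` disk 0 r) &
    K * (size s)%:R <= pi * (r + 11) ^+ 2].
Proof.
move=> K04 r0 sp; have [|s [us Xs Ks]] := sparse_disk K04 _ sp (r := r + 1); first by lra.
exists s; split=> //.
- by move=> p ps; have : [set` s] p by []; rewrite -Xs => -[].
- by move=> p Xp pr; have : (X `&` [set p | nsq p <= (r + 1) ^+ 2]) p by []; rewrite Xs.
- rewrite -bigcup_seq /covered; apply/seteqP; split=> z.
    case=> -[c Xc zc] zr; exists c => //=.
    have : (X `&` [set p | nsq p <= (r + 1) ^+ 2]) c.
      split=> //=; rewrite addrC -(subrK z c); apply: nsqD_le => //.
        by rewrite nsqC; apply/disk_nsq.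
      by move: zr; rewrite disk0E.
    by rewrite Xs.
  case=> c /= cs [zc zr]; split=> //; exists c => //.
  by have : [set` s] c by []; rewrite -Xs => -[].
- by rewrite (_ : r + 11 = r + 1 + 10) //; ring.
Qed.

Lemma measurable_covered X K r : 0 < K <= 4 -> 0 <= r -> sparse K X ->
  measurable (covered X r : set pt).
Proof.
move=> K04 r0 sp; have [s [_ _ _ -> _]] := covered_list K04 r0 sp.
by apply: measurable_bigU => p _; apply: measurableI; exact: measurable_disk.
Qed.

Lemma covered_fractionE X r : 0 < r -> covered_fraction 1 X r =
  fine (area (covered X r)) / (pi * r ^+ 2).
Proof. by move=> r0; rewrite /covered_fraction [area (disk 0 r)]area_disk. Qed.

Lemma covered_le X K r : 0 < K <= 4 -> 0 < r -> sparse K X ->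
  covered_fraction 1 X r <= pi * (r + 11) ^+ 2 / K / r ^+ 2.
Proof.
move=> K04 r0 sp; have /andP[K0 _] := K04.
have [s [us sX _ cE Ks]] := covered_list K04 (ltW r0) sp.
have mc := measurable_covered K04 (ltW r0) sp.
have h : (area (covered X r) <= (\sum_(p <- s) pi)%:E)%E.
  apply: (@area_cover_le _ _ s (fun p => disk p 1 `&` disk 0 r)) => //.
  - by move=> p _; apply: measurableI; exact: measurable_disk.
  - move=> p _; have -> : (pi%:E : \bar R) = area (disk p 1) by rewrite area_disk// expr1n mulr1.
    apply: le_area; [apply: measurableI|..|by move=> z []]; exact: measurable_disk.
  - by rewrite cE.
rewrite covered_fractionE//.
have : fine (area (covered X r)) <= (size s)%:R * pi.
  rewrite -lee_fin fineK; last first.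
    by rewrite ge0_fin_numE ?measure_ge0//; apply: (le_lt_trans h); rewrite ltry.
  by move: h; rewrite big_const_seq count_predT iter_addr addr0 mulr_natl.
move=> hf; have pr : 0 < pi * r ^+ 2 :> R by rewrite mulr_gt0 ?pi_gt0// exprn_gt0.
rewrite ler_pdivrMr// (le_trans hf)//.
have -> : pi * (r + 11) ^+ 2 / K / r ^+ 2 * (pi * r ^+ 2) = pi * (r + 11) ^+ 2 / K * pi.
  by field; rewrite !gt_eqF.
by rewrite ler_pM2r ?pi_gt0// ler_pdivlMr// mulrC.
Qed.

End finite_points.

Lemma interior_segment (R : realType) (A : set (R * R)) (z w : R * R) : A° z ->
  exists t, 0 < t /\ A (z.1 + t * w.1, z.2 + t * w.2).
Proof.
move=> zi.
pose g (t : R) : R * R := (z.1 + t * w.1, z.2 + t * w.2).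
have g0 : g 0 = z by rewrite /g !mul0r !addr0; case: (z).
have cg : g @ (0 : R) --> g 0.
  have c1 : (fun t : R => z.1 + t * w.1) @ (0 : R) --> z.1 + 0 * w.1.
    by apply: cvgD; [exact: cvg_cst|apply: cvgM => //; exact: cvg_cst].
  have c2 : (fun t : R => z.2 + t * w.2) @ (0 : R) --> z.2 + 0 * w.2.
    by apply: cvgD; [exact: cvg_cst|apply: cvgM => //; exact: cvg_cst].
  exact: (cvg_pair c1 c2).
have /nbhs_ballP[e /= e0 be] : nbhs (0 : R) (g @^-1` A).
  by apply: cg; rewrite g0; exact: zi.
have /be : ball (0 : R) e (e / 2).
  by rewrite /ball /= sub0r normrN gtr0_norm; lra.
by move=> At; exists (e / 2); split => //; lra.
Qed.

Lemma interior_disk_lt (R : realType) (c z : R * R) (r : R) : 0 <= r ->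
  (disk c r)° z -> nsq (z - c) < r ^+ 2.
Proof.
move=> r0 zi; have zd : nsq (z - c) <= r ^+ 2 by apply/disk_nsq => //; exact: interior_subset zi.
rewrite lt_neqAle zd andbT; apply/eqP => ze.
have [w hw] : exists w : R * R, forall t, 0 < t -> r ^+ 2 < nsq ((z.1 + t * w.1, z.2 + t * w.2) - c).
  have [rz|rn] := eqVneq r 0.
    exists (1, 0) => t t0; move: ze; rewrite rz expr0n /= => /eqP; rewrite nsq_eq0 subr_eq0 => /eqP ->.
    by rewrite /nsq /= mulr1 mulr0 addr0 subrr expr0n /= addr0 addrAC subrr add0r exprn_gt0.
  exists (z - c) => t t0.
  have -> : nsq ((z.1 + t * (z - c).1, z.2 + t * (z - c).2) - c) = (1 + t) ^+ 2 * nsq (z - c).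
    by rewrite /nsq /=; ring.
  have r2 : 0 < r ^+ 2 by rewrite exprn_gt0// lt_neqAle eq_sym rn.
  rewrite ze; nra.
have [t [t0 /(disk_nsq _ _ r0)]] := interior_segment w zi; apply/negP; rewrite -ltNge.
exact: hw.
Qed.

Definition lat (R : realType) (u v : R * R) : set (R * R) :=
  [set p | exists m n : int, p = u *~ m + v *~ n].

(** * Rhombic lattices *)

Section lattice.
Variable R : realType.
Implicit Types (u v p q z : R * R).

Lemma mulz_pair u (m : int) : u *~ m = (u.1 * m%:~R, u.2 * m%:~R).
Proof.
have nat_case (n : nat) : u *+ n = (u.1 * n%:R, u.2 * n%:R).
  elim: n => [|n IH]; first by rewrite mulr0n !mulr0.
  by rewrite mulrS IH -!(natr1 n) !mulrDr !mulr1 addrC; case: (u).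
case: m => n; first by rewrite -!pmulrn nat_case.
by rewrite NegzE !mulrNz -!pmulrn nat_case /= !mulrN.
Qed.

Lemma latP u v p : lat u v p <-> exists m n : int,
  p = (m%:~R * u.1 + n%:~R * v.1, m%:~R * u.2 + n%:~R * v.2).
Proof.
by split=> -[m [n ->]]; exists m, n; rewrite !mulz_pair /= ![_ * _%:~R]mulrC.
Qed.

Lemma latC u v : lat u v = lat v u.
Proof. by apply/seteqP; split=> p [m [n ->]]; exists n, m; rewrite addrC. Qed.

Lemma latB u v p q : lat u v p -> lat u v q -> lat u v (p - q).
Proof.
move=> [m [n ->]] [m' [n' ->]]; exists (m - m'), (n - n').
by rewrite !mulrzBr opprD addrACA.
Qed.

Lemma lat0 u v : lat u v 0.
Proof. by exists 0, 0; rewrite !mulr0z addr0. Qed.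

Lemma latN u v p : lat u v p -> lat u v (- p).
Proof. by move=> lp; rewrite -sub0r; apply: latB => //; exact: lat0. Qed.

Lemma latD u v p q : lat u v p -> lat u v q -> lat u v (p + q).
Proof. by move=> lp lq; rewrite -[q]opprK; apply: latB => //; exact: latN. Qed.

Lemma lat1 u v : lat u v u.
Proof. by exists 1, 0; rewrite mulr1z mulr0z addr0. Qed.

Lemma lat2 u v : lat u v v.
Proof. by exists 0, 1; rewrite mulr1z mulr0z add0r. Qed.

Lemma int_gap (k : int) : k != 0 -> 1 <= `|k%:~R : R|.
Proof. by move=> k0; rewrite -intr_norm ler1z; lia. Qed.

Lemma half_int_gap (k : int) : 1 / 2 <= `|k%:~R - 1 / 2 : R|.
Proof.
have [k1|k1] := lerP 1 k.
  have : 1 <= k%:~R :> R by rewrite ler1z.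
  by move=> ?; rewrite ger0_norm; lra.
have : k%:~R <= 0 :> R by rewrite lerz0; lia.
by move=> ?; rewrite ler0_norm; lra.
Qed.

(** Since [v] has length 2, lattice lines parallel to [v] are half of [|cross u v|] apart, which is
    at least [2 * lam]. The chosen line lies midway between the lattice line of [c] and the next one
    towards [d]; the signs [s] and [e] orient it. *)
Lemma lat_separating u v (lam : R) (m n m' n' : int) : 0 <= lam -> nsq v = 4 ->
  16 * lam ^+ 2 <= cross u v ^+ 2 -> cross u v != 0 -> (m != m') ->
  let c := u *~ m + v *~ n in let d := u *~ m' + v *~ n' in
  exists (a : R * R) (b : R),
    [/\ a != 0,
        disk c lam `<=` half_le a b /\ disk d lam `<=` half_ge a b &
        forall e : R * R, lat u v e -> line a b `&` (disk e lam)° = set0].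
Proof.
move=> l0 v4 lD D0 mm' c d.
pose D := cross u v.
have [s s1 sD] : exists2 s : R, s ^+ 2 = 1 & 0 < s * D * (m' - m)%:~R.
  have : D * (m' - m)%:~R != 0.
    by rewrite mulf_neq0// intr_eq0 subr_eq0 eq_sym.
  rewrite neq_lt => /orP[h|h].
    by exists (-1); rewrite ?sqrrN ?expr1n// -mulrA mulN1r oppr_gt0.
  by exists 1; rewrite ?expr1n// -mulrA mul1r.
have [e e1 eD] : exists2 e : R, (e = 1 \/ e = -1) & 0 < s * D * e.
  have [h|h] := ltP 0 (s * D).
    by exists 1; [left|rewrite mulr1].
  exists (-1); [by right|]; rewrite mulrN1 oppr_gt0 lt_neqAle h andbT.
  by apply: contraTneq sD => ->; rewrite mul0r ltxx.
pose a : R * R := (s * v.2, - s * v.1).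
have na : nsq a = 4 by rewrite -v4 /nsq /a /=; move: s1; rewrite !expr2 => s1; rewrite -[RHS]mulr1 -s1; ring.
have a0 : a != 0 by rewrite -nsq_eq0 na; apply/eqP; lra.
have dau (x y : R) : dot a (x * u.1 + y * v.1, x * u.2 + y * v.2) = x * (s * D).
  by rewrite /dot /a /D /cross /=; ring.
have sn : `|s| = 1.
  by apply/eqP; rewrite -(@eqrXn2 _ 2)// expr1n -normrX s1 normr1.
have DE : s * D * e = `|D|.
  rewrite -[LHS]ger0_norm ?ltW// !normrM sn.
  have -> : `|e| = 1 by case: e1 => ->; rewrite ?normrN normr1.
  by rewrite mul1r mulr1.
have D1 : 0 < `|D| by rewrite normr_gt0.
have dd (p q : R * R) : dot a p - dot a q = dot a (p - q) by rewrite /dot /=; ring.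
have near (p q : R * R) : nsq (p - q) <= lam ^+ 2 -> `|dot a p - dot a q| <= `|D| / 2.
  move=> h; apply: ler_of_sqr; first lra.
  rewrite dd real_normK ?num_real// exprMn real_normK ?num_real//.
  by apply: le_trans (dot_sqr_le _ _) _; rewrite na; move: lD; rewrite -/D; lra.
have snear (p q : R * R) : nsq (p - q) < lam ^+ 2 -> `|dot a p - dot a q| < `|D| / 2.
  move=> h; rewrite -ltr_sqr ?nnegrE ?divr_ge0 ?normr_ge0//.
  rewrite dd real_normK ?num_real// exprMn real_normK ?num_real//.
  by apply: le_lt_trans (dot_sqr_le _ _) _; rewrite na; move: lD; rewrite -/D; lra.
pose b := (m%:~R + e / 2) * (s * D).
have latE (x y : int) : dot a (u *~ x + v *~ y) = x%:~R * (s * D).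
  by rewrite -(dau _ y%:~R) !mulz_pair /= ![_ * _%:~R]mulrC.
have dc : b - dot a c = `|D| / 2 by rewrite /c latE /b -DE; field.
have ddd : `|D| / 2 <= dot a d - b.
  have -> : dot a d - b = s * D * (m' - m)%:~R - `|D| / 2.
    by rewrite /d latE /b -DE rmorphB /=; field.
  have : `|D| * 1 <= `|D| * `|(m' - m)%:~R|.
    by rewrite ler_pM2l// int_gap// subr_eq0 eq_sym.
  have -> : `|D| * `|(m' - m)%:~R| = s * D * (m' - m)%:~R.
    by rewrite -[RHS]gtr0_norm// !normrM sn mul1r.
  lra.
exists a, b; split=> //.
  split=> z /(disk_nsq _ _ l0) /near; rewrite ler_norml => /andP[h1 h2].
    by rewrite /half_le /= -/(dot a z); lra.
  by rewrite /half_ge /= -/(dot a z); lra.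
move=> p [x [y ->]]; apply/seteqP; split=> z // -[zl /(interior_disk_lt l0) /snear].
move=> lt; exfalso; move: lt; apply/negP; rewrite -leNgt.
have -> : dot a z = b by exact: zl.
have -> : b - dot a (u *~ x + v *~ y) = - (e * x%:~R - e * m%:~R - 1 / 2) * (s * D * e).
  rewrite latE /b; have e2 : e * e = 1 by case: e1 => ->; rewrite ?mulrNN mulr1.
  have -> : - (e * x%:~R - e * m%:~R - 1 / 2) * (s * D * e) =
    - ((e * e) * x%:~R - (e * e) * m%:~R - e / 2) * (s * D) by field.
  by rewrite e2; field.
rewrite DE normrM normrN normr_id [X in _ <= X]mulrC ler_pM2l// .
have [k ->] : exists k : int, e * x%:~R - e * m%:~R = k%:~R.
  by case: e1 => ->; [exists (x - m)|exists (m - x)]; rewrite rmorphB /=; ring.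
by have := half_int_gap k; lra.
Qed.

Section rhombic.
Variables (u v : R * R) (h : R).
Hypotheses (u4 : nsq u = 4) (v4 : nsq v = 4) (uv : dot u v = 4 * h) (h01 : 0 <= h <= 1 / 2).

Lemma cross_rhombic : cross u v ^+ 2 = 16 * (1 - h ^+ 2).
Proof.
have -> : cross u v ^+ 2 = nsq u * nsq v - dot u v ^+ 2 by rewrite /cross /nsq /dot; ring.
by rewrite u4 v4 uv; ring.
Qed.

Lemma cross_rhombic_neq0 : cross u v != 0.
Proof.
rewrite -sqrf_eq0 cross_rhombic; have /andP[h0 h1] := h01.
have h4 : h ^+ 2 <= 1 / 4 by nra.
by apply/eqP => e; lra.
Qed.

Lemma nsq_rhombic (m n : int) : nsq (u *~ m + v *~ n) =
  4 * (m%:~R ^+ 2 + n%:~R ^+ 2 + 2 * h * m%:~R * n%:~R).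
Proof.
have -> : nsq (u *~ m + v *~ n) =
  m%:~R ^+ 2 * nsq u + n%:~R ^+ 2 * nsq v + 2 * m%:~R * n%:~R * dot u v.
  by rewrite /nsq /dot !mulz_pair /=; ring.
by rewrite u4 v4 uv; ring.
Qed.

(** The quadratic form is affine in [h], hence a convex combination of its cases [h = 0] and
    [h = 1 / 2], which are positive definite with integral values. *)
Lemma rhombic_dist p q : lat u v p -> lat u v q -> p != q -> 4 <= nsq (p - q).
Proof.
move=> lp lq pq; have [m [n e]] := latB lp lq; rewrite e nsq_rhombic.
have /andP[h0 h1] := h01.
have mn : m != 0 \/ n != 0.
  have [m0|] := eqVneq m 0; [right|by left].
  by apply: contraNneq pq => n0; rewrite -subr_eq0 e m0 n0 !mulr0z addr0.
have q1 : 1 <= (m ^+ 2 + n ^+ 2 + m * n)%R /\ (1 <= m ^+ 2 + n ^+ 2)%R by nia.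
have : 1 <= ((m ^+ 2 + n ^+ 2 + m * n)%R)%:~R :> R by rewrite ler1z; lia.
have : 1 <= ((m ^+ 2 + n ^+ 2)%R)%:~R :> R by rewrite ler1z; lia.
rewrite !rmorphD !rmorphM /=; move: (m%:~R : R) (n%:~R : R) => x y hx hy.
have : 0 <= (1 - 2 * h) * (x ^+ 2 + y ^+ 2 - 1) by apply: mulr_ge0; lra.
have : 0 <= 2 * h * (x ^+ 2 + y ^+ 2 + x * y - 1) by apply: mulr_ge0; lra.
lra.
Qed.

Lemma rhombic_packing : packing 1 (lat u v).
Proof.
move=> p q lp lq [z [/(interior_disk_lt ler01) zp /(interior_disk_lt ler01) zq]].
apply/eqP/negPn/negP => pq; have := rhombic_dist lp lq pq; apply/negP; rewrite -ltNge.
move: zp zq; rewrite expr1n /nsq /= => zp zq.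
have := sqr_ge0 (p.1 + q.1 - 2 * z.1); have := sqr_ge0 (p.2 + q.2 - 2 * z.2); lra.
Qed.

Lemma rhombic_separable (lam : R) : 0 <= lam -> lam ^+ 2 <= 1 - h ^+ 2 ->
  separable_packing lam 1 (lat u v).
Proof.
move=> l0 lh; split; first exact: rhombic_packing.
have D := cross_rhombic; have Dn := cross_rhombic_neq0.
have vu : cross v u = - cross u v by rewrite /cross; ring.
move=> c d [m [n ->]] [m' [n' ->]] cd.
have [mm|mm] := eqVneq m m'; last first.
  by apply: (lat_separating _ _ l0 v4 _ Dn mm); rewrite D; lra.
have nn : n != n' by apply: contra_not_neq cd => ->; rewrite mm.
have lDv : 16 * lam ^+ 2 <= cross v u ^+ 2 by rewrite vu sqrrN D; lra.
have Dv : cross v u != 0 by rewrite vu oppr_eq0.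
have := lat_separating m m' l0 u4 lDv Dv nn; rewrite latC.
by rewrite [v *~ n + _]addrC [v *~ n' + _]addrC.
Qed.

End rhombic.

End lattice.

(** * Lower bound for the density of a lattice *)

Section lattice_density.
Variable R : realType.
Local Notation pt := (measurableTypeR R * measurableTypeR R)%type.
Implicit Types (u v p z : R * R) (K r : R).

Lemma lat_parallelogram u v z : cross u v != 0 -> nsq u <= 4 -> nsq v <= 4 ->
  exists p, [/\ lat u v p, parallelogram p u v z & nsq (p - z) <= 4 ^+ 2].
Proof.
move=> D0 u4 v4.
pose a := cross z v / cross u v; pose b := cross u z / cross u v.
pose s := a - (Num.floor a)%:~R; pose t := b - (Num.floor b)%:~R.
have fl (x : R) : 0 <= x - (Num.floor x)%:~R < 1.
  by have /andP[f1 f2] := floor_itv x; rewrite rmorphD /= in f2; apply/andP; split; lra.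
have s01 : 0 <= s < 1 by exact: fl.
have t01 : 0 <= t < 1 by exact: fl.
exists (u *~ Num.floor a + v *~ Num.floor b).
have zE : z = u *~ Num.floor a + v *~ Num.floor b + (s *: u + t *: v).
  rewrite !mulz_pair /s /t; move: (_%:~R : R) (_%:~R : R) => x y.
  rewrite [LHS]surjective_pairing; congr pair; rewrite /= /GRing.scale /= /a /b;
  by move: D0; rewrite /cross => D0; field.
split; first by exists (Num.floor a), (Num.floor b).
  by exists s => //=; exists t.
rewrite nsqC.
have -> : z - (u *~ Num.floor a + v *~ Num.floor b) = s *: u + t *: v.
  by apply/eqP; rewrite subr_eq addrC; apply/eqP.
have -> : 4 = 2 + 2 :> R by ring.
have scal (x : R) q : 0 <= x < 1 -> nsq q <= 4 -> nsq (x *: q) <= 2 ^+ 2.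
  move=> /andP[x0 x1] q4; have -> : nsq (x *: q) = x ^+ 2 * nsq q.
    by rewrite /nsq /= /GRing.scale /=; ring.
  have := nsq_ge0 q; nra.
by apply: nsqD_le => //; exact: scal.
Qed.

(** The parallelograms at lattice points within [r - 1] cover the disk of radius [r - 5], which
    bounds the number of these points from below; their unit disks lie in the disk of radius [r]. *)
Lemma lat_covered_ge u v K r : cross u v != 0 -> nsq u <= 4 -> nsq v <= 4 ->
  0 < K <= 4 -> sparse K (lat u v) -> 5 < r ->
  pi * (r - 5) ^+ 2 / `|cross u v| / r ^+ 2 <= covered_fraction 1 (lat u v) r.
Proof.
move=> D0 u4 v4 K04 sp r5.
have r0 : 0 < r by lra. have r1 : 0 <= r - 1 by lra. have r50 : 0 < r - 5 by lra.
have [s [us Xs _]] := sparse_disk K04 r1 sp.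
have sX p : p \in s -> lat u v p /\ nsq p <= (r - 1) ^+ 2.
  by move=> ps; have : [set` s] p by []; rewrite -Xs.
have mc := measurable_covered K04 (ltW r0) sp.
have D1 : 0 < `|cross u v| by rewrite normr_gt0.
have pig := @pi_gt0 R.
have h1 : pi * (r - 5) ^+ 2 <= (size s)%:R * `|cross u v|.
  have : (area (disk 0%R (r - 5)%R) <= (\sum_(p <- s) `|cross u v|)%:E)%E.
    apply: (@area_cover_le _ _ s (fun p => parallelogram p u v)).
    - by move=> p _; have [] := area_parallelogram p D0.
    - by move=> p _; have [_ ->] := area_parallelogram p D0.
    - exact: measurable_disk.
    - move=> z; rewrite disk0E ?ltW//= => zr; rewrite -bigcup_seq.
      have [p [lp pz pzn]] := lat_parallelogram z D0 u4 v4.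
      exists p => //=.
      have : (lat u v `&` [set p | nsq p <= (r - 1) ^+ 2]) p.
        split=> //=; rewrite (_ : r - 1 = 4 + (r - 5)); last by ring.
        by apply: nsq_lt_of_sub pzn zr => //; exact: ltW.
      by rewrite Xs.
  by rewrite area_disk// lee_fin big_const_seq count_predT iter_addr addr0 mulr_natl.
have h2 : (size s)%:R * pi <= fine (area (covered (lat u v) r)).
  have fin : area (covered (lat u v) r) \is a fin_num.
    rewrite ge0_fin_numE ?measure_ge0//.
    apply: (@le_lt_trans _ _ (area (disk 0%R r))).
      by apply: le_area => //; [exact: measurable_disk|move=> z []].
    by rewrite area_disk// ltry.
  (* Closed unit disks may touch, so areas are first added for radii below 1. *)
  have key rho : 0 < rho -> rho < 1 -> (size s)%:R * (pi * rho ^+ 2) <= fine (area (covered (lat u v) r)).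
    move=> rho0 rho1; rewrite -lee_fin fineK//.
    have : ((\sum_(p <- s) (pi * rho ^+ 2))%:E <= area (covered (lat u v) r))%E.
      apply: (@sum_area_disjoint _ _ s (fun p => disk p rho)) => //.
      - by move=> p _; exact: measurable_disk.
      - move=> p q ps qs pq; apply/seteqP; split=> z // -[].
        move=> /(disk_nsq _ _ (ltW rho0)) zp /(disk_nsq _ _ (ltW rho0)) zq.
        have [lp _] := sX _ ps; have [lq _] := sX _ qs.
        have := sp.1 _ _ lp lq pq; apply/negP; rewrite -ltNge.
        have : nsq (p - q) <= (rho + rho) ^+ 2.
          rewrite -(subrKA z); apply: nsqD_le; rewrite ?(ltW rho0)//.
          by rewrite nsqC.
        by move/le_lt_trans; apply; nra.
      - by move=> p _; rewrite area_disk.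
      - move=> p ps z /(disk_nsq _ _ (ltW rho0)) zp; have [lp pr] := sX _ ps.
        have zp1 : nsq (z - p) <= 1 ^+ 2 by apply: (le_trans zp); nra.
        split; first by exists p => //; apply/disk_nsq.
        rewrite disk0E ?ltW//= (_ : r = 1 + (r - 1)); last by ring.
        by apply: nsq_lt_of_sub zp1 pr.
    by rewrite big_const_seq count_predT iter_addr addr0 mulr_natl.
  rewrite leNgt; apply/negP => lt.
  have N0 : 0 < (size s)%:R * @pi R.
    have f0 : 0 <= fine (area (covered (lat u v) r)) by rewrite fine_ge0 ?measure_ge0.
    exact: le_lt_trans f0 lt.
  pose q := fine (area (covered (lat u v) r)) / ((size s)%:R * pi).
  have q1 : q < 1 by rewrite /q ltr_pdivrMr// mul1r.
  have q0 : 0 <= q by rewrite /q divr_ge0 ?fine_ge0 ?measure_ge0 ?ltW.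
  (* For [0 <= q < 1] the radius [(q + 2) / 3] is below 1 and its square exceeds [q]. *)
  have /(key _) : 0 < (q + 2) / 3 by lra.
  have r1' : (q + 2) / 3 < 1 by lra.
  move=> /(_ r1'); have -> : fine (area (covered (lat u v) r)) = q * ((size s)%:R * pi).
    by rewrite /q divfK// gt_eqF.
  rewrite mulrA mulrC ler_pM2r// => bad; nra.
rewrite covered_fractionE//.
rewrite ler_pdivlMr ?mulr_gt0 ?exprn_gt0//; apply: le_trans h2.
have -> : pi * (r - 5) ^+ 2 / `|cross u v| / r ^+ 2 * (pi * r ^+ 2) =
    pi * (r - 5) ^+ 2 / `|cross u v| * pi by field; rewrite !gt_eqF.
by rewrite ler_pM2r// ler_pdivrMr.
Qed.

End lattice_density.

Section densities.
Variable R : realType.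
Implicit Types (u v : R * R) (K r : R) (X : set (R * R)).

Lemma near_upper X K e : 0 < K <= 4 -> sparse K X -> 0 < e ->
  \forall r \near +oo, covered_fraction 1 X r <= pi / K + e.
Proof.
move=> K04 sp e0; have /andP[K0 _] := K04.
have q0 : 0 < pi / K :> R by rewrite divr_gt0 ?pi_gt0.
near=> r.
have r11 : 11 <= r by near: r; exact: nbhs_pinfty_ge.
have r0 : 0 < r by lra.
(* For [11 <= r], the square of [r + 11] is at most [r ^+ 2 + 33 * r]. *)
have rM : 33 * (pi / K) / e <= r by near: r; apply: nbhs_pinfty_ge; exact: num_real.
apply: (le_trans (covered_le K04 r0 sp)).
have rM' : 33 * (pi / K) <= r * e by rewrite -ler_pdivrMr.
have -> : pi * (r + 11) ^+ 2 / K / r ^+ 2 = pi / K * (r + 11) ^+ 2 / r ^+ 2.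
  by field; rewrite !gt_eqF.
rewrite ler_pdivrMr ?exprn_gt0//.
move: (pi / K) q0 rM' => q q0 rM'.
have : 0 <= q * (r * (r - 11)) by apply: mulr_ge0; [lra|apply: mulr_ge0; lra].
have : 0 <= r * (r * e - 33 * q) by apply: mulr_ge0; lra.
have : 0 <= q * (r - 11) by apply: mulr_ge0; lra.
nra.
Unshelve. all: by end_near. Qed.

Lemma near_lower u v K e : cross u v != 0 -> nsq u <= 4 -> nsq v <= 4 ->
  0 < K <= 4 -> sparse K (lat u v) -> 0 < e ->
  \forall r \near +oo, pi / `|cross u v| - e <= covered_fraction 1 (lat u v) r.
Proof.
move=> D0 u4 v4 K04 sp e0.
have D1 : 0 < `|cross u v| by rewrite normr_gt0.
have q0 : 0 < pi / `|cross u v| :> R by rewrite divr_gt0 ?pi_gt0.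
near=> r.
have r11 : 11 <= r by near: r; exact: nbhs_pinfty_ge.
have r0 : 0 < r by lra. have r5 : 5 < r by lra.
have rM : 10 * (pi / `|cross u v|) / e <= r by near: r; apply: nbhs_pinfty_ge; exact: num_real.
apply: le_trans (lat_covered_ge D0 u4 v4 K04 sp r5).
have rM' : 10 * (pi / `|cross u v|) <= r * e by rewrite -ler_pdivrMr.
have -> : pi * (r - 5) ^+ 2 / `|cross u v| / r ^+ 2 = pi / `|cross u v| * (r - 5) ^+ 2 / r ^+ 2.
  by field; rewrite !gt_eqF.
rewrite ler_pdivlMr ?exprn_gt0//.
move: (pi / _) q0 rM' => q q0 rM'.
have : 0 <= r * (r * e - 10 * q) by apply: mulr_ge0; lra.
nra.
Unshelve. all: by end_near. Qed.

Lemma upper_density_le X K : 0 < K <= 4 -> sparse K X ->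
  (upper_density 1 X <= (pi / K)%:E)%E.
Proof. by move=> K04 sp; apply: limf_esup_le => e e0; exact: near_upper K04 sp e0. Qed.

Lemma upper_density_ge u v K : cross u v != 0 -> nsq u <= 4 -> nsq v <= 4 ->
  0 < K <= 4 -> sparse K (lat u v) ->
  ((pi / `|cross u v|)%:E <= upper_density 1 (lat u v))%E.
Proof.
by move=> D0 u4 v4 K04 sp; apply: limf_esup_ge => e e0; exact: near_lower D0 u4 v4 K04 sp e0.
Qed.

Lemma has_density_lat u v : cross u v != 0 -> nsq u <= 4 -> nsq v <= 4 ->
  `|cross u v| <= 4 -> sparse `|cross u v| (lat u v) ->
  has_density 1 (lat u v) (pi / `|cross u v|)%:E.
Proof.
move=> D0 u4 v4 D4 sp; have K04 : 0 < `|cross u v| <= 4 by rewrite normr_gt0 D0.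
apply: cvg_EFin; first by near=> r.
apply/cvgrPdist_le => e e0; near=> r.
rewrite ler_distlC; apply/andP; split.
  by near: r; exact: (near_lower D0 u4 v4 K04 sp e0).
by near: r; exact: near_upper K04 sp e0.
Unshelve. all: by end_near. Qed.

Section rhombic.
Variables (u v : R * R) (h lam : R).
Hypotheses (u4 : nsq u = 4) (v4 : nsq v = 4) (uv : dot u v = 4 * h) (h01 : 0 <= h <= 1 / 2).
Hypotheses (lam0 : 0 <= lam) (lamh : lam ^+ 2 = 1 - h ^+ 2).

Lemma cross_rhombic_norm : `|cross u v| = 4 * lam.
Proof.
apply/eqP; rewrite -(@eqrXn2 _ 2)//; last by rewrite mulr_ge0.
by rewrite real_normK ?num_real// (cross_rhombic u4 v4 uv) exprMn lamh; apply/eqP; ring.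
Qed.

Lemma rhombic_sparse : sparse (4 * lam) (lat u v).
Proof.
apply: separable_sparse => //.
by apply: (rhombic_separable u4 v4 uv h01 lam0); rewrite lamh.
Qed.

Lemma lam_bounds : 0 < 4 * lam <= 4.
Proof.
have Dn := cross_rhombic_neq0 u4 v4 uv h01.
rewrite -cross_rhombic_norm normr_gt0 Dn /= cross_rhombic_norm.
by have := lamh; have := lam0; have := sqr_ge0 h; nra.
Qed.

Lemma rhombic_has_density : has_density 1 (lat u v) (pi / (4 * lam))%:E.
Proof.
have Dn := cross_rhombic_neq0 u4 v4 uv h01; have /andP[_ l4] := lam_bounds.
rewrite -cross_rhombic_norm; apply: has_density_lat; rewrite ?u4 ?v4 ?cross_rhombic_norm//.
exact: rhombic_sparse.
Qed.

Lemma rhombic_upper_density_ge : ((pi / (4 * lam))%:E <= upper_density 1 (lat u v))%E.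
Proof.
have Dn := cross_rhombic_neq0 u4 v4 uv h01.
rewrite -cross_rhombic_norm; apply: (upper_density_ge Dn _ _ lam_bounds rhombic_sparse);
  by rewrite ?u4 ?v4.
Qed.

End rhombic.
End densities.

(** * Delaunay decompositions of rhombic lattices *)

Section hull.
Variable R : realType.
Implicit Types (A C V : set (R * R)) (p q z : R * R) (t : R).

Definition comb t p q : R * R := (t * p.1 + (1 - t) * q.1, t * p.2 + (1 - t) * q.2).

Lemma hull_sub A C : (forall p q t, C p -> C q -> 0 < t < 1 -> C (comb t p q)) ->
  A `<=` C -> hull A `<=` C.
Proof.
move=> cC AC z; apply; split => //; apply/convex_setW => p q; rewrite !inE => Cp Cq k k0 k1.
by rewrite inE; have := cC p q k%:num Cp Cq; rewrite k0 k1 => /(_ isT).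
Qed.

Lemma hull_comb A p q t : hull A p -> hull A q -> 0 < t < 1 -> hull A (comb t p q).
Proof.
move=> hp hq /andP[t0 t1] C CA; have [cC AC] := CA.
have := cC p q (Itv01 (ltW t0) (ltW t1)); rewrite !inE; apply; [exact: hp|exact: hq].
Qed.

Lemma sub_hull A : A `<=` hull A.
Proof. exact: sub_gen_smallest. Qed.

Lemma hull_mono A B : A `<=` B -> hull A `<=` hull B.
Proof.
move=> AB; apply: hull_sub; first by move=> p q t; exact: hull_comb.
by apply: (subset_trans AB); exact: sub_hull.
Qed.

Lemma dot_comb (a p q : R * R) t : dot a (comb t p q) = t * dot a p + (1 - t) * dot a q.
Proof. by rewrite /dot /comb /=; ring. Qed.

Lemma hull_half A (a : R * R) (b : R) : (forall p, A p -> b <= dot a p) ->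
  forall p, hull A p -> b <= dot a p.
Proof.
move=> H; apply: (@hull_sub A [set p | b <= dot a p]) => //.
move=> p q t /= hp hq /andP[t0 t1]; rewrite dot_comb.
have := ler_wpM2l (ltW t0) hp; have : 0 <= (1 - t) * (dot a q - b) by apply: mulr_ge0; lra.
lra.
Qed.

Lemma hull_half_lt A (a : R * R) (b : R) : (forall p, A p -> b < dot a p) ->
  forall p, hull A p -> b < dot a p.
Proof.
move=> H; apply: (@hull_sub A [set p | b < dot a p]) => //.
move=> p q t /= hp hq /andP[t0 t1]; rewrite dot_comb.
have : 0 < t * (dot a p - b) by apply: mulr_gt0; lra.
have : 0 < (1 - t) * (dot a q - b) by apply: mulr_gt0; lra.
lra.
Qed.

Lemma hull_disk A c (r : R) : (forall p, A p -> nsq (p - c) <= r) ->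
  forall p, hull A p -> nsq (p - c) <= r.
Proof.
move=> H; apply: (@hull_sub A [set p | nsq (p - c) <= r]) => //.
move=> p q t /= hp hq /andP[t0 t1].
have E : nsq (comb t p q - c) = t * nsq (p - c) + (1 - t) * nsq (q - c) - t * (1 - t) * nsq (p - q).
  by rewrite /nsq /comb /=; ring.
have : 0 <= t * (1 - t) * nsq (p - q) by apply: mulr_ge0 (nsq_ge0 _); apply: mulr_ge0; lra.
have : 0 <= t * (r - nsq (p - c)) by apply: mulr_ge0; lra.
have : 0 <= (1 - t) * (r - nsq (q - c)) by apply: mulr_ge0; lra.
rewrite E; lra.
Qed.

(** The points strictly beyond the supporting line, together with the hull of the generators on it,
    form a convex set that contains [A]. *)
Lemma hull_face A (a : R * R) (b : R) : (forall p, A p -> b <= dot a p) ->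
  forall p, hull A p -> dot a p = b -> hull (A `&` [set p | dot a p = b]) p.
Proof.
move=> H p hp pb; set B := A `&` _.
have Bb q : hull B q -> dot a q = b.
  move=> hq; apply/eqP; rewrite eq_le; apply/andP; split; last first.
    by apply: (@hull_half B) hq => e [_ /= ->].
  have := @hull_half B (- a) (- b).
  have E e : dot (- a) e = - dot a e by rewrite /dot /=; ring.
  move=> /(_ _ q hq); rewrite E lerN2; apply => e [_ /= eb].
  by rewrite E eb.
have : (hull A `<=` [set q | b < dot a q \/ hull B q]).
  apply: hull_sub; last first.
    move=> q Aq /=; have := H _ Aq; rewrite le_eqVlt => /orP[/eqP e|]; last by left.
    by right; apply: sub_hull; split.
  move=> x y t /= hx hy t01; have /andP[t0 t1] := t01; rewrite dot_comb.
  have gx : b <= dot a x by case: hx => [/ltW//|/Bb->].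
  have gy : b <= dot a y by case: hy => [/ltW//|/Bb->].
  case: hx hy => [xb|hx] [yb|hy].
  - left; have : 0 < t * (dot a x - b) by apply: mulr_gt0; lra.
    have : 0 < (1 - t) * (dot a y - b) by apply: mulr_gt0; lra.
    lra.
  - left; have : 0 < t * (dot a x - b) by apply: mulr_gt0; lra.
    rewrite (Bb _ hy); lra.
  - left; have : 0 < (1 - t) * (dot a y - b) by apply: mulr_gt0; lra.
    rewrite (Bb _ hx); lra.
  - by right; exact: hull_comb.
by move=> /(_ _ hp) /= [|//]; rewrite pb ltxx.
Qed.

Lemma hull_triangle (x y z : R * R) (s t : R) : 0 <= s -> 0 <= t -> s + t <= 1 ->
  hull [set x; y; z] ((1 - s - t) * x.1 + s * y.1 + t * z.1, (1 - s - t) * x.2 + s * y.2 + t * z.2).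
Proof.
have comb' A p q k : hull A p -> hull A q -> 0 <= k <= 1 -> hull A (comb k p q).
  move=> hp hq /andP[k0 k1].
  have [->|k0'] := eqVneq k 0.
    by have -> : comb 0 p q = q by rewrite /comb !mul0r !add0r subr0 !mul1r; case: (q).
  have [->|k1'] := eqVneq k 1.
    by have -> : comb 1 p q = p by rewrite /comb subrr !mul0r !addr0 !mul1r; case: (p).
  by apply: hull_comb => //; rewrite !lt_neqAle k0 k1 k1' eq_sym k0'.
move=> s0 t0 st; set T := [set x; y; z].
have hx : hull T x by apply: sub_hull; left; left.
have hy : hull T y by apply: sub_hull; left; right.
have hz : hull T z by apply: sub_hull; right.
have [st0|st0] := eqVneq (s + t) 0.
  have -> : s = 0 by lra.
  have -> : t = 0 by lra.
  have -> : ((1 - 0 - 0) * x.1 + 0 * y.1 + 0 * z.1, (1 - 0 - 0) * x.2 + 0 * y.2 + 0 * z.2) = x.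
    by rewrite [RHS]surjective_pairing; congr pair; ring.
  exact: hx.
have stp : 0 < s + t by rewrite lt_neqAle eq_sym st0 addr_ge0.
have h1 : hull T (comb (s / (s + t)) y z).
  apply: comb' => //; apply/andP; split; first by apply: divr_ge0 => //; exact: ltW.
  by rewrite ler_pdivrMr// mul1r; lra.
have st01 : 0 <= s + t <= 1 by rewrite st ltW.
have := comb' _ _ _ _ h1 hx st01.
congr (hull _ _); rewrite /comb /=; congr pair; field; exact: st0.
Qed.

End hull.

Section interiors.
Variable R : realType.
Implicit Types (A : set (R * R)) (a z : R * R) (b : R).

Lemma interior_half_lt A a b z : a != 0 -> (forall p, A p -> b <= dot a p) -> A° z ->
  b < dot a z.
Proof.
move=> a0 H zi; have [t [t0 /H]] := interior_segment (- a) zi.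
have -> : dot a (z.1 + t * (- a).1, z.2 + t * (- a).2) = dot a z - t * nsq a.
  by rewrite /dot /nsq /=; ring.
have : 0 < t * nsq a by rewrite mulr_gt0// nsq_gt0.
lra.
Qed.

Lemma continuous_dot a : continuous (dot a).
Proof.
move=> z; apply: (@cvgD _ _ _ _ _ (fun p : R * R => a.1 * p.1) (fun p : R * R => a.2 * p.2)).
  by apply: (@cvgM _ _ _ _ (fun _ : R * R => a.1) (fun p : R * R => p.1)); [exact: cvg_cst|exact: cvg_fst].
by apply: (@cvgM _ _ _ _ (fun _ : R * R => a.2) (fun p : R * R => p.2)); [exact: cvg_cst|exact: cvg_snd].
Qed.

Lemma interior_three_halves A a1 b1 a2 b2 a3 b3 z :
  (forall p, b1 < dot a1 p -> b2 < dot a2 p -> b3 < dot a3 p -> A p) ->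
  b1 < dot a1 z -> b2 < dot a2 z -> b3 < dot a3 z -> A° z.
Proof.
move=> H h1 h2 h3; rewrite /interior /=.
have N a b : b < dot a z -> \forall p \near z, b < dot a p.
  by move=> hb; have := @cvgr_gt _ _ _ _ _ _ (@continuous_dot a z) _ hb => /(_ (nbhs_filter z)).
near=> p; apply: H; near: p; exact: N.
Unshelve. all: by end_near. Qed.

End interiors.

(** * Tiles cut out by empty circles of equal radius *)

Section tiles.
Variable R : realType.
Implicit Types (X V W : set (R * R)) (c p q : R * R) (rho : R).

Definition tile X rho c : set (R * R) := [set p | X p /\ nsq (p - c) = rho].

Definition empty_circle X rho c := forall p, X p -> rho <= nsq (p - c).

(** The tangent at [v] leaves all other points of the circle strictly on one side. *)
Lemma tile_vertex X rho c v : tile X rho c v -> ~ hull (tile X rho c `\ v) v.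
Proof.
move=> [Xv vc] hv.
have := @hull_half_lt _ (tile X rho c `\ v) (c - v) (dot (c - v) v) _ v hv.
rewrite ltxx => bad; suff : false by [].
apply: bad => p [[Xp pc] /eqP pv].
have n0 : 0 < nsq (p - v) by rewrite nsq_gt0// subr_eq0.
move: pc n0; rewrite -vc /nsq /dot /=; lra.
Qed.

(* The radical axis of the two circles separates the tiles. *)
Lemma tile_meet X rho c c' : empty_circle X rho c -> empty_circle X rho c' ->
  tile X rho c <> tile X rho c' ->
  (hull (tile X rho c))° `&` (hull (tile X rho c'))° = set0 /\
  hull (tile X rho c) `&` hull (tile X rho c') = hull (tile X rho c `&` tile X rho c').
Proof.
move=> ec ec' cc'; pose a : R * R := (2 * (c.1 - c'.1), 2 * (c.2 - c'.2)).
pose b := nsq c - nsq c'.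
have gE p : dot a p - b = nsq (p - c') - nsq (p - c).
  by rewrite /dot /a /b /nsq /=; ring.
have gV p : tile X rho c p -> b <= dot a p.
  by move=> [Xp pc]; rewrite -subr_ge0 gE pc subr_ge0; exact: ec'.
have gW p : tile X rho c' p -> - b <= dot (- a) p.
  move=> [Xp pc]; have -> : dot (- a) p = - dot a p by rewrite /dot /=; ring.
  by rewrite lerN2 -subr_le0 gE pc subr_le0; exact: ec.
split.
  apply/seteqP; split => z // -[zV zW].
  have [a0|a0] := eqVneq a 0.
    exfalso; apply: cc'; suff -> : c = c' by [].
    move: a0; rewrite /a => -[/eqP + /eqP]; rewrite !mulf_eq0 !subr_eq0 !pnatr_eq0 /=.
    by move=> /eqP e1 /eqP e2; rewrite [c]surjective_pairing e1 e2 -surjective_pairing.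
  have h1 := interior_half_lt a0 (hull_half gV) zV.
  have a0' : - a != 0 by rewrite oppr_eq0.
  have := interior_half_lt a0' (hull_half gW) zW.
  have -> : dot (- a) z = - dot a z by rewrite /dot /=; ring.
  by rewrite ltrN2 => /(lt_trans h1); rewrite ltxx.
apply/seteqP; split => [z [zV zW]|z zVW].
  have h1 := hull_half gV zV; have := hull_half gW zW.
  have -> : dot (- a) z = - dot a z by rewrite /dot /=; ring.
  move=> h2; have zb : dot a z = b by apply/eqP; rewrite eq_le h1 andbT; lra.
  apply: hull_mono (hull_face gV zV zb) => p [[Xp pc] /= pb]; split => //; split => //.
  by have := gE p; rewrite pb subrr pc => /esym/eqP; rewrite subr_eq0 => /eqP.
by split; apply: hull_mono zVW => p [].
Qed.

End tiles.

Section rhombic_coordinates.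
Variables (R : realType) (u v : R * R).
Hypothesis D0 : cross u v != 0.
Implicit Types (p x z : R * R).

Definition tri x u v : set (R * R) := [set x + u; x + v; x].

Let aa : R * R := (v.2 / cross u v, - v.1 / cross u v).
Let bb : R * R := (- u.2 / cross u v, u.1 / cross u v).
Definition co1 z := dot aa z.
Definition co2 z := dot bb z.

Lemma coE z : z = (co1 z * u.1 + co2 z * v.1, co1 z * u.2 + co2 z * v.2).
Proof.
rewrite [LHS]surjective_pairing; congr pair; rewrite /co1 /co2 /dot /=;
by move: D0; rewrite /cross => D0'; field.
Qed.

Lemma co1D p q : co1 (p + q) = co1 p + co1 q.
Proof. by rewrite /co1 /dot /=; ring. Qed.
Lemma co2D p q : co2 (p + q) = co2 p + co2 q.
Proof. by rewrite /co2 /dot /=; ring. Qed.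
Lemma co_u : (co1 u = 1) * (co2 u = 0).
Proof. by split; rewrite /co1 /co2 /dot /=; move: D0; rewrite /cross => D0'; field. Qed.
Lemma co_v : (co1 v = 0) * (co2 v = 1).
Proof. by split; rewrite /co1 /co2 /dot /=; move: D0; rewrite /cross => D0'; field. Qed.

Lemma co_lat (m n : int) : (co1 (u *~ m + v *~ n) = m%:~R) * (co2 (u *~ m + v *~ n) = n%:~R).
Proof.
by split; rewrite !mulz_pair /co1 /co2 /dot /=; move: D0; rewrite /cross => D0'; field.
Qed.

Lemma aa_neq0 : aa != 0.
Proof.
apply: contraNneq D0 => e; have := co_u.1; rewrite /co1 e /dot /= !mul0r addr0 => /eqP.
by rewrite eq_sym oner_eq0.
Qed.

Lemma bb_neq0 : bb != 0.
Proof.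
apply: contraNneq D0 => e; have := co_v.2; rewrite /co2 e /dot /= !mul0r addr0 => /eqP.
by rewrite eq_sym oner_eq0.
Qed.

Lemma aabb_neq0 : - (aa + bb) != 0.
Proof.
apply: contraNneq D0 => e; have : dot (- (aa + bb)) u = - (co1 u + co2 u).
  by rewrite /co1 /co2 /dot /=; ring.
by rewrite e !co_u /dot /= !mul0r addr0 addr0 => /eqP; rewrite eq_sym oppr_eq0 oner_eq0.
Qed.

Lemma dot_aabb p : dot (- (aa + bb)) p = - (co1 p + co2 p).
Proof. by rewrite /co1 /co2 /dot /=; ring. Qed.

Lemma tri_hullE x p : hull (tri x u v) p <->
  [/\ co1 x <= co1 p, co2 x <= co2 p & co1 p + co2 p <= co1 x + co2 x + 1].
Proof.
split=> [hp|[h1 h2 h3]].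
  split.
  - apply: (hull_half _ hp) => q [[|]|] /= ->; rewrite -?/(co1 _) ?co1D ?co_u ?co_v; lra.
  - apply: (hull_half _ hp) => q [[|]|] /= ->; rewrite -?/(co2 _) ?co2D ?co_u ?co_v; lra.
  - have : - (co1 x + co2 x + 1) <= dot (- (aa + bb)) p.
      apply: (hull_half _ hp) => q [[|]|] /= ->; rewrite dot_aabb ?co1D ?co2D ?co_u ?co_v; lra.
    rewrite dot_aabb; lra.
pose s := co1 p - co1 x; pose t := co2 p - co2 x.
have := @hull_triangle _ (x + u) (x + v) x t (1 - s - t).
have -> : 1 - t - (1 - s - t) = s by ring.
have -> : (s * (x + u).1 + t * (x + v).1 + (1 - s - t) * x.1,
           s * (x + u).2 + t * (x + v).2 + (1 - s - t) * x.2) = p.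
  rewrite [in RHS](coE p); have := coE x; rewrite {1}[x]surjective_pairing => -[e1 e2].
  by congr pair; rewrite /= /s /t; [rewrite {1 2 3}e1|rewrite {1 2 3}e2]; ring.
by apply; rewrite /s /t; lra.
Qed.

Lemma tri_interior x p : (hull (tri x u v))° p <->
  [/\ co1 x < co1 p, co2 x < co2 p & co1 p + co2 p < co1 x + co2 x + 1].
Proof.
split=> [hp|[h1 h2 h3]].
  split.
  - by apply: (interior_half_lt aa_neq0 _ hp) => q /tri_hullE[].
  - by apply: (interior_half_lt bb_neq0 _ hp) => q /tri_hullE[].
  - have : - (co1 x + co2 x + 1) < dot (- (aa + bb)) p.
      by apply: (interior_half_lt aabb_neq0 _ hp) => q /tri_hullE[_ _]; rewrite dot_aabb lerN2.
    rewrite dot_aabb; lra.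
apply: (@interior_three_halves _ _ aa (co1 x) bb (co2 x) (- (aa + bb)) (- (co1 x + co2 x + 1))) => //.
  move=> q q1 q2; rewrite dot_aabb => q3; apply/tri_hullE; split; [exact: ltW|exact: ltW|lra].
rewrite dot_aabb; lra.
Qed.

End rhombic_coordinates.

Lemma int_pred_ge0 (m : int) : (0 <= m * (m - 1))%R.
Proof. by have [m0|m1] := lerP m 0; [rewrite -mulrNN mulr_ge0|rewrite mulr_ge0]; lia. Qed.

Lemma int_pred_eq0 (m : int) : (m * (m - 1) = 0)%R -> (0 <= m <= 1)%R.
Proof. by move=> /eqP; rewrite mulf_eq0 subr_eq0 => /orP[] /eqP ->. Qed.

(** Twice the form plus 1 is a sum of three integer squares, not all of them zero. *)
Lemma int_form_ge0 (m n : int) : (0 <= m * (m - 1) + n * (n - 1) + m * n)%R.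
Proof.
have e : (2 * (m * (m - 1) + n * (n - 1) + m * n) = (m + n - 1) * (m + n - 1) + m * m + n * n - 1)%R by ring.
have h1 : (0 <= (m + n - 1) * (m + n - 1))%R by rewrite -expr2 sqr_ge0.
have h2 : (0 <= m * m)%R by rewrite -expr2 sqr_ge0.
have h3 : (0 <= n * n)%R by rewrite -expr2 sqr_ge0.
have [m0|m0] := eqVneq m 0; first by rewrite m0; nia.
have : (1 <= m * m)%R by nia.
lia.
Qed.

Lemma int_form_eq0 (m n : int) : (m * (m - 1) + n * (n - 1) + m * n = 0)%R ->
  (0 <= m <= 1)%R /\ (0 <= n <= 1)%R.
Proof.
move=> z.
have e : (2 * (m * (m - 1) + n * (n - 1) + m * n) = (m + n - 1) * (m + n - 1) + m * m + n * n - 1)%R by ring.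
have h1 : (0 <= (m + n - 1) * (m + n - 1))%R by rewrite -expr2 sqr_ge0.
have h2 : (0 <= m * m)%R by rewrite -expr2 sqr_ge0.
have h3 : (0 <= n * n)%R by rewrite -expr2 sqr_ge0.
have m1 : (m * m <= 1)%R by lia.
have n1 : (n * n <= 1)%R by lia.
have mb : (-1 <= m <= 1)%R by nia.
have nb : (-1 <= n <= 1)%R by nia.
have : m = -1 \/ m = 0 \/ m = 1 by lia.
have : n = -1 \/ n = 0 \/ n = 1 by lia.
by case=> [n0|[n0|n0]]; case=> [m0|[m0|m0]]; move: z; rewrite m0 n0; lia.
Qed.

Section rhombic_tiles.
Variables (R : realType) (h : R).
Hypothesis h01 : 0 <= h <= 1 / 2.
Implicit Types (u v p x z : R * R).

Definition rhombic u v := [/\ nsq u = 4, nsq v = 4 & dot u v = 4 * h].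

Let rho := 2 / (1 + h).
(* The circumcenter of [0], [u], [v]; its squared norm is [2 / (1 + h)]. *)
Definition center u v : R * R := ((u.1 + v.1) / (2 * (1 + h)), (u.2 + v.2) / (2 * (1 + h))).

Lemma h1_neq0 : 1 + h != 0.
Proof. by have /andP[h0 _] := h01; apply/eqP; lra. Qed.

Lemma rhombicN u v : rhombic u v -> rhombic (- u) (- v).
Proof.
by move=> [u4 v4 uv]; split; [rewrite -u4|rewrite -v4|rewrite -uv]; rewrite /nsq /dot /=; ring.
Qed.

Lemma latNN u v : lat (- u) (- v) = lat u v.
Proof.
by apply/seteqP; split=> p [m [n ->]]; exists (- m), (- n);
  rewrite !mulrNz ?mulNrz ?opprK.
Qed.

Lemma centerN u v : center (- u) (- v) = - center u v.
Proof. by rewrite [RHS]surjective_pairing /center /=; congr pair; field; exact: h1_neq0. Qed.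

Lemma center_dot u v (a b : R) : rhombic u v ->
  nsq ((a * u.1 + b * v.1, a * u.2 + b * v.2) - center u v) =
  rho + 4 * (a * (a - 1) + b * (b - 1) + 2 * h * a * b).
Proof.
move=> [u4 v4 uv]; pose k := (2 * (1 + h))^-1.
have -> : nsq ((a * u.1 + b * v.1, a * u.2 + b * v.2) - center u v) =
    (a - k) ^+ 2 * nsq u + (b - k) ^+ 2 * nsq v + 2 * (a - k) * (b - k) * dot u v.
  by rewrite /nsq /dot /center /= -/k; ring.
by rewrite u4 v4 uv /rho /k; field; exact: h1_neq0.
Qed.

(* By [center_dot], four times this form is the power of [u *~ m + v *~ n] with
   respect to the circumcircle of [0], [u], [v]. *)
Lemma power_ge0 (m n : int) :
  0 <= m%:~R * (m%:~R - 1) + n%:~R * (n%:~R - 1) + 2 * h * m%:~R * n%:~R.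
Proof.
have /andP[h0 h1] := h01.
have i1 : (0 <= m * (m - 1) + n * (n - 1))%R by rewrite addr_ge0 ?int_pred_ge0.
have i2 := int_form_ge0 m n.
have : 0 <= (m * (m - 1) + n * (n - 1))%:~R :> R by rewrite ler0z.
have : 0 <= (m * (m - 1) + n * (n - 1) + m * n)%:~R :> R by rewrite ler0z.
rewrite !rmorphD !rmorphM /= !rmorphB /=; move: (m%:~R : R) (n%:~R : R) => x y e2 e1.
have : 0 <= (1 - 2 * h) * (x * (x - 1) + y * (y - 1)) by apply: mulr_ge0; lra.
have : 0 <= 2 * h * (x * (x - 1) + y * (y - 1) + x * y) by apply: mulr_ge0; lra.
lra.
Qed.

(** The form is again a combination of its cases [h = 0] and [h = 1 / 2]. For [0 < h] the second
    must vanish, which excludes [(1, 1)]; for [h = 0] all four corners of the square lie on the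
    circle. *)
Lemma power_eq0 (m n : int) :
  m%:~R * (m%:~R - 1) + n%:~R * (n%:~R - 1) + 2 * h * m%:~R * n%:~R = 0 :> R ->
  [\/ m = 1 /\ n = 0, m = 0 /\ n = 1, m = 0 /\ n = 0 | [/\ h = 0, m = 1 & n = 1]].
Proof.
have /andP[h0 h1] := h01.
have i1 : (0 <= m * (m - 1) + n * (n - 1))%R by rewrite addr_ge0 ?int_pred_ge0.
have i2 := int_form_ge0 m n.
have : 0 <= (m * (m - 1) + n * (n - 1))%:~R :> R by rewrite ler0z.
have : 0 <= (m * (m - 1) + n * (n - 1) + m * n)%:~R :> R by rewrite ler0z.
have p1 : (m * (m - 1) + n * (n - 1))%:~R = m%:~R * (m%:~R - 1) + n%:~R * (n%:~R - 1) :> R.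
  by rewrite !rmorphD !rmorphM /= !rmorphB.
have p2 : (m * (m - 1) + n * (n - 1) + m * n)%:~R = m%:~R * (m%:~R - 1) + n%:~R * (n%:~R - 1) + m%:~R * n%:~R :> R.
  by rewrite rmorphD /= p1 rmorphM.
move=> q2 q1 e.
have [h_eq0|hn0] := eqVneq h 0.
  have : (m * (m - 1) + n * (n - 1))%:~R = 0 :> R by rewrite p1; move: e; rewrite h_eq0; lra.
  move=> /eqP; rewrite intr_eq0 => /eqP k0.
  have im := int_pred_ge0 m; have jn := int_pred_ge0 n.
  have [hm hn] : (0 <= m <= 1)%R /\ (0 <= n <= 1)%R by split; apply: int_pred_eq0; lia.
  have [m0|m1] : m = 0 \/ m = 1 by lia.
    have [n0|n1] : n = 0 \/ n = 1 by lia.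
      by constructor 3.
    by constructor 2.
  have [n0|n1] : n = 0 \/ n = 1 by lia.
    by constructor 1.
  by constructor 4.
have hp : 0 < h by rewrite lt_neqAle eq_sym hn0.
have : (m * (m - 1) + n * (n - 1) + m * n)%:~R = 0 :> R.
  apply/eqP; rewrite eq_le q2 andbT.
  have : 0 <= (1 - 2 * h) * (m * (m - 1) + n * (n - 1))%:~R by apply: mulr_ge0; lra.
  have : 2 * h * (m * (m - 1) + n * (n - 1) + m * n)%:~R + (1 - 2 * h) * (m * (m - 1) + n * (n - 1))%:~R = 0.
    by rewrite p1 p2 -[RHS]e; ring.
  move=> e1 e2; have : 2 * h * (m * (m - 1) + n * (n - 1) + m * n)%:~R <= 0 by lra.
  by rewrite pmulr_rle0//; lra.
move=> /eqP; rewrite intr_eq0 => /eqP k0.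
have [hm hn] := int_form_eq0 k0.
have [m0|m1] : m = 0 \/ m = 1 by lia.
  have [n0|n1] : n = 0 \/ n = 1 by lia.
    by constructor 3.
  by constructor 2.
have [n0|n1] : n = 0 \/ n = 1 by lia.
  by constructor 1.
by exfalso; move: k0; rewrite m1 n1.
Qed.

Lemma lat_rel u v x p : lat u v x -> lat u v p -> exists m n : int,
  p - x = (m%:~R * u.1 + n%:~R * v.1, m%:~R * u.2 + n%:~R * v.2).
Proof. by move=> lx lp; apply/latP; exact: latB. Qed.

Lemma nsq_center u v x p : nsq (p - (x + center u v)) = nsq ((p - x) - center u v).
Proof. by rewrite opprD addrA. Qed.

Lemma tile_empty u v x : rhombic u v -> lat u v x ->
  empty_circle (lat u v) rho (x + center u v).
Proof.
move=> ruv lx p lp; have [m [n e]] := lat_rel lx lp.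
by rewrite nsq_center e center_dot// lerDl mulr_ge0// power_ge0.
Qed.

Lemma tri_tile u v x : rhombic u v -> lat u v x ->
  tri x u v `<=` tile (lat u v) rho (x + center u v).
Proof.
move=> ruv lx.
have E (a b : R) p : p - x = (a * u.1 + b * v.1, a * u.2 + b * v.2) ->
    a * (a - 1) + b * (b - 1) + 2 * h * a * b = 0 -> nsq (p - (x + center u v)) = rho.
  by move=> e z; rewrite nsq_center e center_dot// z mulr0 addr0.
move=> p [[|]|] /= ->; split.
- by apply: latD => //; exact: lat1.
- apply: (E 1 0); last ring.
  by rewrite addrC addKr [LHS]surjective_pairing; congr pair; ring.
- by apply: latD => //; exact: lat2.
- apply: (E 0 1); last ring.
  by rewrite addrC addKr [LHS]surjective_pairing; congr pair; ring.
- by [].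
- by apply: (E 0 0); [rewrite subrr; congr pair; rewrite /=; ring|ring].
Qed.

Lemma tile_vertices u v x p : rhombic u v -> lat u v x ->
  tile (lat u v) rho (x + center u v) p -> tri x u v p \/ (h = 0 /\ p = x + u + v).
Proof.
move=> ruv lx [lp pc]; have [m [n e]] := lat_rel lx lp.
move: pc; rewrite nsq_center e center_dot// => pc.
have /power_eq0 : m%:~R * (m%:~R - 1) + n%:~R * (n%:~R - 1) + 2 * h * m%:~R * n%:~R = 0 :> R by lra.
have pE : p = x + (p - x) by rewrite addrC subrK.
case=> [[m1 n0]|[m0 n1]|[m0 n0]|[h0 m1 n1]].
- left; left; left; rewrite /= pE e m1 n0; congr (_ + _).
  by rewrite [RHS]surjective_pairing; congr pair; rewrite /=; ring.
- left; left; right; rewrite /= pE e m0 n1; congr (_ + _).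
  by rewrite [RHS]surjective_pairing; congr pair; rewrite /=; ring.
- left; right; rewrite /= pE e m0 n0 -[RHS]addr0; congr (_ + _).
  by congr pair; rewrite /=; ring.
- right; split=> //; rewrite pE e m1 n1 -addrA; congr (_ + _).
  by congr pair; rewrite /=; ring.
Qed.

Lemma rhombic_cross u v : rhombic u v -> cross u v != 0.
Proof. by move=> [u4 v4 uv]; exact: cross_rhombic_neq0 u4 v4 uv h01. Qed.

(** Triangles of the second kind are those of the first kind for the basis [- u], [- v] of the same
    lattice, so facts about one kind transfer to the other. *)
Definition half_tiles u v : set (set (R * R)) :=
  [set t | exists x, lat u v x /\ (t = tri x u v \/ t = tri x (- u) (- v))].

Lemma crossNN u v : cross (- u) (- v) = cross u v.
Proof. by rewrite /cross /=; ring. Qed.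

Lemma coNN u v p : (co1 (- u) (- v) p = - co1 u v p) * (co2 (- u) (- v) p = - co2 u v p).
Proof. by rewrite /co1 /co2 /dot !crossNN /=; split; rewrite !mulNr ?opprK; ring. Qed.

Lemma half_tiles_cover u v z : rhombic u v -> exists x, lat u v x /\
  (hull (tri x u v) z \/ hull (tri x (- u) (- v)) z).
Proof.
move=> ruv; have D0 := rhombic_cross ruv; have D0' : cross (- u) (- v) != 0 by rewrite crossNN.
pose m := Num.floor (co1 u v z); pose n := Num.floor (co2 u v z).
have /andP[m1 m2] := floor_itv (co1 u v z); have /andP[n1 n2] := floor_itv (co2 u v z).
rewrite -/m -/n !rmorphD /= in m1 m2 n1 n2.
have [x [lx cx1 cx2]] : exists x, [/\ lat u v x, co1 u v x = m%:~R & co2 u v x = n%:~R].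
  by exists (u *~ m + v *~ n); rewrite !(co_lat D0); split=> //; exists m, n.
have [le1|gt1] := leP (co1 u v z + co2 u v z) (m%:~R + n%:~R + 1).
  exists x; split=> //; left; apply/(tri_hullE D0); by rewrite cx1 cx2; split.
exists (x + u + v); split; first by apply: latD; [apply: latD => //; exact: lat1|exact: lat2].
right; apply/(tri_hullE D0'); rewrite !coNN !co1D !co2D cx1 cx2 !(co_u D0) !(co_v D0).
by split; lra.
Qed.

(** The integer parts of the coordinates of [z] determine its cell, and the diagonal separates the
    two triangles there. A triangle with [- u], [- v] at [x] lies in the cell of [x - u - v], hence
    the shifts by 1. *)
Lemma half_tiles_disjoint u v t t' z : rhombic u v -> half_tiles u v t -> half_tiles u v t' ->
  (hull t)° z -> (hull t')° z -> t = t'.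
Proof.
move=> ruv; have D0 := rhombic_cross ruv; have D0' : cross (- u) (- v) != 0 by rewrite crossNN.
have pos (m n : int) (x : R) : m%:~R < x -> x < m%:~R + 1 -> n%:~R < x -> x < n%:~R + 1 -> m = n.
  move=> a b c d; have : (m%:~R : R) < n%:~R + 1 by lra.
  have : (n%:~R : R) < m%:~R + 1 by lra.
  by rewrite -!(rmorphD _ _ 1) /= !ltr_int; lia.
have side x : lat u v x -> exists m n : int, [/\ x = u *~ m + v *~ n, co1 u v x = m%:~R & co2 u v x = n%:~R].
  by move=> [m [n ->]]; exists m, n; rewrite !(co_lat D0).
move=> [x [lx tx]] [x' [lx' tx']].
have [m [n [xE xm xn]]] := side _ lx; have [m' [n' [xE' xm' xn']]] := side _ lx'.
case: tx tx' => -> [] ->.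
- move=> /(tri_interior D0)[a b c] /(tri_interior D0)[a' b' c'].
  rewrite xm xn in a b c; rewrite xm' xn' in a' b' c'.
  have e1 : m = m' by apply: (pos _ _ (co1 u v z)); lra.
  have e2 : n = n' by apply: (pos _ _ (co2 u v z)); lra.
  by rewrite xE xE' e1 e2.
- move=> /(tri_interior D0)[a b c] /(tri_interior D0')[]; rewrite !coNN => a' b' c'.
  rewrite xm xn in a b c; rewrite xm' xn' in a' b' c'.
  have e1 : m' - 1 = m by apply: (pos _ _ (co1 u v z)); rewrite ?rmorphB /=; lra.
  have e2 : n' - 1 = n by apply: (pos _ _ (co2 u v z)); rewrite ?rmorphB /=; lra.
  by exfalso; move: c; rewrite -e1 -e2 !rmorphB /=; lra.
- move=> /(tri_interior D0')[] + + + /(tri_interior D0)[a' b' c']; rewrite !coNN => a b c.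
  rewrite xm xn in a b c; rewrite xm' xn' in a' b' c'.
  have e1 : m - 1 = m' by apply: (pos _ _ (co1 u v z)); rewrite ?rmorphB /=; lra.
  have e2 : n - 1 = n' by apply: (pos _ _ (co2 u v z)); rewrite ?rmorphB /=; lra.
  by exfalso; move: c'; rewrite -e1 -e2 !rmorphB /=; lra.
- move=> /(tri_interior D0')[] + + + /(tri_interior D0')[]; rewrite !coNN => a b c a' b' c'.
  rewrite xm xn in a b c; rewrite xm' xn' in a' b' c'.
  have e1 : m - 1 = m' - 1 by apply: (pos _ _ (co1 u v z)); rewrite ?rmorphB /=; lra.
  have e2 : n - 1 = n' - 1 by apply: (pos _ _ (co2 u v z)); rewrite ?rmorphB /=; lra.
  by rewrite xE xE' (addIr _ e1) (addIr _ e2).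
Qed.

End rhombic_tiles.

Section rhombic_delaunay.
Variables (R : realType) (h : R).
Hypothesis h01 : 0 <= h <= 1 / 2.
Implicit Types (u v p x z : R * R).
Local Notation rho := (2 / (1 + h)).
Local Notation center := (center h).

(** A tile collects all lattice points on its circle. Thus for [h = 0] both kinds give the same
    square cells, and for [0 < h] they are triangles, without a case distinction. *)
Definition tiles u v : set (set (R * R)) :=
  [set V | exists x, lat u v x /\ (V = tile (lat u v) rho (x + center u v) \/
                                   V = tile (lat u v) rho (x - center u v))].

Lemma tiles_sym u v (P : set (R * R) -> set (R * R) -> Prop) :
  (forall u v x, rhombic h u v -> lat u v x -> P (lat u v) (tile (lat u v) rho (x + center u v))) ->
  forall V, rhombic h u v -> tiles u v V -> P (lat u v) V.
Proof.
move=> H V ruv [x [lx [->|->]]]; first exact: H.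
rewrite -(centerN h01) -latNN; apply: H; [exact: rhombicN|by rewrite latNN].
Qed.

Lemma finite_set4 (a b c d : R * R) : finite_set ([set a; b; c] `|` [set d]).
Proof. by rewrite !finite_setU; do !split; exact: finite_set1. Qed.

Lemma tile_polygon u v x : rhombic h u v -> lat u v x ->
  polygon (tile (lat u v) rho (x + center u v)).
Proof.
move=> ruv lx; have D0 := rhombic_cross h01 ruv; split.
- apply: (@sub_finite_set _ _ (tri x u v `|` [set x + u + v])); last exact: finite_set4.
  move=> p /(tile_vertices h01 ruv lx)[|[_ ->]]; [by left|by right].
- pose z : R * R := (x.1 + 1 / 3 * u.1 + 1 / 3 * v.1, x.2 + 1 / 3 * u.2 + 1 / 3 * v.2).
  exists z; apply: (@interiorS _ (hull (tri x u v))); first exact: hull_mono (tri_tile h01 ruv lx).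
  have zE : z = x + ((1 / 3 * u.1 + 1 / 3 * v.1), (1 / 3 * u.2 + 1 / 3 * v.2)).
    by rewrite /z; congr pair; rewrite /= addrA.
  have [e1 e2] : co1 u v z = co1 u v x + 1 / 3 /\ co2 u v z = co2 u v x + 1 / 3.
    rewrite zE co1D co2D; split; congr (_ + _); move: D0; rewrite /co1 /co2 /dot /cross /= => D0; field; exact: D0.
  by apply/(tri_interior D0); rewrite e1 e2; split; lra.
- by move=> p; exact: tile_vertex.
Qed.

Lemma tiles_cover u v z : rhombic h u v -> exists2 V, tiles u v V & hull V z.
Proof.
move=> ruv; have [x [lx [hz|hz]]] := half_tiles_cover h01 z ruv.
  exists (tile (lat u v) rho (x + center u v)); first by exists x; split=> //; left.
  exact: hull_mono (tri_tile h01 ruv lx) _ hz.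
exists (tile (lat u v) rho (x - center u v)); first by exists x; split=> //; right.
have lx' : lat (- u) (- v) x by rewrite latNN.
have := hull_mono (tri_tile h01 (rhombicN ruv) lx') hz.
by rewrite latNN (centerN h01).
Qed.

Lemma lat_disk_finite u v (r : R) : rhombic h u v -> 0 <= r ->
  finite_set (lat u v `&` [set p | nsq p <= r ^+ 2]).
Proof.
move=> [u4 v4 uv] r0.
have [|s [us -> _]] := sparse_disk _ r0 (packing_sparse (rhombic_packing u4 v4 uv h01)).
  rewrite sqrtr_gt0 ltr0n /=; apply: ler_of_sqr => //.
  by rewrite sqr_sqrtr//; lra.
exact: finite_seq.
Qed.

Lemma center_nsq u v : rhombic h u v -> nsq (center u v) = rho.
Proof.
move=> [u4 v4 uv]; have := center_dot h01 0 0 (And3 u4 v4 uv).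
have -> : 0 * (0 - 1) + 0 * (0 - 1) + 2 * h * 0 * 0 = 0 by ring.
by rewrite mulr0 addr0 => <-; rewrite /nsq /=; ring.
Qed.

Lemma rho_le : 0 <= rho <= 2.
Proof. by have /andP[h0 h1] := h01; apply/andP; split; [rewrite divr_ge0//|rewrite ler_pdivrMr]; lra. Qed.

Lemma tiles_delaunay u v : rhombic h u v -> delaunay (lat u v) (tiles u v).
Proof.
move=> ruv; split.
- move=> V DV; split.
    by apply: (@tiles_sym u v (fun _ V => polygon V)) DV => // *; exact: tile_polygon.
  by apply: (@tiles_sym u v (fun X V => V `<=` X)) DV => // *; move=> p [].
- apply/seteqP; split=> z.
    case=> V [x [lx hV]] hz; apply: hull_mono hz => p; case: hV => -> []//.
  by move=> _; have [V DV hz] := tiles_cover z ruv; exists V.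
- move=> V W.
  have E X : tiles u v X -> exists c, X = tile (lat u v) rho c /\ empty_circle (lat u v) rho c.
    apply: (@tiles_sym u v (fun Y V => exists c, V = tile Y rho c /\ empty_circle Y rho c)) => // u' v' x r' l'.
    by exists (x + center u' v'); split=> //; exact: tile_empty.
  move=> /E[c [-> ec]] /E[c' [-> ec']]; exact: tile_meet.
- move=> r; have [r0|r0] := ltP r 0.
    rewrite (_ : mkset _ = set0)//; apply/seteqP; split=> V // -[_ [z [_ zr]]].
    have : edist z 0 <= r by exact: zr.
    by rewrite leNgt (lt_le_trans r0 (sqrtr_ge0 _)).
  have r4 : 0 <= r + 4 by lra.
  pose S0 := lat u v `&` [set p | nsq p <= (r + 4) ^+ 2].
  have fS0 : finite_set S0 by exact: lat_disk_finite.
  apply: (@sub_finite_set _ _ ((fun x => tile (lat u v) rho (x + center u v)) @` S0 `|`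
     (fun x => tile (lat u v) rho (x - center u v)) @` S0)); last first.
    by rewrite finite_setU; split; exact: finite_image.
  have near x c z : nsq c = rho -> hull (tile (lat u v) rho (x + c)) z -> disk 0 r z ->
      nsq x <= (r + 4) ^+ 2.
    move=> nc hz /(disk_nsq _ _ r0); rewrite subr0 => zr; have /andP[q0 q2] := rho_le.
    have : nsq (z - (x + c)) <= rho by apply: (hull_disk _ hz) => p [_ ->].
    move=> h1; have -> : x = z + ((x + c - z) + (- c)) by rewrite addrA addrCA subrr addr0 addrK.
    have -> : r + 4 = r + (2 + 2) by ring.
    apply: nsqD_le => //; apply: nsqD_le => //.
      by rewrite nsqC; lra.
    have -> : nsq (- c) = nsq c by rewrite /nsq /= !sqrrN.
    by rewrite nc; lra.
  have cn := center_nsq ruv.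
  have cn' : nsq (- center u v) = rho by rewrite -cn /nsq /= !sqrrN.
  move=> V [[x [lx hV]] [z [hz zr]]]; case: hV => e; rewrite e in hz *.
    by left; exists x => //; split=> //; exact: near cn hz zr.
  by right; exists x => //; split=> //; exact: near cn' hz zr.
- move=> V DV; apply: (@tiles_sym u v (fun X V => exists c (r : R), [/\ forall w, V w -> edist w c = r,
     forall x, X x -> ~ edist x c < r & forall x, X x -> edist x c = r -> V x]) _ V ruv DV) => {DV V ruv} {}u {}v x ruv lx.
  exists (x + center u v), (Num.sqrt rho); have /andP[q0 _] := rho_le; split.
  + by move=> w [_ <-].
  + move=> p lp; rewrite edist_nsq ltNge; apply/negP/negPn.
    by rewrite ler_sqrt ?nsq_ge0//; exact: (tile_empty h01 ruv lx).
  + move=> p lp; rewrite edist_nsq => /eqP; rewrite eqr_sqrt ?nsq_ge0// => /eqP e.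
    by split.
Qed.

Lemma card_set3 (a b c : R * R) : a <> b -> a <> c -> b <> c -> ([set a; b; c] #= `I_3)%card.
Proof.
move=> ab ac bc; apply/eq_cardSP; exists a; first by left; left.
apply/eq_cardSP; exists b; first by split; [left; right|exact/nesym].
apply/eq_cardSP; exists c; first by split; [split; [right|exact/nesym]|exact/nesym].
suff -> : [set a; b; c] `\ a `\ b `\ c = set0 by rewrite II0.
rewrite -subset0 => z [[[[[e|e]|e] ea] eb] ec]; [exact: ea|exact: eb|exact: ec].
Qed.

Lemma half_tilesNN u v : half_tiles (- u) (- v) = half_tiles u v.
Proof.
apply/seteqP; split=> t [x [lx tx]]; exists x.
  by move: lx tx; rewrite latNN !opprK => lx [->|->]; split=> //; [right|left].
by rewrite latNN !opprK; case: tx => ->; split=> //; [right|left].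
Qed.

(** For [h = 0] the square is cut along the diagonal from [x + u] to [x + v], and the second
    triangle is the one at [x + u + v]. *)
Lemma tile_dissection u v x : rhombic h u v -> lat u v x ->
  dissection (tile (lat u v) rho (x + center u v))
    [set t | half_tiles u v t /\ t `<=` tile (lat u v) rho (x + center u v)].
Proof.
move=> ruv lx; have D0 := rhombic_cross h01 ruv; have D0' : cross (- u) (- v) != 0 by rewrite crossNN.
have u0 : u <> 0 by move=> e; move: D0; rewrite e /cross /= !mul0r subrr eqxx.
have v0 : v <> 0 by move=> e; move: D0; rewrite e /cross /= !mulr0 subrr eqxx.
have uv0 : u <> v by move=> e; move: D0; rewrite e /cross mulrC subrr eqxx.
have card_tri (y : R * R) a b : a <> 0 -> b <> 0 -> a <> b -> (tri y a b #= `I_3)%card.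
  move=> a0 b0 ab; apply: card_set3.
  - by move=> /addrI.
  - by rewrite -[X in _ <> X]addr0 => /addrI.
  - by rewrite -[X in _ <> X]addr0 => /addrI.
split.
- move=> t [[y [ly [->|->]]] tV]; split=> //; first exact: card_tri.
  by apply: card_tri => [/eqP|/eqP|/oppr_inj//]; rewrite oppr_eq0 => /eqP.
- apply/seteqP; split=> z; first by case=> t [_ tV] hz; exact: hull_mono tV _ hz.
  move=> hz; have triS : half_tiles u v (tri x u v) by exists x; split=> //; left.
  have triV := tri_tile h01 ruv lx.
  have [h0|hn0] := eqVneq h 0; last first.
    exists (tri x u v); first by split.
    apply: hull_mono hz => p /(tile_vertices h01 ruv lx)[//|[h0 _]].
    by rewrite h0 eqxx in hn0.
  have [c1 c2 c3 c4] : [/\ co1 u v x <= co1 u v z, co2 u v x <= co2 u v z,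
      - (co1 u v x + 1) <= - co1 u v z & - (co2 u v x + 1) <= - co2 u v z].
    have B p : tile (lat u v) rho (x + center u v) p -> [/\ co1 u v x <= co1 u v p, co2 u v x <= co2 u v p,
      - (co1 u v x + 1) <= - co1 u v p & - (co2 u v x + 1) <= - co2 u v p].
      move=> /(tile_vertices h01 ruv lx)[[[|]|]|[_]] /= ->;
        rewrite ?co1D ?co2D ?(co_u D0) ?(co_v D0); split; lra.
    split.
    - by apply: (hull_half _ hz) => p /B[].
    - by apply: (hull_half _ hz) => p /B[].
    - rewrite -(coNN u v z).1; apply: (hull_half _ hz) => p /B[].
      by rewrite -(coNN u v p).1.
    - rewrite -(coNN u v z).2; apply: (hull_half _ hz) => p /B[].
      by rewrite -(coNN u v p).2.
  have [le1|gt1] := leP (co1 u v z + co2 u v z) (co1 u v x + co2 u v x + 1).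
    by exists (tri x u v); [split|apply/(tri_hullE D0)].
  have lxuv : lat u v (x + u + v) by apply: latD; [apply: latD => //; exact: lat1|exact: lat2].
  exists (tri (x + u + v) (- u) (- v)).
    split; first by exists (x + u + v); split=> //; right.
    have e1 : x + u + v + - u = x + v by rewrite addrAC addrK.
    have e2 : x + u + v + - v = x + u by rewrite addrK.
    move=> p; rewrite /tri e1 e2 => -[[|]|] /= ->.
    + by apply: triV; left; right.
    + by apply: triV; left; left.
    + split=> //; have [m [n e]] : exists m n : R, x + u + v - x = (m * u.1 + n * v.1, m * u.2 + n * v.2) /\ (m = 1 /\ n = 1).
        exists 1, 1; split=> //; rewrite -[x + u + v]addrA (addrC (x + _)) addKr; congr pair; rewrite /=; ring.
      rewrite nsq_center e.1 center_dot// e.2.1 e.2.2 h0; ring.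
  by apply/(tri_hullE D0'); rewrite !coNN !co1D !co2D !(co_u D0) !(co_v D0); split; lra.
- move=> t t' [St _] [St' _] [z [zt zt']].
  exact: (half_tiles_disjoint h01 ruv St St' zt zt').
Qed.

Lemma congruent_refl_tri u v x : congruent (tri x u v) (tri 0 u v).
Proof.
exists (fun p => p - x); split.
  by move=> p q; rewrite !edist_nsq opprD opprK addrACA addNr addr0.
rewrite /tri !image_setU !image_set1; congr (_ `|` _ `|` _); congr set1.
- by rewrite addrC addKr add0r.
- by rewrite addrC addKr add0r.
- by rewrite subrr.
Qed.

Lemma congruent_neg_tri u v x : congruent (tri x (- u) (- v)) (tri 0 u v).
Proof.
exists (fun p => x - p); split.
  by move=> p q; rewrite !edist_nsq opprD opprK addrACA subrr add0r addrC nsqC.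
rewrite /tri !image_setU !image_set1; congr (_ `|` _ `|` _); congr set1.
- by rewrite opprD opprK addNKr add0r.
- by rewrite opprD opprK addNKr add0r.
- by rewrite subrr.
Qed.

Lemma rhombic_delaunay_congruent u v (a : R) : rhombic h u v -> 0 <= a -> a ^+ 2 = 8 - 8 * h ->
  delaunay_lattice_packing (triangle a 2 2) (lat u v).
Proof.
move=> ruv a0 ah; have [u4 v4 uv] := ruv; split.
- by exists u, v; split=> //; have := rhombic_cross h01 ruv; rewrite /cross.
- exact: rhombic_packing u4 v4 uv h01.
have e2 p : nsq p = 4 -> Num.sqrt (nsq p) = 2.
  by move=> ->; rewrite -[4](_ : 2 ^+ 2 = 4) ?sqrtr_sqr ?ger0_norm//; ring.
exists (tri 0 u v).
  exists (0 + u), (0 + v), 0; split=> //; rewrite !add0r edist_nsq.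
  - have -> : nsq (u - v) = a ^+ 2.
      have -> : nsq (u - v) = nsq u + nsq v - 2 * dot u v by rewrite /nsq /dot /=; ring.
      by rewrite u4 v4 uv ah; ring.
    by rewrite sqrtr_sqr ger0_norm.
  - by rewrite subr0 e2.
  - by rewrite sub0r e2// -u4 /nsq /= !sqrrN.
exists (half_tiles u v); last first.
  by move=> t [x [_ [->|->]]]; [exact: congruent_refl_tri|exact: congruent_neg_tri].
exists (tiles u v); split.
- exact: tiles_delaunay.
- move=> t [x [lx [->|->]]].
    exists (tile (lat u v) rho (x + center u v)); first by exists x; split=> //; left.
    exact: tri_tile.
  exists (tile (lat u v) rho (x - center u v)); first by exists x; split=> //; right.
  have lx' : lat (- u) (- v) x by rewrite latNN.
  by have := tri_tile h01 (rhombicN ruv) lx'; rewrite latNN (centerN h01).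
- move=> V [x [lx [->|->]]]; first exact: tile_dissection.
  have lx' : lat (- u) (- v) x by rewrite latNN.
  by have := tile_dissection (rhombicN ruv) lx'; rewrite latNN (centerN h01) half_tilesNN.
Qed.

End rhombic_delaunay.

(** * An empty triangle spans the lattice *)

Section empty_triangle.
Variables (R : realType) (u0 v0 u v c s0 : R * R) (rho : R).
Local Notation X := (lat u0 v0).
Hypotheses (D0 : cross u v != 0) (X0 : X s0) (Xu : X (s0 + u)) (Xv : X (s0 + v)).
Hypotheses (c0 : nsq (s0 - c) = rho) (cu : nsq (s0 + u - c) = rho) (cv : nsq (s0 + v - c) = rho).
Hypothesis ec : empty_circle X rho c.

(* The power of a point of the triangle is minus a sum of nonnegative terms. *)
Lemma empty_triangle (s t : R) : 0 <= s -> 0 <= t -> s + t <= 1 ->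
  X (s * u.1 + t * v.1, s * u.2 + t * v.2) ->
  [/\ s * t = 0, (1 - s - t) * s = 0 & (1 - s - t) * t = 0].
Proof.
move=> hs ht st Xz; have := ec (latD X0 Xz).
have D := D0.
have u_gt0 : 0 < nsq u by apply: nsq_gt0; apply/eqP => e; move: D; rewrite e /cross /= !mul0r subrr eqxx.
have v_gt0 : 0 < nsq v by apply: nsq_gt0; apply/eqP => e; move: D; rewrite e /cross /= !mulr0 subrr eqxx.
have uv_gt0 : 0 < nsq (u - v).
  by apply: nsq_gt0; rewrite subr_eq0; apply/eqP => e; move: D; rewrite e /cross mulrC subrr eqxx.
have -> : nsq (s0 + (s * u.1 + t * v.1, s * u.2 + t * v.2) - c) =
   (1 - s - t) * nsq (s0 - c) + s * nsq (s0 + u - c) + t * nsq (s0 + v - c)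
   - ((1 - s - t) * s * nsq u + (1 - s - t) * t * nsq v + s * t * nsq (u - v)).
  by rewrite /nsq /=; ring.
have -> : (1 - s - t) * nsq (s0 - c) + s * nsq (s0 + u - c) + t * nsq (s0 + v - c) = rho.
  by rewrite c0 cu cv; ring.
rewrite -subr_ge0 addrAC subrr add0r oppr_ge0 => le0.
have st1 : 0 <= 1 - s - t by lra.
have e1 : 0 <= (1 - s - t) * s * nsq u by rewrite !mulr_ge0// ltW.
have e2 : 0 <= (1 - s - t) * t * nsq v by rewrite !mulr_ge0// ltW.
have e3 : 0 <= s * t * nsq (u - v) by rewrite !mulr_ge0// ltW.
have Z (x y : R) : 0 < y -> x * y = 0 -> x = 0.
  by move=> y0 /eqP; rewrite mulf_eq0 (gt_eqF y0) orbF => /eqP.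
by split; [apply: (Z _ _ uv_gt0)|apply: (Z _ _ u_gt0)|apply: (Z _ _ v_gt0)]; lra.
Qed.

Lemma empty_triangle_lat : X = lat u v.
Proof.
have lu : X u by rewrite -(addKr s0 u) addrC; exact: latB.
have lv : X v by rewrite -(addKr s0 v) addrC; exact: latB.
have lz w (m : int) : X w -> X (w *~ m).
  move=> [i [j ->]]; exists (i * m), (j * m).
  by rewrite mulrzDl !mulrzA.
have sub : lat u v `<=` X by move=> _ [m [n ->]]; apply: latD; exact: lz.
apply/seteqP; split=> // p Xp.
set m := Num.floor (co1 u v p); set n := Num.floor (co2 u v p).
set s := co1 u v p - m%:~R; set t := co2 u v p - n%:~R.
have [s0' s1] : 0 <= s /\ s < 1.
  by have := floor_itv (co1 u v p); rewrite /s -/m intrD => /andP[]; lra.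
have [t0' t1] : 0 <= t /\ t < 1.
  by have := floor_itv (co2 u v p); rewrite /t -/n intrD => /andP[]; lra.
have pE : p = (s * u.1 + t * v.1, s * u.2 + t * v.2) + (u *~ m + v *~ n).
  rewrite [LHS](coE D0) !mulz_pair /s /t; congr pair; rewrite /=; ring.
have prod0 (x y : R) : x * y = 0 -> x = 0 \/ y = 0.
  by move=> /eqP; rewrite mulf_eq0 => /orP[] /eqP; [left|right].
have lmn : lat u v (u *~ m + v *~ n) by exists m, n.
have Xq : X (s * u.1 + t * v.1, s * u.2 + t * v.2).
  have -> : (s * u.1 + t * v.1, s * u.2 + t * v.2) = p - (u *~ m + v *~ n) by rewrite {1}pE addrK.
  by apply: latB => //; exact: sub.
have [st|st] := leP (s + t) 1.
  have [e1 e2 e3] := empty_triangle s0' t0' st Xq; rewrite pE.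
  have [-> ->] : s = 0 /\ t = 0.
    by case: (prod0 _ _ e1) (prod0 _ _ e2) (prod0 _ _ e3) => ? [] ? [] ?; split; lra.
  by rewrite !mul0r !addr0 add0r.
(* Reflection in the center of the parallelogram moves a point of the other half into the triangle,
   where [(1 - s) * (1 - t)] would have to vanish although [s] and [t] are below 1. *)
have Xq' : X ((1 - s) * u.1 + (1 - t) * v.1, (1 - s) * u.2 + (1 - t) * v.2).
  have -> : ((1 - s) * u.1 + (1 - t) * v.1, (1 - s) * u.2 + (1 - t) * v.2) =
    u + v - (s * u.1 + t * v.1, s * u.2 + t * v.2) by congr pair; rewrite /=; ring.
  by apply: latB => //; apply: latD.
have [|||e _ _] := empty_triangle _ _ _ Xq'; [lra..|].
by case: (prod0 _ _ e); lra.
Qed.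

End empty_triangle.

Section converse.
Variable R : realType.
Implicit Types X : set (R * R).

(** The cell containing the origin, a lattice point, provides a triangle; a single one suffices,
    since it spans the lattice. *)
Lemma delaunay_triangle X T : lattice X -> delaunay_congruent X T ->
  exists t0 t, [/\ T t0, congruent t t0, t `<=` X &
    exists c rho, empty_circle X rho c /\ forall p, t p -> nsq (p - c) = rho].
Proof.
move=> [u0 [v0 [_ ->]]] [t0 Tt0 [S [D [dD SV dis]] cong]].
have X0 : hull (lat u0 v0) 0 by apply: sub_hull; exact: lat0.
move: X0; rewrite -(delaunay_cover dD) => -[V DV V0].
have [_ cover _] := dis V DV; move: V0; rewrite -cover => -[t [St tV] t0V].
have [_ VX] := delaunay_tile dD DV.
exists t0, t; split=> //.
- exact: cong.
- by move=> p /tV/VX.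
have [c [r [h1 h2 _]]] := delaunay_circum dD DV.
exists c, (r ^+ 2); have E x : edist x c ^+ 2 = nsq (x - c) by rewrite edist_nsq sqr_sqrtr// nsq_ge0.
have VE x : V x -> nsq (x - c) = r ^+ 2 by rewrite -E => /h1 ->.
split=> [x Xx|x /tV]; last exact: VE.
(* A negative [r] would leave [t] without points, but its hull contains 0. *)
have r0 : 0 <= r.
  rewrite leNgt; apply/negP => r0.
  suff : 1 <= dot (0 : R * R) 0 by rewrite /dot /= !mul0r addr0; lra.
  by apply: (hull_half _ t0V) => p /tV/h1 e; move: r0; rewrite -e ltNge sqrtr_ge0.
by rewrite -E ler_pXn2r ?nnegrE ?sqrtr_ge0// leNgt; apply/negP; exact: h2.
Qed.

Lemma rhombic_of_delaunay X (h a : R) : 0 <= h <= 1 / 2 -> 0 <= a -> a ^+ 2 = 8 - 8 * h ->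
  delaunay_lattice_packing (triangle a 2 2) X -> exists u v, rhombic h u v /\ X = lat u v.
Proof.
move=> h01 a0 ah [lX _ dX].
have [t0 [t [[p [q [s [-> pq qs sp]]]] [f [fd ft]] tX [c [rho [ec tc]]]]]] := delaunay_triangle lX dX.
have pre y : [set p; q; s] y -> exists2 x, t x & f x = y by rewrite -ft.
have [p' tp fp] := pre p (or_introl (or_introl erefl)).
have [q' tq fq] := pre q (or_introl (or_intror erefl)).
have [s' ts fs] := pre s (or_intror erefl).
have dist x y d : 0 <= d -> edist (f x) (f y) = d -> nsq (x - y) = d ^+ 2.
  by move=> d0; rewrite fd edist_nsq => <-; rewrite sqr_sqrtr// nsq_ge0.
rewrite -fp -fq -fs in pq qs sp.
have e1 : nsq (p' - q') = 8 - 8 * h by rewrite -ah; exact: dist.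
have e2 : nsq (q' - s') = 4 by rewrite (dist _ _ 2)//; ring.
have e3 : nsq (p' - s') = 4 by rewrite nsqC (dist _ _ 2)//; ring.
have ruv : rhombic h (p' - s') (q' - s').
  split=> //; have : nsq (p' - q') = nsq (p' - s') + nsq (q' - s') - 2 * dot (p' - s') (q' - s').
    by rewrite /nsq /dot /=; ring.
  by rewrite e1 e2 e3; lra.
exists (p' - s'), (q' - s'); split=> //.
case: lX => u0 [v0 [_ XE]]; rewrite -/(lat u0 v0) in XE; subst X.
have cc x y : y + (x - y) = x :> R * R by rewrite addrC subrK.
apply: (@empty_triangle_lat _ _ _ _ _ c s' rho (rhombic_cross h01 ruv)); rewrite ?cc; 
  by [exact: tX|exact: tc|].
Qed.

End converse.

(** * The values of the densities and the extremal lattices *)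

Section main.
Variable R : realType.
Implicit Types (lam mu h a : R) (X : set (R * R)).

Lemma deltas_eq lam K X : 0 < K <= 4 ->
  (forall Y, separable_packing lam 1 Y -> sparse K Y) ->
  separable_packing lam 1 X -> lattice X -> ((pi / K)%:E <= upper_density 1 X)%E ->
  delta lam = (pi / K)%:E /\ delta_lattice lam = (pi / K)%:E.
Proof.
move=> K4 sp sX lX dX; split; apply/eqP; rewrite eq_le; apply/andP; split.
- by apply: ge_ereal_sup => _ [Y sY <-]; apply: upper_density_le => //; exact: sp.
- by apply: le_trans dX _; apply: ereal_sup_ubound; exists X.
- by apply: ge_ereal_sup => _ [Y [sY _] <-]; apply: upper_density_le => //; exact: sp.
- by apply: le_trans dX _; apply: ereal_sup_ubound; exists X.
Qed.

Lemma rhombic_exists h : 0 <= h <= 1 / 2 -> exists u v : R * R, rhombic h u v.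
Proof.
move=> /andP[h0 h1]; exists (2, 0), (2 * h, 2 * Num.sqrt (1 - h ^+ 2)).
have e : Num.sqrt (1 - h ^+ 2) ^+ 2 = 1 - h ^+ 2.
  by rewrite sqr_sqrtr// subr_ge0; nra.
split; rewrite /nsq /dot /=; [ring| |ring].
by rewrite !exprMn e; ring.
Qed.

Lemma rhombic_lattice h (u v : R * R) : 0 <= h <= 1 / 2 -> rhombic h u v -> lattice (lat u v).
Proof.
by move=> h01 ruv; exists u, v; split=> //; have := rhombic_cross h01 ruv; rewrite /cross.
Qed.

(* [mu] is the largest parameter for which the rhombic lattice with angle parameter [h] is separable. *)
Lemma delta_rhombic lam mu h : 0 <= h <= 1 / 2 -> 0 <= lam <= mu -> mu ^+ 2 = 1 - h ^+ 2 ->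
  (forall Y, separable_packing lam 1 Y -> sparse (4 * mu) Y) ->
  delta lam = (pi / (4 * mu))%:E /\ delta_lattice lam = (pi / (4 * mu))%:E.
Proof.
move=> h01 /andP[lam0 lammu] muh sp.
have [u [v ruv]] := rhombic_exists h01; have [u4 v4 uv] := ruv.
have mu0 : 0 <= mu by exact: le_trans lammu.
apply: (@deltas_eq _ _ (lat u v)) => //.
- exact: (lam_bounds u4 v4 uv h01 mu0 muh).
- by apply: (rhombic_separable u4 v4 uv h01) => //; rewrite -muh ler_pXn2r// nnegrE.
- exact: rhombic_lattice h01 ruv.
- exact: (rhombic_upper_density_ge u4 v4 uv h01 mu0 muh).
Qed.

Lemma delaunay_rhombic lam mu h a : 0 <= h <= 1 / 2 -> 0 <= lam <= mu -> mu ^+ 2 = 1 - h ^+ 2 ->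
  0 <= a -> a ^+ 2 = 8 - 8 * h -> delta lam = (pi / (4 * mu))%:E ->
  (exists X, delaunay_lattice_packing (triangle a 2 2) X) /\
  (forall X, delaunay_lattice_packing (triangle a 2 2) X ->
     separable_packing lam 1 X /\ has_density 1 X (delta lam)).
Proof.
move=> h01 /andP[lam0 lammu] muh a0 ah dE; split.
  have [u [v ruv]] := rhombic_exists h01; exists (lat u v).
  exact: (rhombic_delaunay_congruent h01 ruv a0 ah).
move=> X /(rhombic_of_delaunay h01 a0 ah)[u [v [[u4 v4 uv] ->]]].
have mu0 : 0 <= mu by exact: le_trans lammu.
split; last by rewrite dE; exact: (rhombic_has_density u4 v4 uv h01 mu0 muh).
by apply: (rhombic_separable u4 v4 uv h01) => //; rewrite -muh ler_pXn2r// nnegrE.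
Qed.

Lemma sqrt12 : Num.sqrt 12 = 4 * (Num.sqrt 3 / 2) :> R.
Proof.
rewrite (_ : 12 = 2 ^+ 2 * 3); last by ring.
by rewrite sqrtrM ?sqr_ge0// sqrtr_sqr ger0_norm//; field.
Qed.

Lemma sqrt3_half : (Num.sqrt 3 / 2) ^+ 2 = 3 / 4 :> R.
Proof. by rewrite expr_div_n sqr_sqrtr//; field. Qed.

(** For [y ^+ 2 = 2 - 2 * h] the radicand [y ^+ 2 - lam ^+ 2] is the square of [1 - h]. So the equal
    edges of the triangle have length 2, as in the rhombic lattice. *)
Lemma xe_eq1 lam h : 0 <= h <= 1 / 2 -> lam ^+ 2 = 1 - h ^+ 2 ->
  xe lam (Num.sqrt (2 - 2 * h)) = 1.
Proof.
move=> /andP[h0 h1] lamh; rewrite /xe sqr_sqrtr; last by lra.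
have -> : 2 - 2 * h - lam ^+ 2 = (1 - h) ^+ 2 by rewrite lamh; ring.
by rewrite sqrtr_sqr ger0_norm; [field|]; lra.
Qed.

End main.

Theorem theorem1 (R : realType) (lam : R) (hlam : 0 <= lam <= 1) :
  [/\ delta lam = delta_lattice lam,
      lam <= Num.sqrt 3 / 2 -> delta lam = (pi / Num.sqrt 12)%:E,
      Num.sqrt 3 / 2 <= lam -> delta lam = (pi / (4 * lam))%:E,
      lam <= Num.sqrt 3 / 2 ->
        (exists X : set (R * R), delaunay_lattice_packing (Te_reg 1) X) /\
        (forall X : set (R * R), delaunay_lattice_packing (Te_reg 1) X ->
           separable_packing lam 1 X /\ has_density 1 X (delta lam)) &
      Num.sqrt 3 / 2 <= lam ->
        (exists X : set (R * R),
           delaunay_lattice_packing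
             (Te lam (Num.sqrt (2 - 2 * Num.sqrt (1 - lam ^+ 2)))) X) /\
        (forall X : set (R * R),
           delaunay_lattice_packing
             (Te lam (Num.sqrt (2 - 2 * Num.sqrt (1 - lam ^+ 2)))) X ->
           separable_packing lam 1 X /\ has_density 1 X (delta lam))].
Proof.
have /andP[lam0 lam1] := hlam.
(* [h = 1 / 2] is the hexagonal lattice, separable up to the parameter [Num.sqrt 3 / 2]. *)
have h1 : 0 <= (1 / 2 : R) <= 1 / 2 by rewrite lexx andbT divr_ge0.
have muE : (Num.sqrt 3 / 2) ^+ 2 = 1 - (1 / 2) ^+ 2 :> R by rewrite sqrt3_half; field.
have small : lam <= Num.sqrt 3 / 2 -> delta lam = (pi / Num.sqrt 12)%:E /\ delta_lattice lam = (pi / Num.sqrt 12)%:E.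
  move=> le; rewrite sqrt12; apply: (delta_rhombic h1 _ muE); first by rewrite lam0.
  by move=> Y [pY _]; rewrite -sqrt12; exact: packing_sparse.
(* The cosine of the angle of the rhombic lattice for which [lam] is the limiting parameter. *)
pose h := Num.sqrt (1 - lam ^+ 2).
have hE : h ^+ 2 = 1 - lam ^+ 2 by rewrite sqr_sqrtr// subr_ge0; nra.
have h0 : 0 <= h by exact: sqrtr_ge0.
have hlarge : Num.sqrt 3 / 2 <= lam -> 0 <= h <= 1 / 2.
  move=> le; rewrite h0 /=; apply: ler_of_sqr => //.
  rewrite hE; have : (Num.sqrt 3 / 2) ^+ 2 <= lam ^+ 2 by rewrite ler_pXn2r// nnegrE// divr_ge0// sqrtr_ge0.
  by rewrite muE; lra.
have lamE : lam ^+ 2 = 1 - h ^+ 2 by rewrite hE; ring.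
have large : Num.sqrt 3 / 2 <= lam -> delta lam = (pi / (4 * lam))%:E /\ delta_lattice lam = (pi / (4 * lam))%:E.
  move=> le; apply: (delta_rhombic (hlarge le) _ lamE); first by rewrite lam0 lexx.
  by move=> Y; exact: separable_sparse.
split.
- by have [/small|/ltW/large] := leP lam (Num.sqrt 3 / 2); case=> -> ->.
- by move=> /small[].
- by move=> /large[].
- move=> le; rewrite /Te_reg mulr1; apply: (delaunay_rhombic h1 _ muE) => //; first by rewrite lam0.
    by field.
  by rewrite -sqrt12; have [] := small le.
- move=> le; rewrite /Te (xe_eq1 (hlarge le) lamE) mulr1; apply: (delaunay_rhombic (hlarge le) _ lamE).
  + by rewrite lam0 lexx.
  + by rewrite mulr_ge0// sqrtr_ge0.
  + rewrite exprMn sqr_sqrtr; first by rewrite -/h; ring.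
    by rewrite -/h; have := hlarge le; lra.
  + by have [] := large le.
Qed.
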